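(* Let $\varphi:\mathbb{D}\to\mathbb{D}$ be an inner function. Then $\mathcal{M}(\varphi)=\mathcal{M}(\mathcal{D})$ if and only if $\varphi$ is a finite Blaschke product.
   Context: $\mathbb{D}$ is the open unit disc in $\mathbb{C}$ and $A$ is normalized Lebesgue area measure on $\mathbb{D}$. The Dirichlet space $\mathcal{D}$ is the space of holomorphic $f$ on $\mathbb{D}$ with $\|f\|_{\mathcal{D}}^2=|f(0)|^2+\int_{\mathbb{D}}|f'(z)|^2\,dA(z)<\infty$. $\mathcal{M}(\mathcal{D})$ is the algebra of multipliers of $\mathcal{D}$, i.e. the functions $u$ on $\mathbb{D}$ such that $uf\in\mathcal{D}$ for every $f\in\mathcal{D}$ (so $f\mapsto uf$ is automatically bounded). For a holomorphic map $\varphi:\mathbb{D}\to\mathbb{D}$ and $u\in\mathcal{D}$, the weighted composition operator is $(W_{u,\varphi}f)(z)=u(z)f(\varphi(z))$, and $\mathcal{M}(\varphi)=\{u\in\mathcal{D}: W_{u,\varphi}\text{ is bounded from }\mathcal{D}\text{ into }\mathcal{D}\}$. An inner function is a bounded holomorphic function on $\mathbb{D}$ whose radial boundary values have modulus $1$ almost everywhere on the unit circle; here, as a self-map of $\mathbb{D}$, it is nonconstant. *)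

(* Defs.v *)
From HB Require Import structures.
From mathcomp Require Import all_boot all_order all_algebra.
From mathcomp Require Import all_classical all_reals all_analysis.
From mathcomp Require Import complex.

Set Implicit Arguments.
Unset Strict Implicit.
Unset Printing Implicit Defensive.

Import Order.TTheory GRing.Theory Num.Theory.
Import numFieldNormedType.Exports.
Import Normc.

Local Open Scope classical_set_scope.
Local Open Scope ring_scope.
Local Open Scope complex_scope.

(* Functions on the disc are represented by total functions R[i] -> R[i]; every
   notion below depends only on the values taken on [disc]. *)
Section Dirichlet.
Context {R : realType}.
Implicit Types (f u phi : R[i] -> R[i]) (z w : R[i]).

Definition disc : set R[i] := [set z | `|z| < 1].

(* The regular module R[i]^o over the field R[i] makes this the complex
   derivative. *)
Definition holomorphic_disc f : Prop :=
  forall z, disc z -> derivable (f : R[i]^o -> R[i]^o) z 1.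

Definition self_map_disc phi : Prop :=
  holomorphic_disc phi /\ (forall z, disc z -> disc (phi z)).

(* The factor 1/pi makes the disc have total mass 1. *)
Definition area_integral (g : R[i] -> \bar R) : \bar R :=
  ((pi^-1)%:E *
   \int[lebesgue_measure \x lebesgue_measure]_(p in
       [set p : R * R | disc (p.1 +i* p.2)]) g (p.1 +i* p.2))%E.

Definition dirichlet_sqnorm f : \bar R :=
  ((normc (f 0) ^+ 2)%:E +
   area_integral (fun z => (normc (derive1 (f : R[i]^o -> R[i]^o) z) ^+ 2)%:E))%E.

Definition dirichlet : set (R[i] -> R[i]) :=
  [set f | holomorphic_disc f /\ (dirichlet_sqnorm f < +oo)%E].

Definition dirichlet_norm f : R := Num.sqrt (fine (dirichlet_sqnorm f)).

Definition multiplier : set (R[i] -> R[i]) :=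
  [set u | forall f, dirichlet f -> dirichlet (fun z => u z * f z)].

Definition wcomp u phi f : R[i] -> R[i] := fun z => u z * f (phi z).

Definition wcomp_bounded u phi : Prop :=
  (forall f, dirichlet f -> dirichlet (wcomp u phi f)) /\
  exists M : R, forall f, dirichlet f ->
    dirichlet_norm (wcomp u phi f) <= M * dirichlet_norm f.

Definition wcomp_multiplier phi : set (R[i] -> R[i]) :=
  [set u | dirichlet u /\ wcomp_bounded u phi].

Definition cis (t : R) : R[i] := cos t +i* sin t.

Definition inner_disc phi : Prop :=
  [/\ holomorphic_disc phi,
      exists M : R, forall z, disc z -> normc (phi z) <= M &
      {ae lebesgue_measure, forall t : R, t \in `[0, 2 * pi] ->
        exists2 w : R[i],
          (phi (r%:C * cis t) : R[i]^o) @[r --> (1 : R)^'-] --> (w : R[i]^o) & `|w| = 1}].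

Definition nonconstant_disc phi : Prop :=
  exists z w, [/\ disc z, disc w & phi z != phi w].

(* Zeros are listed in s with multiplicity.  The empty product (a unimodular
   constant) is allowed, but is never a map from the disc into itself. *)
Definition finite_blaschke phi : Prop :=
  exists (c : R[i]) (s : seq R[i]),
    [/\ `|c| = 1, (forall a, a \in s -> disc a) &
        forall z, disc z ->
          phi z = c * \prod_(a <- s) ((z - a) / (1 - a^* * z))].

End Dirichlet.

(* Main.v *)
Require Import Defs.
From HB Require Import structures.
From mathcomp Require Import all_boot all_order all_algebra.
From mathcomp Require Import all_classical all_reals all_analysis.
From mathcomp Require Import complex.
From mathcomp Require Import measurable_realfun ring lra.
Set Implicit Arguments.
Unset Strict Implicit.
Unset Printing Implicit Defensive.
Import Order.TTheory GRing.Theory Num.Theory.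
Import numFieldNormedType.Exports.
Import Normc.
Local Open Scope classical_set_scope.
Local Open Scope ring_scope.
Local Open Scope complex_scope.

(** Write [D(f)] for the sum of [n |f_n|^2] and [E(f)] for the sum of [|f_n|^2] over the
    Taylor coefficients of [f]. Parseval's identity on the disc ([dirichletP]) shows that
    the Dirichlet space consists of the holomorphic [f] with [D(f)] finite, and that its
    squared norm is [|f_0|^2 + kappa D(f)] with [kappa > 0]. Everything else rests on two
    balances for the division [h = h(a) + (z - a) q]. With [b_a] the Blaschke factor at [a],
    [k_a = 1 / (1 - a^* z)] and [L] the backward shift, for which
    [h = (1 - |a|^2) h(a) k_a + b_a L], they read
    [E(h) = E(L) + (1 - |a|^2) |h(a)|^2] and [D(h) = D(L) + (1 - |a|^2) E(q)]
    ([step_htotal], [step_dtotal] give the inequalities that are used).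

    Let [phi] be a finite Blaschke product. Then [f o phi] lies in the Dirichlet space for
    every [f] in it: in Horner's scheme [T = c_0 + phi T'] the terms [k_a c_0] and
    [k_a phi T'] are orthogonal when [phi(a) = 0], which bounds [E(T)] by a multiple of
    the sum of the [|c_i|^2], and a multiplication by [phi] adds at most a multiple of [E] to [D]
    ([dirichlet_comp]). So a multiplier [u] maps [f] to [u (f o phi)], and boundedness
    follows by the uniform boundedness principle ([uniform_boundedness]). Conversely,
    dividing repeatedly by the zeros of [phi] writes every [g] of the space as a finite sum
    of [e_i (g_i o phi)], with fixed multipliers [e_i] and with [g_i] in the space
    ([blaschke_module]): the balances bound the coefficients produced at pass [k], weighted
    by [k], by the energies still present, and these by the losses of [D] and [E]. If all
    [u (f o phi)] lie in the space, then so does [u g], the sum of the [e_i u (g_i o phi)].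

    Let now [phi] be inner with the two sets equal. The function 1 is a multiplier, and
    applying its weighted composition to the identity function shows that [D(phi)] is
    finite. Radial limits of modulus one give [E(k_c phi) >= 1 / (1 - |c|^2)] for all [c]
    ([inner_full_modulus]). If [phi(a) = 0] then [phi = (z - a) q] where [q] has at least the
    Hardy norm of [k_a phi], so the quotient [phi / b_a] has Dirichlet integral at most
    [D(phi) - 1] and inherits all hypotheses ([remove_zero]). After finitely many steps a
    zero-free [psi] is left. For it [1 - |psi(a)|^2 <= (1 - |a|^2) E(q)], and by the second
    balance this tends to 0 as [|a|] tends to 1 ([boundary_modulus]). Hence [1 / psi] has
    modulus at most 1 at the origin, and as [E(psi) <= 1] the function [psi] is a unimodular
    constant ([zero_free_constant]). *)

(** * Moduli and complex derivatives *)

Section Modulus.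
Variable R : realType.
Implicit Types (z w : R[i]).

Lemma normcE' z : `|z| = (normc z)%:C. Proof. by []. Qed.

Lemma normc_ge0 z : 0 <= normc z.
Proof. by rewrite -ler0c -normcE'. Qed.

Lemma ncM z w : normc (z * w) = normc z * normc w.
Proof. exact: normcM. Qed.

Lemma ncD z w : normc (z + w) <= normc z + normc w.
Proof. exact: le_normcD. Qed.

Lemma ncN z : normc (- z) = normc z.
Proof. exact: normcN. Qed.

Lemma ncB z w : normc (z - w) <= normc z + normc w.
Proof. by rewrite -(ncN w); exact: ncD. Qed.

Lemma ncBC z w : normc (z - w) = normc (w - z).
Proof. by rewrite -ncN opprB. Qed.

Lemma ncV z : normc z^-1 = (normc z)^-1.
Proof. exact: normcV. Qed.

Lemma ncX z n : normc (z ^+ n) = normc z ^+ n.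
Proof. by elim: n => [|n IH]; rewrite ?expr0 ?normc1// !exprS ncM IH. Qed.

Lemma ncR (x : R) : normc x%:C = `|x|.
Proof. by rewrite /= expr0n/= addr0 sqrtr_sqr. Qed.

Lemma ncJ z : normc z^* = normc z.
Proof. by case: z => a b /=; rewrite sqrrN. Qed.

Lemma nc_sq z : normc z ^+ 2 = complex.Re z ^+ 2 + complex.Im z ^+ 2.
Proof. by case: z => a b /=; rewrite sqr_sqrtr// addr_ge0// sqr_ge0. Qed.

Lemma nc_sqJ z : (normc z ^+ 2)%:C = z * z^*.
Proof. by rewrite rmorphXn/= -normcE' sqr_normc. Qed.

Lemma nc_eq0 z : (normc z == 0) = (z == 0).
Proof. by apply/eqP/eqP => [/eq0_normc//|->]; rewrite normc0. Qed.

Lemma nc_gt0 z : (0 < normc z) = (z != 0).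
Proof. by rewrite lt_neqAle normc_ge0 andbT eq_sym nc_eq0. Qed.

Lemma ncRe z : `|complex.Re z| <= normc z.
Proof. by rewrite -lecR -normcE' normc_ge_Re. Qed.

Lemma ncIm z : `|complex.Im z| <= normc z.
Proof.
rewrite -(@ler_pXn2r _ 2)// ?nnegrE ?normc_ge0// nc_sq real_normK ?num_real//.
by rewrite lerDr sqr_ge0.
Qed.

Lemma nc_le_ReIm z : normc z <= `|complex.Re z| + `|complex.Im z|.
Proof.
rewrite {1}(complexE z) (le_trans (ncD _ _))// ncM !ncR lerD//.
by rewrite /= expr0n/= add0r expr1n sqrtr1 mul1r.
Qed.

Lemma nc_sum (I : Type) (r : seq I) (P : pred I) (F : I -> R[i]) :
  normc (\sum_(i <- r | P i) F i) <= \sum_(i <- r | P i) normc (F i).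
Proof.
elim/big_ind2 : _ => //; first by rewrite normc0.
by move=> x y u v h1 h2; rewrite (le_trans (ncD _ _))// lerD.
Qed.

Lemma nc_prod (I : Type) (r : seq I) (F : I -> R[i]) :
  normc (\prod_(i <- r) F i) = \prod_(i <- r) normc (F i).
Proof. by elim/big_ind2 : _ => [|x y u v <- <-|//]; rewrite ?normc1 ?ncM. Qed.

Lemma discE z : disc z <-> normc z < 1.
Proof. by rewrite /disc /= normcE' -ltcR. Qed.

Lemma disc0 : disc (0 : R[i]).
Proof. by rewrite discE normc0. Qed.

Lemma cReD z w : complex.Re (z + w) = complex.Re z + complex.Re w.
Proof. by case: z w => [a b] [c d]. Qed.
Lemma cImD z w : complex.Im (z + w) = complex.Im z + complex.Im w.
Proof. by case: z w => [a b] [c d]. Qed.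
Lemma cReN z : complex.Re (- z) = - complex.Re z.
Proof. by case: z. Qed.
Lemma cImN z : complex.Im (- z) = - complex.Im z.
Proof. by case: z. Qed.
Lemma cReM z w : complex.Re (z * w) =
  complex.Re z * complex.Re w - complex.Im z * complex.Im w.
Proof. by case: z w => [a b] [c d]. Qed.
Lemma cImM z w : complex.Im (z * w) =
  complex.Re z * complex.Im w + complex.Im z * complex.Re w.
Proof. by case: z w => [a b] [c d]. Qed.

Lemma cplx_eq z w :
  complex.Re z = complex.Re w -> complex.Im z = complex.Im w -> z = w.
Proof. by case: z w => [a b] [c d] /= -> ->. Qed.

Lemma nc_small0 z : (forall e : R, 0 < e -> normc z <= e) -> z = 0.
Proof.
move=> h; apply/eqP; rewrite -nc_eq0 eq_le normc_ge0 andbT.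
by apply/ler_addgt0Pr => e e0; rewrite add0r h.
Qed.

Lemma nc_lip z w : `|normc z - normc w| <= normc (z - w).
Proof.
have H (x y : R[i]) : normc x - normc y <= normc (x - y).
  by rewrite lerBlDr -{1}[x](subrK y) ncD.
by rewrite ler_norml H andbT lerNl opprB ncBC H.
Qed.

End Modulus.
Arguments normc_ge0 {R}.
#[global] Hint Extern 0 (is_true (@Order.le _ _ _ (normc _))) => exact: normc_ge0 : core.

Section ComplexDerivative.
Variable R : realType.
Implicit Types (f g : R[i] -> R[i]) (z w B : R[i]).

(** Differentiability with real radii: the norm of [R[i]^o] takes values in [R[i]], which
    estimates would have to translate at every step. *)
Definition cder f z B := forall e : R, 0 < e -> exists2 d : R, 0 < d &
  forall w, normc w < d -> normc (f (z + w) - f z - B * w) <= e * normc w.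

Lemma quotient_cvgP f z B :
  ((fun h : R[i]^o => h^-1 *: ((f : R[i]^o -> R[i]^o) (h + z) - f z)) @ 0^' -->
    (B : R[i]^o)) <-> cder f z B.
Proof.
split.
- move/cvgrPdist_le => H e e0.
  have e0' : 0 < e%:C by rewrite ltcR.
  have [d /= d0 Hd] := H _ e0'.
  have [d' dE] : exists d' : R, d = d'%:C.
    by apply/complex_realP; rewrite ger0_real// ltW.
  subst d; rewrite ltcR in d0; exists d' => // w wd.
  have [->|w0] := eqVneq w 0; first by rewrite addr0 subrr mulr0 subrr normc0 mulr0.
  have := Hd w; rewrite /ball_/= sub0r normrN normcE' ltcR => /(_ wd w0).
  rewrite normcE' lecR => Hw.
  rewrite (_ : _ - _ - _ = - (w * (B - w^-1 *: (f (w + z) - f z)))); last first.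
    by rewrite mulrBr /GRing.scale/= mulrA mulfV// mul1r (addrC z) (mulrC B); ring.
  by rewrite ncN ncM mulrC ler_wpM2r.
- move=> H; apply/cvgrPdist_le => e e0.
  have [e' eE] : exists e' : R, e = e'%:C.
    by apply/complex_realP; rewrite ger0_real// ltW.
  subst e; rewrite ltcR in e0.
  have [d d0 Hd] := H _ e0.
  exists d%:C; first by rewrite /= ltcR.
  move=> w; rewrite /ball_/= sub0r normrN normcE' ltcR => wd w0.
  rewrite normcE' lecR -(@ler_pM2r _ (normc w)) ?nc_gt0// -ncM.
  rewrite (_ : _ * w = - (f (z + w) - f z - B * w)) ?ncN ?Hd//.
  by rewrite mulrBl /GRing.scale/= mulrAC mulVf// mul1r (addrC z); ring.
Qed.

Lemma derivableP_cder f z :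
  derivable (f : R[i]^o -> R[i]^o) z 1 <-> exists B, cder f z B.
Proof.
rewrite /derivable.
rewrite (_ : (fun h : R[i]^o => _) =
  (fun h : R[i]^o => h^-1 *: (((f : R[i]^o -> R[i]^o) (h + z)) - f z))); last first.
  by apply/funext => h /=; rewrite /GRing.scale/= mulr1.
split => [/cvg_ex[B HB]|[B HB]].
  by exists B; apply/quotient_cvgP.
by apply/cvg_ex; exists B; apply/quotient_cvgP.
Qed.

Lemma cder_derive1 f z B : cder f z B -> derive1 (f : R[i]^o -> R[i]^o) z = B.
Proof. by move/quotient_cvgP => H; rewrite /derive1; apply/cvg_lim. Qed.

Lemma cder_cont f z B : cder f z B ->
  forall e : R, 0 < e -> exists2 d : R, 0 < d &
    forall w, normc (w - z) < d -> normc (f w - f z) <= e.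
Proof.
move=> H e e0; have [d d0 Hd] := H 1 ltr01.
have K0 : 0 < 1 + normc B by rewrite (lt_le_trans ltr01)// lerDl.
exists (Num.min d (e / (1 + normc B))); first by rewrite lt_min d0 divr_gt0.
move=> w; rewrite lt_min => /andP[wd we].
have := Hd _ wd; rewrite [z + _]addrC subrK => Hw.
rewrite (_ : f w - f z = (f w - f z - B * (w - z)) + B * (w - z)); last by ring.
rewrite (le_trans (ncD _ _))// (le_trans (lerD Hw (lexx _)))// ncM -mulrDl.
by rewrite mulrC -ler_pdivlMr// ltW.
Qed.

Lemma cder_ext f g z B : cder f z B ->
  (exists2 d : R, 0 < d & forall w, normc (w - z) < d -> f w = g w) -> cder g z B.
Proof.
move=> H [d d0 fg] e e0; have [d' d'0 Hd] := H _ e0.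
exists (Num.min d d'); first by rewrite lt_min d0.
move=> w; rewrite lt_min => /andP[wd wd'].
have <- : f (z + w) = g (z + w) by apply: fg; rewrite [z + _]addrC addrK.
have <- : f z = g z by apply: fg; rewrite subrr normc0.
exact: Hd.
Qed.

End ComplexDerivative.

(** * Additive functions of rectangles *)

Section AdditiveRectangles.
Variable R : realType.
Implicit Types (x y a b c d e : R).

Lemma half_pow_small (K e : R) : 0 < e -> exists n, K / 2 ^+ n < e.
Proof.
move=> e0.
have [n Hn] : exists n : nat, K / e < n%:R.
  by exists (Num.bound `|K / e|); rewrite (le_lt_trans (ler_norm _))// archi_boundP.
exists n; rewrite ltr_pdivrMr ?exprn_gt0// mulrC -ltr_pdivrMr//.
rewrite (lt_trans Hn)// -natrX ltr_nat; exact: ltn_expl.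
Qed.

Variable Phi : R -> R -> R -> R -> R[i].
Variables a b c d : R.
Hypotheses (ab : a <= b) (cd : c <= d).
Hypothesis addx : forall x0 x1 x2 y0 y1, a <= x0 -> x0 <= x1 -> x1 <= x2 -> x2 <= b ->
  c <= y0 -> y0 <= y1 -> y1 <= d -> Phi x0 x2 y0 y1 = Phi x0 x1 y0 y1 + Phi x1 x2 y0 y1.
Hypothesis addy : forall x0 x1 y0 y1 y2, a <= x0 -> x0 <= x1 -> x1 <= b ->
  c <= y0 -> y0 <= y1 -> y1 <= y2 -> y2 <= d ->
  Phi x0 x1 y0 y2 = Phi x0 x1 y0 y1 + Phi x0 x1 y1 y2.

Section Regular.
Hypothesis small : forall p q, a <= p <= b -> c <= q <= d -> forall e, 0 < e ->
  exists2 dl : R, 0 < dl & forall x0 x1 y0 y1, a <= x0 -> x0 <= p -> p <= x1 -> x1 <= b ->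
    c <= y0 -> y0 <= q -> q <= y1 -> y1 <= d -> x1 - x0 < dl -> y1 - y0 < dl ->
    normc (Phi x0 x1 y0 y1) <= e * ((x1 - x0) + (y1 - y0)) ^+ 2.

Let W n : R := (b - a) / 2 ^+ n.
Let H n : R := (d - c) / 2 ^+ n.
Let Q n (p : R * R) := normc (Phi p.1 (p.1 + W n) p.2 (p.2 + H n)).

Let Wge0 n : 0 <= W n.
Proof. by rewrite divr_ge0 ?exprn_ge0// subr_ge0. Qed.
Let Hge0 n : 0 <= H n.
Proof. by rewrite divr_ge0 ?exprn_ge0// subr_ge0. Qed.
Let WS n : W n = W n.+1 + W n.+1.
Proof. by rewrite /W exprS; field; rewrite expf_neq0. Qed.
Let HS n : H n = H n.+1 + H n.+1.
Proof. by rewrite /H exprS; field; rewrite expf_neq0. Qed.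

Let step n (p : R * R) : R * R :=
  let p2 := (p.1 + W n.+1, p.2) in
  let p3 := (p.1, p.2 + H n.+1) in
  let p4 := (p.1 + W n.+1, p.2 + H n.+1) in
  if Q n p <= 4 * Q n.+1 p then p else
  if Q n p <= 4 * Q n.+1 p2 then p2 else
  if Q n p <= 4 * Q n.+1 p3 then p3 else p4.

Fixpoint corner n : R * R := if n is m.+1 then step m (corner m) else (a, c).

Let inside n (p : R * R) :=
  [/\ a <= p.1, p.1 + W n <= b, c <= p.2 & p.2 + H n <= d].

Let step_bounds n p : [/\ p.1 <= (step n p).1, (step n p).1 + W n.+1 <= p.1 + W n,
  p.2 <= (step n p).2 & (step n p).2 + H n.+1 <= p.2 + H n].
Proof.
have := Wge0 n.+1; have := Hge0 n.+1; rewrite (WS n) (HS n) /step => h w.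
by do 3 (case: ifP => _ /=; first (by split; lra)); split; lra.
Qed.

Let corner_inside n : inside n (corner n).
Proof.
elim: n => [|n [h1 h2 h3 h4]].
  by split => //=; rewrite ?/W ?/H expr0 divr1 addrC subrK.
rewrite /=; have [k1 k2 k3 k4] := step_bounds n (corner n).
by split; [exact: le_trans k1|exact: le_trans h2|exact: le_trans k3|exact: le_trans h4].
Qed.

Let step_Q n p : inside n p -> Q n p <= 4 * Q n.+1 (step n p).
Proof.
move=> [h1 h2 h3 h4]; have w := Wge0 n.+1; have h := Hge0 n.+1.
rewrite /step; case: ifPn => // q1; case: ifPn => //= q2; case: ifPn => //= q3.
rewrite -!ltNge in q1 q2 q3.
set q4 := Q n.+1 _.
suff : Q n p <= Q n.+1 p + Q n.+1 (p.1 + W n.+1, p.2) + Q n.+1 (p.1, p.2 + H n.+1) + q4.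
  by move=> k; lra.
have h2' : p.1 + W n.+1 + W n.+1 <= b by rewrite -addrA -WS.
have h4' : p.2 + H n.+1 + H n.+1 <= d by rewrite -addrA -HS.
have -> : Q n p = normc (Phi p.1 (p.1 + W n.+1 + W n.+1) p.2 (p.2 + H n.+1 + H n.+1)).
  by rewrite /Q -!addrA -WS -HS.
rewrite (@addx _ (p.1 + W n.+1)); try by lra.
rewrite (@addy p.1 _ _ (p.2 + H n.+1)); try by lra.
rewrite (@addy (p.1 + W n.+1) _ _ (p.2 + H n.+1)); try by lra.
rewrite /q4 /Q /=.
set P1 := Phi p.1 _ p.2 _; set P3 := Phi p.1 _ _ _.
set P2 := Phi _ _ p.2 _; set P4 := Phi _ _ _ _.
rewrite (_ : P1 + P3 + (P2 + P4) = P1 + P2 + P3 + P4); last by ring.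
by do 3 (apply: (le_trans (ncD _ _)); apply: lerD => //).
Qed.

Let corner_Q n : Q 0 (corner 0) <= 4 ^+ n * Q n (corner n).
Proof.
elim: n => [|n IH]; first by rewrite expr0 mul1r.
rewrite (le_trans IH)// exprSr -mulrA ler_wpM2l ?exprn_ge0//.
exact/step_Q/corner_inside.
Qed.

Let corner_mono m n : (m <= n)%N -> [/\ (corner m).1 <= (corner n).1,
  (corner n).1 + W n <= (corner m).1 + W m,
  (corner m).2 <= (corner n).2 & (corner n).2 + H n <= (corner m).2 + H m].
Proof.
move/subnK => <-; elim: (n - m)%N => [|k [h1 h2 h3 h4]]; first by split.
rewrite addSn /=; have [k1 k2 k3 k4] := step_bounds (k + m) (corner (k + m)).
by split; [exact: le_trans k1|exact: le_trans h2|exact: le_trans k3|exact: le_trans h4].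
Qed.

Let nested (u w : nat -> R) : (forall n, 0 <= w n) ->
  (forall m n, (m <= n)%N -> u m <= u n /\ u n + w n <= u m + w m) ->
  exists p, forall n, u n <= p <= u n + w n.
Proof.
move=> w0 mono; exists (sup (range u)) => n.
have ub m : u m <= u n + w n.
  have [mn|/ltnW nm] := leqP m n.
    by rewrite (le_trans (mono _ _ mn).1)// lerDl.
  by rewrite (le_trans _ (mono _ _ nm).2)// lerDl.
apply/andP; split.
  apply: ub_le_sup; last by exists n.
  by exists (u n + w n) => _ [m _ <-].
apply: ge_sup; first by exists (u 0), 0.
by move=> _ [m _ <-].
Qed.

(** Goursat's argument: repeated quartering keeps a quarter carrying at least a quarter
    of the modulus, and at the limit point the bound is quadratic in the side. *)
Lemma additive_small_eq0 : Phi a b c d = 0.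
Proof.
have [p Hp] := @nested (fun n => (corner n).1) W Wge0
  (fun m n mn => let: And4 h1 h2 _ _ := corner_mono mn in conj h1 h2).
have [q Hq] := @nested (fun n => (corner n).2) H Hge0
  (fun m n mn => let: And4 _ _ h1 h2 := corner_mono mn in conj h1 h2).
have W0 : a + W 0 = b by rewrite /W expr0 divr1 addrC subrK.
have H0 : c + H 0 = d by rewrite /H expr0 divr1 addrC subrK.
have pab : a <= p <= b by have := Hp 0; rewrite /= W0.
have qcd : c <= q <= d by have := Hq 0; rewrite /= H0.
apply: nc_small0 => e e0.
pose K := (b - a) + (d - c).
have K0 : 0 <= K by rewrite addr_ge0 ?subr_ge0.
have e'0 : 0 < e / (1 + K ^+ 2) by rewrite divr_gt0// ltr_pwDl// sqr_ge0.
have [dl dl0 Hdl] := small pab qcd e'0.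
have [n Hn] := half_pow_small K dl0.
have WHK : W n + H n = K / 2 ^+ n by rewrite -mulrDl.
have := corner_Q n; rewrite {1}/Q /= W0 H0 => Hc; apply: (le_trans Hc).
have [h1 h2 h3 h4] := corner_inside n.
have /andP[p1 p2] := Hp n; have /andP[q1 q2] := Hq n.
have w := Wge0 n; have h := Hge0 n.
have : Q n (corner n) <= e / (1 + K ^+ 2) * (K / 2 ^+ n) ^+ 2.
  have := Hdl _ _ _ _ h1 p1 p2 h2 h3 q1 q2 h4.
  rewrite !(addrC _ (W n)) !(addrC _ (H n)) !addrK WHK.
  rewrite /Q !(addrC _ (W n)) !(addrC _ (H n)); apply; lra.
move/(ler_wpM2l (exprn_ge0 n (ler0n R 4))) => Hle; apply: (le_trans Hle).
rewrite (_ : 4 ^+ n * _ = e * (K ^+ 2 / (1 + K ^+ 2))); last first.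
  have -> : 4 ^+ n = (2 ^+ n) ^+ 2 :> R by rewrite -exprM mulnC exprM; congr (_ ^+ _); rewrite -natrX.
  by field; rewrite expf_neq0//= gt_eqF// ltr_pwDl// sqr_ge0.
rewrite -[leRHS]mulr1 ler_wpM2l ?(ltW e0)// ler_pdivrMr ?mul1r ?lerDr//.
by rewrite ltr_pwDl// sqr_ge0.
Qed.

End Regular.
End AdditiveRectangles.

Section Exceptional.
Variable R : realType.
Implicit Types (x y a b c d e p q : R).
Variable Phi : R -> R -> R -> R -> R[i].

Definition additive_on a b c d :=
  (forall x0 x1 x2 y0 y1, a <= x0 -> x0 <= x1 -> x1 <= x2 -> x2 <= b ->
    c <= y0 -> y0 <= y1 -> y1 <= d ->
    Phi x0 x2 y0 y1 = Phi x0 x1 y0 y1 + Phi x1 x2 y0 y1) /\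
  (forall x0 x1 y0 y1 y2, a <= x0 -> x0 <= x1 -> x1 <= b ->
    c <= y0 -> y0 <= y1 -> y1 <= y2 -> y2 <= d ->
    Phi x0 x1 y0 y2 = Phi x0 x1 y0 y1 + Phi x0 x1 y1 y2).

Definition small_at a b c d p q := forall e, 0 < e ->
  exists2 dl : R, 0 < dl & forall x0 x1 y0 y1, a <= x0 -> x0 <= p -> p <= x1 -> x1 <= b ->
    c <= y0 -> y0 <= q -> q <= y1 -> y1 <= d -> x1 - x0 < dl -> y1 - y0 < dl ->
    normc (Phi x0 x1 y0 y1) <= e * ((x1 - x0) + (y1 - y0)) ^+ 2.

(** A point where only continuity is known is cut out by a shrinking rectangle. *)
Lemma additive_exceptional_eq0 a b c d p q : a <= b -> c <= d -> additive_on a b c d ->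
  (forall p' q', a <= p' <= b -> c <= q' <= d -> p' != p \/ q' != q ->
    small_at a b c d p' q') ->
  (forall e, 0 < e -> exists2 dl : R, 0 < dl & forall x0 x1 y0 y1,
    a <= x0 -> x0 <= x1 -> x1 <= b -> c <= y0 -> y0 <= y1 -> y1 <= d ->
    p - dl <= x0 -> x1 <= p + dl -> q - dl <= y0 -> y1 <= q + dl ->
    normc (Phi x0 x1 y0 y1) <= e) ->
  Phi a b c d = 0.
Proof.
move=> ab cd [ax ay] sm van.
have sub a' b' c' d' : a <= a' -> a' <= b' -> b' <= b -> c <= c' -> c' <= d' -> d' <= d ->
    (forall p' q', a' <= p' <= b' -> c' <= q' <= d' -> p' != p \/ q' != q) ->
    Phi a' b' c' d' = 0.
  move=> h1 h2 h3 h4 h5 h6 hne; apply: (@additive_small_eq0 R Phi a' b' c' d') => //.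
  - by move=> *; apply: ax => //; lra.
  - by move=> *; apply: ay => //; lra.
  - move=> p' q' hp hq e e0.
    have [||dl dl0 Hd] := sm p' q' _ _ (hne _ _ hp hq) e e0; [lra|lra|].
    by exists dl => // *; apply: Hd => //; lra.
have dgx x y0 y1 : a <= x <= b -> c <= y0 -> y0 <= y1 -> y1 <= d -> Phi x x y0 y1 = 0.
  move=> hx h1 h2 h3; apply/eqP; rewrite -subr_eq0 -{1}(addrK (Phi x x y0 y1) (Phi x x y0 y1)).
  by rewrite -ax ?subrr ?sub0r ?addNr// ?subr_eq0//; lra.
have dgy x0 x1 y : a <= x0 -> x0 <= x1 -> x1 <= b -> c <= y <= d -> Phi x0 x1 y y = 0.
  move=> h1 h2 h3 hy; apply/eqP; rewrite -subr_eq0 -{1}(addrK (Phi x0 x1 y y) (Phi x0 x1 y y)).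
  by rewrite -ay ?subrr ?sub0r ?addNr// ?subr_eq0//; lra.
have [pin|pout] := boolP ((a <= p <= b) && (c <= q <= d)); last first.
  apply: sub => // p' q' hp hq; apply/orP; rewrite -negb_and; apply: contra pout.
  by move=> /andP[/eqP <- /eqP <-]; rewrite hp.
have /andP[/andP[pa pb] /andP[qc qd]] := pin.
apply: nc_small0 => e e0; have [dl dl0 Hd] := van e e0.
pose x1 := Num.max a (p - dl); pose x2 := Num.min b (p + dl).
pose y1 := Num.max c (q - dl); pose y2 := Num.min d (q + dl).
have [ax1 px1] : a <= x1 /\ p - dl <= x1 by rewrite /x1 !le_max !lexx orbT.
have [x2b x2p] : x2 <= b /\ x2 <= p + dl by rewrite /x2 !ge_min !lexx orbT.
have [cy1 qy1] : c <= y1 /\ q - dl <= y1 by rewrite /y1 !le_max !lexx orbT.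
have [y2d y2q] : y2 <= d /\ y2 <= q + dl by rewrite /y2 !ge_min !lexx orbT.
have x1p : x1 <= p by rewrite /x1 ge_max pa/=; lra.
have px2 : p <= x2 by rewrite /x2 le_min pb/=; lra.
have y1q : y1 <= q by rewrite /y1 ge_max qc/=; lra.
have qy2 : q <= y2 by rewrite /y2 le_min qd/=; lra.
have L : Phi a x1 c d = 0.
  have := erefl x1; rewrite {1}/x1; case: (leP a (p - dl)) => [h|h] hx; last first.
    by rewrite -hx dgx//; lra.
  apply: sub => //; [lra|]; move=> p' q' /andP[_ hp] _; left.
  by rewrite lt_eqF//; lra.
have Rr : Phi x2 b c d = 0.
  have := erefl x2; rewrite {1}/x2; case: (leP b (p + dl)) => [h|h] hx.
    by rewrite -hx dgx//; lra.
  apply: sub => //; [lra|]; move=> p' q' /andP[hp _] _; left.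
  by rewrite gt_eqF//; lra.
have B : Phi x1 x2 c y1 = 0.
  have := erefl y1; rewrite {1}/y1; case: (leP c (q - dl)) => [h|h] hx; last first.
    by rewrite -hx dgy//; lra.
  apply: sub => //; [lra|lra|]; move=> p' q' _ /andP[_ hp]; right.
  by rewrite lt_eqF//; lra.
have T : Phi x1 x2 y2 d = 0.
  have := erefl y2; rewrite {1}/y2; case: (leP d (q + dl)) => [h|h] hx.
    by rewrite -hx dgy//; lra.
  apply: sub => //; [lra|lra|]; move=> p' q' _ /andP[hp _]; right.
  by rewrite gt_eqF//; lra.
rewrite (@ax a x1 b c d) ?(@ax x1 x2 b c d); try lra.
rewrite (@ay x1 x2 c y1 d) ?(@ay x1 x2 y1 y2 d); try lra.
rewrite L Rr B T !add0r !addr0; apply: Hd => //; lra.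
Qed.

End Exceptional.

(** * Integrals of complex functions of a real variable *)

Section ComplexIntegral.
Variable R : realType.
Implicit Types (a b : R) (z : R[i]) (F G : R -> R[i]).
Local Notation mu := (@lebesgue_measure R).

Definition cint a b F : R[i] :=
  (\int[mu]_(x in `[a, b]) complex.Re (F x)) +i* (\int[mu]_(x in `[a, b]) complex.Im (F x)).

Definition ccont a b F := forall x, a <= x <= b -> forall e : R, 0 < e ->
  exists2 d : R, 0 < d & forall y, a <= y <= b -> `|y - x| < d -> normc (F y - F x) <= e.

Lemma ccont_comp_real (f : R[i] -> R) a b F :
  (forall z w, `|f z - f w| <= normc (z - w)) -> ccont a b F ->
  {within `[a, b], continuous (f \o F)}.
Proof.
move=> lip H; apply/subspace_continuousP => x /=; rewrite in_itv/= => hx.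
apply/cvgrPdist_le => e e0; have [d d0 Hd] := H x hx e e0.
rewrite /fmap /= near_withinE near_simpl; exists d => //= y /= xy.
rewrite in_itv/= => hy; rewrite distrC (le_trans (lip _ _))//.
by apply: Hd => //; rewrite distrC.
Qed.

Lemma ccont_Re a b F : ccont a b F ->
  mu.-integrable `[a, b] (EFin \o (fun x => complex.Re (F x))).
Proof.
move=> H; apply: continuous_compact_integrable; first exact: segment_compact.
apply: (ccont_comp_real (f := @complex.Re R)) => // z w.
by rewrite (le_trans _ (ncRe _))// cReD cReN.
Qed.

Lemma ccont_Im a b F : ccont a b F ->
  mu.-integrable `[a, b] (EFin \o (fun x => complex.Im (F x))).
Proof.
move=> H; apply: continuous_compact_integrable; first exact: segment_compact.
apply: (ccont_comp_real (f := @complex.Im R)) => // z w.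
by rewrite (le_trans _ (ncIm _))// cImD cImN.
Qed.

Lemma ccont_cst a b z : ccont a b (fun=> z).
Proof. by move=> x _ e e0; exists 1 => // y _ _; rewrite subrr normc0 ltW. Qed.

Lemma ccontD a b F G : ccont a b F -> ccont a b G -> ccont a b (fun x => F x + G x).
Proof.
move=> hF hG x hx e e0; have e2 : 0 < e / 2 by lra.
have [d1 d10 H1] := hF x hx _ e2; have [d2 d20 H2] := hG x hx _ e2.
exists (Num.min d1 d2); first by rewrite lt_min d10.
move=> y hy; rewrite lt_min => /andP[y1 y2].
rewrite opprD addrACA (le_trans (ncD _ _))//.
by have := H1 y hy y1; have := H2 y hy y2; lra.
Qed.

Lemma ccontM a b F G : ccont a b F -> ccont a b G -> ccont a b (fun x => F x * G x).
Proof.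
move=> hF hG x hx e e0.
pose K := 1 + normc (F x) + normc (G x).
have K1 : 1 <= K by rewrite /K -addrA lerDl addr_ge0.
have K0 : 0 < K by lra.
have e2 : 0 < Num.min 1 (e / (K + K)) by rewrite lt_min ltr01 divr_gt0// addr_gt0.
have [d1 d10 H1] := hF x hx _ e2; have [d2 d20 H2] := hG x hx _ e2.
exists (Num.min d1 d2); first by rewrite lt_min d10.
move=> y hy; rewrite lt_min => /andP[y1 y2].
have := H1 y hy y1; have := H2 y hy y2.
rewrite !le_min => /andP[g1 g2] /andP[f1 f2].
rewrite (_ : _ - _ = (F y - F x) * G y + F x * (G y - G x)); last by ring.
rewrite (le_trans (ncD _ _))// !ncM.
have Gy : normc (G y) <= K.
  rewrite -(subrK (G x) (G y)) (le_trans (ncD _ _))// /K.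
  by have := normc_ge0 (F x); lra.
have Fx : normc (F x) <= K by rewrite /K; have := normc_ge0 (G x); lra.
rewrite (le_trans (lerD (ler_pM _ _ f2 Gy) (ler_pM _ _ Fx g2)))//.
by rewrite mulrC -mulrDl mulrC divfK// gt_eqF// addr_gt0.
Qed.

Lemma cintD a b F G : ccont a b F -> ccont a b G ->
  cint a b (fun x => F x + G x) = cint a b F + cint a b G.
Proof.
move=> hF hG; apply: cplx_eq; rewrite /cint /=.
  rewrite -RintegralD//; [|exact: ccont_Re..].
  by apply: eq_Rintegral => x _; rewrite cReD.
rewrite -RintegralD//; [|exact: ccont_Im..].
by apply: eq_Rintegral => x _; rewrite cImD.
Qed.

Lemma cintZ a b F z : ccont a b F -> cint a b (fun x => z * F x) = z * cint a b F.
Proof.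
move=> hF; have iR := ccont_Re hF; have iI := ccont_Im hF.
have iZ (u : R) (f : R -> R) : mu.-integrable `[a, b] (EFin \o f) ->
    mu.-integrable `[a, b] (EFin \o (fun x => u * f x)).
  by move=> hf; apply: (integrableZl _ u hf).
apply: cplx_eq; rewrite /cint.
  rewrite [RHS]cReM /= -!RintegralZl//= -RintegralB//; try exact: iZ.
  by apply: eq_Rintegral => x _; rewrite cReM.
rewrite [RHS]cImM /= -!RintegralZl//= -RintegralD//; try exact: iZ.
by apply: eq_Rintegral => x _; rewrite cImM.
Qed.

Lemma eq_cint a b F G : (forall x, a <= x <= b -> F x = G x) -> cint a b F = cint a b G.
Proof.
by move=> FG; apply: cplx_eq; rewrite /cint /=; apply: eq_Rintegral => x;
  rewrite inE/= in_itv/= => hx; rewrite FG.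
Qed.

Lemma cint_pt a F : cint a a F = 0.
Proof. by rewrite /cint set_itv1 !Rintegral_set1. Qed.

Lemma cint_split a m b F : a <= m -> m <= b -> ccont a b F ->
  cint a b F = cint a m F + cint m b F.
Proof.
move=> am mb hF; have iR := ccont_Re hF; have iI := ccont_Im hF.
have sub : [set` `]m, b]] `<=` [set` `[a, b]].
  by move=> x /=; rewrite !in_itv/= => /andP[h ->]; rewrite andbT (le_trans am)// ltW.
have := @Rintegral_itvB _ _ _ _ m iR; have := @Rintegral_itvB _ _ _ _ m iI.
rewrite !bnd_simp => /(_ am mb) hI /(_ am mb) hR.
rewrite Rintegral_itv_obnd_cbnd in hI; last by apply: integrableS iI.
rewrite Rintegral_itv_obnd_cbnd in hR; last by apply: integrableS iR.
by apply: cplx_eq; rewrite /cint /= -?hR -?hI addrC subrK.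
Qed.

(** The factor 2 comes from bounding the two components separately. *)
Lemma cint_bound a b F (M : R) : a <= b -> ccont a b F ->
  (forall x, a <= x <= b -> normc (F x) <= M) -> normc (cint a b F) <= 2 * M * (b - a).
Proof.
move=> ab hF HM; rewrite (le_trans (nc_le_ReIm _))// /cint /=.
have mub : fine (mu `[a, b]) = b - a.
  rewrite lebesgue_measure_itv/= lte_fin; case: ltP => //= ba.
  lra.
have mufin : (mu `[a, b] < +oo)%E.
  by rewrite lebesgue_measure_itv/=; case: ifP => _; rewrite ?ltry ?EFinN -?EFinB ?ltry.
have K (f : R -> R) : mu.-integrable `[a, b] (EFin \o f) ->
    (forall x, a <= x <= b -> `|f x| <= M) -> `|\int[mu]_(x in `[a, b]) f x| <= M * (b - a).
  move=> hf fM; rewrite (le_trans (le_normr_Rintegral _ _))// -mub -Rintegral_cst//.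
  apply: le_Rintegral => //.
  - exact: (integrable_norm hf).
  - by apply/integrableP; split; [exact: measurable_cst|
      rewrite integral_cst//= lte_mul_pinfty// ?lee_fin ?normr_ge0].
rewrite (_ : 2 * M * (b - a) = M * (b - a) + M * (b - a)); last by ring.
apply: lerD; apply: K; [exact: ccont_Re| |exact: ccont_Im|].
  by move=> x hx; rewrite (le_trans (ncRe _))// HM.
by move=> x hx; rewrite (le_trans (ncIm _))// HM.
Qed.

Definition cdrv G F := forall x : R,
  is_derive x 1 (fun y : R => complex.Re (G y)) (complex.Re (F x)) /\
  is_derive x 1 (fun y : R => complex.Im (G y)) (complex.Im (F x)).

Lemma cdrv_cst z : cdrv (fun=> z) (fun=> 0).
Proof. by move=> x; split; exact: is_derive_cst. Qed.

Lemma cdrvD F F' G G' : cdrv F F' -> cdrv G G' ->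
  cdrv (fun x => F x + G x) (fun x => F' x + G' x).
Proof.
move=> hF hG x; have [a1 a2] := hF x; have [b1 b2] := hG x; split.
  rewrite cReD (_ : (fun y => _) = (fun y => complex.Re (F y)) + (fun y => complex.Re (G y))).
    exact: is_deriveD.
  by apply/funext => y; rewrite cReD.
rewrite cImD (_ : (fun y => _) = (fun y => complex.Im (F y)) + (fun y => complex.Im (G y))).
  exact: is_deriveD.
by apply/funext => y; rewrite cImD.
Qed.

Lemma cdrvM F F' G G' : cdrv F F' -> cdrv G G' ->
  cdrv (fun x => F x * G x) (fun x => F' x * G x + F x * G' x).
Proof.
move=> hF hG x; have [a1 a2] := hF x; have [b1 b2] := hG x; split.
  rewrite (_ : (fun y => _) = (fun y => complex.Re (F y)) * (fun y => complex.Re (G y)) -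
    (fun y => complex.Im (F y)) * (fun y => complex.Im (G y))).
    apply: is_derive_eq; rewrite cReD !cReM /GRing.scale/=; ring.
  by apply/funext => y; rewrite cReM.
rewrite (_ : (fun y => _) = (fun y => complex.Re (F y)) * (fun y => complex.Im (G y)) +
    (fun y => complex.Im (F y)) * (fun y => complex.Re (G y))).
  apply: is_derive_eq; rewrite cImD !cImM /GRing.scale/=; ring.
by apply/funext => y; rewrite cImM.
Qed.

Lemma cdrv_ext F F' G' : (forall x, F' x = G' x) -> cdrv F F' -> cdrv F G'.
Proof. by move=> FG hF x; rewrite -FG. Qed.

Lemma cdrv_real : cdrv (fun x => x%:C) (fun=> 1).
Proof. by move=> x; split; [exact: is_derive_id|exact: is_derive_cst]. Qed.

Lemma cdrv_cis : cdrv (@cis R) (fun x => 'i * cis x).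
Proof.
move=> x; split; rewrite /cis /=.
  rewrite mul0r mul1r sub0r; exact: is_derive_cos.
rewrite mul0r mul1r add0r; exact: is_derive_sin.
Qed.

Lemma cdrvX F F' n : cdrv F F' -> cdrv (fun x => F x ^+ n.+1) (fun x => n.+1%:R * F x ^+ n * F' x).
Proof.
move=> hF; elim: n => [|n IH].
  by apply: cdrv_ext hF => x; rewrite expr0 mulr1 mul1r.
rewrite (_ : (fun x => F x ^+ n.+2) = (fun x => F x * F x ^+ n.+1)); last first.
  by apply/funext => x; rewrite exprS.
apply: cdrv_ext (cdrvM hF IH) => x.
by rewrite -[n.+2%:R]natr1 !exprS; ring.
Qed.

Lemma cdrv_cont G F a b : cdrv G F -> ccont a b G.
Proof.
move=> hG x hx e e0; have [h1 h2] := hG x.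
have c1 : {for x, continuous (fun y => complex.Re (G y))}.
  by apply: differentiable_continuous; apply/derivable1_diffP; exact: (@ex_derive _ _ _ _ _ _ _ h1).
have c2 : {for x, continuous (fun y => complex.Im (G y))}.
  by apply: differentiable_continuous; apply/derivable1_diffP; exact: (@ex_derive _ _ _ _ _ _ _ h2).
have e2 : 0 < e / 2 by lra.
move/cvgrPdist_le : c1 => /(_ _ e2); rewrite near_simpl => -[d1 /= d10 H1].
move/cvgrPdist_le : c2 => /(_ _ e2); rewrite near_simpl => -[d2 /= d20 H2].
exists (Num.min d1 d2); first by rewrite lt_min d10.
move=> y _; rewrite lt_min distrC => /andP[y1 y2].
have := H1 y y1; have := H2 y y2 => k2 k1.
rewrite ncBC (le_trans (nc_le_ReIm _))// cReD cReN cImD cImN; lra.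
Qed.

Lemma cint_FTC G F a b : a <= b -> cdrv G F -> ccont a b F -> cint a b F = G b - G a.
Proof.
rewrite le_eqVlt => /predU1P[->|ab] hG hF; first by rewrite cint_pt subrr.
have K (g f : R -> R) : (forall x : R, is_derive x 1 g (f x)) ->
    {within `[a, b], continuous f} -> \int[mu]_(x in `[a, b]) f x = g b - g a.
  move=> gf cf; rewrite /Rintegral (@continuous_FTC2 _ f g)//.
    have cg x : {for x, continuous g}.
      by apply: differentiable_continuous; apply/derivable1_diffP; exact: (@ex_derive _ _ _ _ _ _ _ (gf x)).
    split; first by move=> x _; exact: (@ex_derive _ _ _ _ _ _ _ (gf x)).
    + exact/cvg_at_right_filter/cg.
    + exact/cvg_at_left_filter/cg.
  by move=> x _; rewrite derive1E; exact: (@derive_val _ _ _ _ _ _ _ (gf x)).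
apply: cplx_eq; rewrite /cint /=.
  rewrite (K (fun y => complex.Re (G y)) _ (fun x => (hG x).1)) ?cReD ?cReN//.
  apply: (ccont_comp_real (f := @complex.Re R)) => // z w.
  by rewrite (le_trans _ (ncRe _))// cReD cReN.
rewrite (K (fun y => complex.Im (G y)) _ (fun x => (hG x).2)) ?cImD ?cImN//.
apply: (ccont_comp_real (f := @complex.Im R)) => // z w.
by rewrite (le_trans _ (ncIm _))// cImD cImN.
Qed.

End ComplexIntegral.

(** * The unit circle; sums of power series *)

Section Circle.
Variable R : realType.
Implicit Types (r t : R) (z w : R[i]).

Lemma nc_cis t : normc (cis t) = 1.
Proof. by rewrite /cis /= cos2Dsin2 sqrtr1. Qed.

Lemma nc_polar r t : normc (r%:C * cis t) = `|r|.
Proof. by rewrite ncM ncR nc_cis mulr1. Qed.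

Lemma cis0 : cis (0 : R) = 1.
Proof. by rewrite /cis cos0 sin0. Qed.

Lemma cis2pi : cis (2 * pi : R) = 1.
Proof. by rewrite /cis mulr_natl cos2pi sin2pi. Qed.

Lemma cisJ t : cis t * (cis t)^* = 1.
Proof. by rewrite -nc_sqJ nc_cis expr1n. Qed.

Lemma cdrv_cisJ : cdrv (fun t => (cis t)^*) (fun t => - 'i * (cis t)^*).
Proof.
move=> x; split; rewrite /cis /=.
  rewrite oppr0 mul0r mulrN mulN1r opprK sub0r; exact: is_derive_cos.
rewrite oppr0 mul0r add0r mulN1r; apply: is_deriveN.
Qed.

Lemma cis_lip t u : normc (cis t - cis u) <= 2 * `|t - u|.
Proof.
wlog tu : t u / u <= t.
  by move=> H; have [/H//|/ltW/H] := leP u t; rewrite ncBC distrC.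
have c : ccont u t (fun x => 'i * cis x).
  by apply: ccontM; [exact: ccont_cst|exact: cdrv_cont (@cdrv_cis R)].
rewrite -(cint_FTC tu (@cdrv_cis R) c) ger0_norm ?subr_ge0//.
rewrite (le_trans (@cint_bound _ _ _ _ 1 tu c _))// ?mulr1//.
move=> x _; rewrite ncM nc_cis mulr1.
by rewrite /= expr0n/= expr1n add0r sqrtr1.
Qed.

Lemma polar_lip r t p q : `|p| <= 1 ->
  normc (r%:C * cis t - p%:C * cis q) <= `|r - p| + 2 * `|t - q|.
Proof.
move=> p1; rewrite (_ : _ - _ = (r - p)%:C * cis t + p%:C * (cis t - cis q)); last first.
  by rewrite rmorphB/=; ring.
rewrite (le_trans (ncD _ _))// nc_polar lerD// ncM ncR.
by rewrite (le_trans _ (cis_lip t q))// ler_piMl.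
Qed.

Lemma cint_cisJX n : cint 0 (2 * pi) (fun t : R => (cis t)^* ^+ n) =
  if n == 0%N then (2 * pi)%:C else 0.
Proof.
have p0 : 0 <= 2 * pi :> R by rewrite mulr_ge0// pi_ge0.
case: n => [|n] /=.
  rewrite (cint_FTC (G := fun x => x%:C) p0) ?subr0//; first exact: cdrv_real.
  exact: ccont_cst.
have i0 : - 'i * n.+1%:R != 0 :> R[i].
  rewrite mulf_neq0 ?pnatr_eq0// oppr_eq0 eq_complex /= eqxx oner_eq0//.
have dG : cdrv (fun t : R => (- 'i * n.+1%:R)^-1 * (cis t)^* ^+ n.+1)
    (fun t => (cis t)^* ^+ n.+1).
  apply: cdrv_ext (cdrvM (cdrv_cst _) (cdrvX n cdrv_cisJ)) => t /=.
  rewrite mul0r add0r exprS; set c := (cis t)^*.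
  rewrite (_ : _ * _ * _ = (- 'i * n.+1%:R) * (c * c ^+ n)); last by ring.
  by rewrite mulrA mulVf// mul1r.
rewrite (cint_FTC p0 dG); last exact: cdrv_cont (cdrvX n cdrv_cisJ).
by rewrite cis0 cis2pi subrr.
Qed.

End Circle.

Section PowerSeriesSum.
Variable R : realType.
Implicit Types (a : nat -> R[i]) (z s : R[i]).

Definition psum a z N := \sum_(n < N) a n * z ^+ n.

Definition pconv a z s := forall e : R, 0 < e ->
  exists N0, forall N, (N0 <= N)%N -> normc (psum a z N - s) <= e.

Lemma pconv_unique_val a z s s' : pconv a z s -> pconv a z s' -> s = s'.
Proof.
move=> h1 h2; apply/eqP; rewrite -subr_eq0; apply/eqP/nc_small0 => e e0.
have e2 : 0 < e / 2 by lra.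
have [N1 H1] := h1 _ e2; have [N2 H2] := h2 _ e2.
have := H1 (maxn N1 N2) (leq_maxl _ _); have := H2 (maxn N1 N2) (leq_maxr _ _).
set S := psum _ _ _ => k2 k1.
rewrite (_ : s - s' = (S - s') - (S - s)); last by ring.
by rewrite (le_trans (ncB _ _))//; lra.
Qed.

Lemma psumS a z N : psum a z N.+1 = psum a z N + a N * z ^+ N.
Proof. by rewrite /psum big_ord_recr. Qed.

Lemma pconv_term_bounded a z s : pconv a z s ->
  exists2 M : R, 0 <= M & forall n, normc (a n) * normc z ^+ n <= M.
Proof.
move=> H; have [N0 HN] := H 1 ltr01.
exists (2 + \sum_(n < N0) normc (a n) * normc z ^+ n).
  by rewrite addr_ge0// sumr_ge0// => n _; rewrite mulr_ge0// exprn_ge0.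
move=> n; have [nN|Nn] := ltnP n N0.
  rewrite (bigD1 (Ordinal nN))//= addrCA lerDl addr_ge0// sumr_ge0// => i _.
  by rewrite mulr_ge0// exprn_ge0.
rewrite -ncX -ncM (_ : a n * z ^+ n = (psum a z n.+1 - s) - (psum a z n - s)); last first.
  by rewrite psumS; ring.
rewrite (le_trans (ncB _ _))//.
have := HN n.+1 (leqW Nn); have := HN n Nn.
have : 0 <= \sum_(n < N0) normc (a n) * normc z ^+ n.
  by rewrite sumr_ge0// => i _; rewrite mulr_ge0// exprn_ge0.
by lra.
Qed.

Lemma geo_tail_le (q : R) k N : 0 <= q -> q <= 1 / 2 ->
  \sum_(k <= n < N) q ^+ n <= 2 * q ^+ k.
Proof.
move=> q0 q2; have [Nk|kN] := leqP N k.
  by rewrite big_geq// mulr_ge0// exprn_ge0.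
rewrite -{1}[k]add0n -(subnK (ltnW kN)) big_addn addnK.
suff H m : \sum_(0 <= i < m) q ^+ (i + k) <= (2 - 2 * q ^+ m) * q ^+ k.
  rewrite (le_trans (H _))// ler_wpM2r ?exprn_ge0// gerBl mulr_ge0// exprn_ge0//.
elim: m => [|m IH]; first by rewrite big_geq// expr0 mulr1 subrr mul0r.
rewrite big_nat_recr//= (le_trans (lerD IH (lexx _)))//.
rewrite exprD -mulrDl ler_wpM2r ?exprn_ge0// exprS.
have := exprn_ge0 m q0; nra.
Qed.

(** The least nonzero coefficient would dominate the series near the origin. *)
Lemma pconv0_coef0 a (rho : R) : 0 < rho ->
  (forall z, normc z < rho -> pconv a z 0) -> forall k, a k = 0.
Proof.
move=> rho0 H; elim/ltn_ind => k IH.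
pose s := 2 / rho; have s0 : 0 < s by rewrite divr_gt0.
have hr : normc (rho / 2)%:C < rho by rewrite ncR ger0_norm; lra.
have [M M0 HM] := pconv_term_bounded (H _ hr).
apply: nc_small0 => e e0.
pose K := 2 * M * s ^+ k.+1.
have K0 : 0 <= K by rewrite !mulr_ge0// exprn_ge0// ltW.
pose x := Num.min (1 / (2 * s)) (e / (2 * (K + 1))).
have x0 : 0 < x by rewrite lt_min !divr_gt0// mulr_gt0// ltr_wpDl.
have xs : s * x <= 1 / 2.
  rewrite mulrC -ler_pdivlMr// (le_trans (y := 1 / (2 * s)))//; first by rewrite ge_min lexx.
  by rewrite !mul1r invfM.
have Kx : K * x <= e / 2.
  rewrite (@le_trans _ _ ((K + 1) * (e / (2 * (K + 1)))))//.
    by rewrite ler_pM// ?(ltW x0)// ?lerDl// ge_min lexx orbT.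
  by rewrite le_eqVlt; apply/orP; left; apply/eqP; field; rewrite gt_eqF// ltr_wpDl.
have xr : x < rho.
  have : s * x < 2 by lra.
  by rewrite /s mulrAC ltr_pdivrMr// ltr_pM2l.
have e'0 : 0 < e / 2 * x ^+ k by rewrite mulr_gt0 ?exprn_gt0//; lra.
have [|N0 HN] := H x%:C _ _ e'0; first by rewrite ncR gtr0_norm.
have := HN (maxn N0 k.+1) (leq_maxl _ _); set N := maxn _ _ => hN.
have kN : (k < N)%N by rewrite leq_max ltnSn orbT.
have aM n : normc (a n) * x ^+ n <= M * (s * x) ^+ n.
  have r2 : 0 < rho / 2 by lra.
  have := HM n; rewrite ncR gtr0_norm// => h.
  rewrite exprMn mulrA ler_wpM2r ?exprn_ge0 ?(ltW x0)//.
  by rewrite /s -[2 / rho]invf_div exprVn ler_pdivlMr// exprn_gt0.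
have : normc (a k) * x ^+ k <= e * x ^+ k.
  have -> : normc (a k) * x ^+ k = normc (a k * x%:C ^+ k).
    by rewrite ncM ncX ncR gtr0_norm.
  have E : psum a x%:C N = a k * x%:C ^+ k + \sum_(k.+1 <= n < N) a n * x%:C ^+ n.
    rewrite /psum -(big_mkord xpredT (fun n => a n * x%:C ^+ n)).
    rewrite (big_cat_nat _ (n := k))//=; last exact: ltnW.
    rewrite big_nat big1 ?add0r; last by move=> i /andP[_ ik]; rewrite IH// mul0r.
    by rewrite big_ltn.
  rewrite subr0 E in hN.
  rewrite -[leLHS](_ : normc ((a k * x%:C ^+ k + \sum_(k.+1 <= n < N) a n * x%:C ^+ n) -
    \sum_(k.+1 <= n < N) a n * x%:C ^+ n) = _); last by rewrite addrK.
  rewrite (le_trans (ncB _ _))// (_ : e * _ = e / 2 * x ^+ k + e / 2 * x ^+ k); last by field.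
  apply: lerD => //.
  rewrite (le_trans (nc_sum _ _ _))//.
  rewrite (@le_trans _ _ (\sum_(k.+1 <= n < N) M * (s * x) ^+ n))//.
    by apply: ler_sum => n _; rewrite ncM ncX ncR gtr0_norm.
  rewrite -mulr_sumr (le_trans (ler_wpM2l M0 (geo_tail_le _ _ _ xs)))//.
    by rewrite mulr_ge0// ltW.
  rewrite (_ : M * _ = K * x * x ^+ k); last by rewrite /K exprMn !exprS; ring.
  by rewrite ler_wpM2r// exprn_ge0// ltW.
by rewrite ler_pM2r// exprn_gt0.
Qed.

Lemma pconvB a b z s s' : pconv a z s -> pconv b z s' ->
  pconv (fun n => a n - b n) z (s - s').
Proof.
move=> h1 h2 e e0; have e2 : 0 < e / 2 by lra.
have [N1 H1] := h1 _ e2; have [N2 H2] := h2 _ e2.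
exists (maxn N1 N2) => N; rewrite geq_max => /andP[n1 n2].
have := H1 N n1; have := H2 N n2 => k2 k1.
rewrite (_ : _ - _ = (psum a z N - s) - (psum b z N - s')).
  by rewrite (le_trans (ncB _ _))//; lra.
rewrite /psum; under eq_bigr do rewrite mulrBl; rewrite sumrB; ring.
Qed.

Lemma pconv_unique a b (f : R[i] -> R[i]) (rho : R) : 0 < rho ->
  (forall z, normc z < rho -> pconv a z (f z)) ->
  (forall z, normc z < rho -> pconv b z (f z)) -> a = b.
Proof.
move=> rho0 ha hb; apply/funext => k; apply/eqP; rewrite -subr_eq0; apply/eqP.
apply: (@pconv0_coef0 (fun n => a n - b n) rho) => // z hz.
by rewrite -(subrr (f z)); apply: pconvB; [exact: ha|exact: hb].
Qed.

End PowerSeriesSum.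

(** * Cauchy's theorem on circles *)

Section Sector.
Variable R : realType.
Implicit Types (r t p q : R) (z w : R[i]) (h : R[i] -> R[i]).

Definition cont_disc h := forall z, disc z -> forall e : R, 0 < e ->
  exists2 d : R, 0 < d & forall w, normc (w - z) < d -> normc (h w - h z) <= e.

Definition rad h t r0 r1 := cint r0 r1 (fun r => h (r%:C * cis t) * cis t).
Definition ang h r t0 t1 :=
  cint t0 t1 (fun t => h (r%:C * cis t) * (r%:C * ('i * cis t))).

(** The contour integral of [h] around a polar rectangle. A full turn has the circle as
    outer side, while its two rays cancel and its inner arc can be shrunk to the origin. *)
Definition sector h r0 r1 t0 t1 :=
  rad h t0 r0 r1 + ang h r1 t0 t1 - rad h t1 r0 r1 - ang h r0 t0 t1.

Lemma cdrv_ray t : cdrv (fun r => r%:C * cis t) (fun=> cis t).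
Proof.
apply: cdrv_ext (cdrvM (@cdrv_real R) (cdrv_cst (cis t))) => x.
by rewrite mul1r mulr0 addr0.
Qed.

Lemma cdrv_arc r : cdrv (fun t => r%:C * cis t) (fun t => r%:C * ('i * cis t)).
Proof.
apply: cdrv_ext (cdrvM (cdrv_cst r%:C) (@cdrv_cis R)) => x.
by rewrite mul0r add0r.
Qed.

Lemma ccont_arc' r a b : ccont a b (fun t => r%:C * ('i * cis t)).
Proof.
by apply: ccontM; [exact: ccont_cst|apply: ccontM; [exact: ccont_cst|
  exact: cdrv_cont (@cdrv_cis R)]].
Qed.

Lemma ccont_comp_disc h (g : R -> R[i]) a b : cont_disc h ->
  (forall x, a <= x <= b -> disc (g x)) -> ccont a b g -> ccont a b (fun x => h (g x)).
Proof.
move=> ch gd cg x hx e e0; have [d d0 Hd] := ch _ (gd x hx) e e0.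
have d2 : 0 < d / 2 by lra.
have [d' d'0 Hd'] := cg x hx _ d2; exists d' => // y hy yx.
by apply: Hd; rewrite (le_lt_trans (Hd' y hy yx))//; lra.
Qed.

Lemma ccont_ray h t a b : cont_disc h -> 0 <= a -> b < 1 ->
  ccont a b (fun r => h (r%:C * cis t) * cis t).
Proof.
move=> ch a0 b1; apply: ccontM; last exact: ccont_cst.
apply: ccont_comp_disc => //; last exact: cdrv_cont (cdrv_ray t).
by move=> x hx; rewrite discE nc_polar ger0_norm; lra.
Qed.

Lemma ccont_circle h r a b : cont_disc h -> 0 <= r < 1 ->
  ccont a b (fun t => h (r%:C * cis t)).
Proof.
move=> ch r1; apply: ccont_comp_disc => //; last exact: cdrv_cont (cdrv_arc r).
by move=> x hx; rewrite discE nc_polar ger0_norm; lra.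
Qed.

Lemma ccont_arc h r a b : cont_disc h -> 0 <= r < 1 ->
  ccont a b (fun t => h (r%:C * cis t) * (r%:C * ('i * cis t))).
Proof.
by move=> ch r1; apply: ccontM; [exact: ccont_circle|exact: ccont_arc'].
Qed.

Lemma sector_additive h rho t0 t1 : cont_disc h -> rho < 1 ->
  additive_on (sector h) 0 rho t0 t1.
Proof.
move=> ch r1; split.
  move=> x0 x1 x2 y0 y1 a1 a2 a3 a4 b1 b2 b3; rewrite /sector /rad.
  rewrite (@cint_split _ x0 x1 x2)//; last by apply: ccont_ray => //; lra.
  rewrite (@cint_split _ x0 x1 x2 (fun r => h (r%:C * cis y1) * _))//.
    by rewrite /ang; ring.
  by apply: ccont_ray => //; lra.
move=> x0 x1 y0 y1 y2 a1 a2 a3 b1 b2 b3 b4; rewrite /sector /ang.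
rewrite (@cint_split _ y0 y1 y2)//; last by apply: ccont_arc => //; lra.
rewrite (@cint_split _ y0 y1 y2 (fun t => h (x0%:C * cis t) * _))//.
  by ring.
by apply: ccont_arc => //; lra.
Qed.

Lemma sector_add h g r0 r1 t0 t1 : cont_disc h -> cont_disc g -> 0 <= r0 -> r0 <= r1 ->
  r1 < 1 -> sector (fun z => h z + g z) r0 r1 t0 t1 =
    sector h r0 r1 t0 t1 + sector g r0 r1 t0 t1.
Proof.
move=> ch cg a1 a2 a3.
have hr t : rad (fun z => h z + g z) t r0 r1 = rad h t r0 r1 + rad g t r0 r1.
  rewrite /rad -cintD; try by apply: ccont_ray.
  by apply: eq_cint => x _; rewrite mulrDl.
have ha r : 0 <= r < 1 -> ang (fun z => h z + g z) r t0 t1 = ang h r t0 t1 + ang g r t0 t1.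
  move=> r01; rewrite /ang -cintD; try by apply: ccont_arc.
  by apply: eq_cint => x _; rewrite mulrDl.
rewrite /sector !hr !ha; [ring|lra|lra].
Qed.

(** An affine function has a primitive. *)
Lemma sector_affine A B r0 r1 t0 t1 : r0 <= r1 -> t0 <= t1 ->
  sector (fun z => A + B * z) r0 r1 t0 t1 = 0.
Proof.
move=> a b; pose G z := A * z + B / 2 * z ^+ 2.
have dG (g g' : R -> R[i]) : cdrv g g' ->
    cdrv (fun x => G (g x)) (fun x => (A + B * g x) * g' x).
  move=> hg; have := cdrvD (cdrvM (cdrv_cst A) hg) (cdrvM (cdrv_cst (B / 2)) (cdrvX 1 hg)).
  by apply: cdrv_ext => x; field.
have hr t : rad (fun z => A + B * z) t r0 r1 = G (r1%:C * cis t) - G (r0%:C * cis t).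
  apply: (cint_FTC (G := fun x => G (x%:C * cis t))) => //; first exact: dG (cdrv_ray t).
  apply: ccontM; last exact: ccont_cst.
  apply: ccontD; first exact: ccont_cst.
  by apply: ccontM; [exact: ccont_cst|exact: cdrv_cont (cdrv_ray t)].
have ha r : ang (fun z => A + B * z) r t0 t1 = G (r%:C * cis t1) - G (r%:C * cis t0).
  apply: (cint_FTC (G := fun x => G (r%:C * cis x))) => //; first exact: dG (cdrv_arc r).
  apply: ccontM; last exact: ccont_arc'.
  apply: ccontD; first exact: ccont_cst.
  by apply: ccontM; [exact: ccont_cst|exact: cdrv_cont (cdrv_arc r)].
by rewrite /sector !hr !ha; ring.
Qed.

Lemma sector_bound h r0 r1 t0 t1 (M : R) : cont_disc h ->
  0 <= r0 -> r0 <= r1 -> r1 < 1 -> t0 <= t1 -> 0 <= M ->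
  (forall r t, r0 <= r <= r1 -> t0 <= t <= t1 -> normc (h (r%:C * cis t)) <= M) ->
  normc (sector h r0 r1 t0 t1) <= 4 * M * ((r1 - r0) + (t1 - t0)).
Proof.
move=> ch a1 a2 a3 b M0 HM.
have hr t : t0 <= t <= t1 -> normc (rad h t r0 r1) <= 2 * M * (r1 - r0).
  move=> ht; apply: cint_bound => //; first exact: ccont_ray.
  by move=> x hx; rewrite ncM nc_cis mulr1 HM.
have ha r : r0 <= r <= r1 -> normc (ang h r t0 t1) <= 2 * M * (t1 - t0).
  move=> hr0; apply: cint_bound => //; first by apply: ccont_arc => //; lra.
  move=> x hx; rewrite !ncM nc_cis mulr1 ncR ger0_norm; last by lra.
  have -> : normc ('i : R[i]) = 1 by rewrite /= expr0n/= expr1n add0r sqrtr1.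
  rewrite mulr1 (le_trans _ (HM r x hr0 hx))// ler_piMr//; lra.
have t00 : t0 <= t0 <= t1 by lra.
have t11 : t0 <= t1 <= t1 by lra.
have r00 : r0 <= r0 <= r1 by lra.
have r11 : r0 <= r1 <= r1 by lra.
rewrite /sector (_ : 4 * M * _ = 2 * M * (r1 - r0) + 2 * M * (t1 - t0) +
  2 * M * (r1 - r0) + 2 * M * (t1 - t0)); last by ring.
do 2 (apply: (le_trans (ncB _ _)); apply: lerD; last by auto).
by apply: (le_trans (ncD _ _)); apply: lerD; auto.
Qed.

(** Subtracting the affine approximation leaves an integrand of size [e] times the
    diameter, on a boundary whose length is of the order of the diameter. *)
Lemma sector_small_at h B p q rho t0 t1 : cont_disc h -> rho < 1 -> 0 <= p <= rho ->
  cder h (p%:C * cis q) B -> small_at (sector h) 0 rho t0 t1 p q.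
Proof.
move=> ch rho1 p01 hB e e0; set z := p%:C * cis q in hB.
have e8 : 0 < e / 8 by lra.
have [d d0 Hd] := hB _ e8.
exists (d / 4); first by lra.
move=> x0 x1 y0 y1 a1 a2 a3 a4 b1 b2 b3 b4 dx dy.
pose A := h z - B * z.
pose g w := h w - (A + B * w).
have caff : cont_disc (fun w => A + B * w).
  move=> u _ e' e'0; exists (e' / (1 + normc B)); first by rewrite divr_gt0// ltr_pwDl.
  move=> w hw; rewrite (_ : _ - _ = B * (w - u)); last by ring.
  have K0 : 0 < 1 + normc B by rewrite ltr_pwDl.
  rewrite ncM (le_trans (y := (1 + normc B) * normc (w - u)))//.
    by rewrite ler_wpM2r// lerDr.
  by rewrite mulrC -ler_pdivlMr// ltW.
have cg : cont_disc g.
  move=> u hu e' e'0; have e'2 : 0 < e' / 2 by lra.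
  have [d1 d10 H1] := ch u hu _ e'2; have [d2 d20 H2] := caff u hu _ e'2.
  exists (Num.min d1 d2); first by rewrite lt_min d10.
  move=> w; rewrite lt_min => /andP[w1 w2]; rewrite /g.
  rewrite (_ : _ - _ - _ = (h w - h u) - ((A + B * w) - (A + B * u))); last by ring.
  by rewrite (le_trans (ncB _ _))//; have := H1 w w1; have := H2 w w2; lra.
have -> : sector h x0 x1 y0 y1 = sector g x0 x1 y0 y1.
  rewrite (_ : h = (fun w => g w + (A + B * w))); last first.
    by apply/funext => w; rewrite /g subrK.
  by rewrite sector_add ?sector_affine ?addr0//; lra.
pose S := (x1 - x0) + (y1 - y0).
have S0 : 0 <= S by rewrite /S; lra.
have := @sector_bound g x0 x1 y0 y1 (e / 4 * S) cg.
rewrite -/S => K; apply: (le_trans (K _ _ _ _ _ _)); try by lra.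
- by rewrite mulr_ge0//; lra.
- move=> r t hr ht; set w := r%:C * cis t.
  have wz : normc (w - z) <= 2 * S.
    rewrite (le_trans (polar_lip r t (p := p) q _))//; first by rewrite ger0_norm; lra.
    have : `|r - p| <= x1 - x0 by rewrite ler_norml; lra.
    have : `|t - q| <= y1 - y0 by rewrite ler_norml; lra.
    by rewrite /S; lra.
  have := Hd (w - z); rewrite [z + _]addrC subrK => Hw.
  rewrite (_ : g w = h w - h z - B * (w - z)); last by rewrite /g /A; ring.
  rewrite (le_trans (Hw _))//; first by rewrite (le_lt_trans wz)// /S; lra.
  by rewrite (_ : e / 4 * S = e / 8 * (2 * S)); [rewrite ler_wpM2l//; lra|field].
Qed.

(** Goursat's theorem on a polar rectangle; at the exempt point continuity bounds the
    integrand, so that small rectangles around it contribute little. *)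
Lemma sector_eq0 h p q rho t0 t1 : cont_disc h -> 0 <= rho < 1 -> t0 <= t1 -> 0 <= p <= rho ->
  (forall r t, 0 <= r <= rho -> t0 <= t <= t1 -> r != p \/ t != q ->
     exists B, cder h (r%:C * cis t) B) ->
  sector h 0 rho t0 t1 = 0.
Proof.
move=> ch rho1 t01 hp hd.
apply: (@additive_exceptional_eq0 R (sector h) 0 rho t0 t1 p q) => //; first by lra.
- by apply: sector_additive => //; lra.
- move=> r t hr ht ne; have [B hB] := hd r t hr ht ne.
  by apply: sector_small_at hB => //; lra.
move=> e e0; set z := p%:C * cis q.
have dz : disc z by rewrite discE nc_polar ger0_norm; lra.
have [d d0 Hd] := ch z dz 1 ltr01.
pose M := normc (h z) + 1.
have M0 : 0 < M by rewrite /M ltr_wpDl.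
pose dl := Num.min (d / 4) (e / (16 * M)).
have dl0 : 0 < dl by rewrite lt_min !divr_gt0// mulr_gt0.
exists dl => // x0 x1 y0 y1 a1 a2 a3 b1 b2 b3 px0 x1p qy0 y1q.
have dld : dl <= d / 4 by rewrite /dl ge_min lexx.
have dle : dl <= e / (16 * M) by rewrite /dl ge_min lexx orbT.
rewrite (le_trans (@sector_bound h x0 x1 y0 y1 M ch _ _ _ _ _ _))//; try lra.
  move=> r t hr ht; set w := r%:C * cis t.
  rewrite -[h w](subrK (h z)) (le_trans (ncD _ _))// addrC lerD// Hd//.
  rewrite (le_lt_trans (polar_lip r t (p := p) q _))//; first by rewrite ger0_norm; lra.
  have : `|r - p| <= dl by rewrite ler_norml; lra.
  have : `|t - q| <= dl by rewrite ler_norml; lra.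
  lra.
rewrite (@le_trans _ _ (4 * M * (4 * dl)))//; first by rewrite ler_wpM2l//; lra.
rewrite (_ : 4 * M * _ = dl * (16 * M)); last by ring.
by rewrite -ler_pdivlMr// mulr_gt0.
Qed.

Lemma polar_inj r t p q : 0 < p -> 0 <= r -> 0 <= t <= pi -> 0 <= q <= pi ->
  r%:C * cis t = p%:C * cis q -> r = p /\ t = q.
Proof.
move=> p0 r0 ht hq E; have rp : r = p.
  by have := congr1 (@normc R) E; rewrite !nc_polar !ger0_norm// ltW.
split => //; apply: (@cos_inj R); rewrite ?in_itv//=.
have := congr1 (@complex.Re R) E; rewrite rp /cis /= !mul0r !subr0.
by move/(mulfI (lt0r_neq0 p0)).
Qed.

(** On a half circle the polar coordinates of a nonzero point are unique, so that an
    exempt point of the disc is a single point of the parameter rectangle. *)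
Lemma half_circle_unique w (k : bool) : w != 0 ->
  exists p q, 0 <= p <= normc w /\ forall r t, 0 <= r ->
    (if k then pi else 0) <= t <= (if k then 2 * pi else pi) ->
    r%:C * cis t = w -> r = p /\ t = q.
Proof.
move=> w0; pose I t := (if k then pi else 0 : R) <= t <= (if k then 2 * pi else pi).
have [[r [t [r0 It E]]]|no] := pselect (exists r t, [/\ 0 <= r, I t & r%:C * cis t = w]).
  have rw : r = normc w by rewrite -E nc_polar ger0_norm.
  have rp : 0 < r by rewrite rw nc_gt0.
  exists r, t; rewrite -rw lexx r0; split => // r' t' r'0 It' E'.
  move: It It' E E'; rewrite {}/I; case: k => It It' E E'; last first.
    by apply: polar_inj => //; rewrite E E'.
  have cm s : cis (s - pi) = - cis s :> R[i].
    apply: cplx_eq; rewrite /cis /=.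
      by rewrite -[in RHS](subrK pi s) cosDpi opprK.
    by rewrite -[in RHS](subrK pi s) sinDpi opprK.
  have [|||-> ht] := @polar_inj r' (t' - pi) r (t - pi) rp r'0; [lra|lra| |].
    by rewrite !cm !mulrN E E'.
  by split => //; lra.
exists 0, 0; rewrite lexx normc_ge0; split => // r t r0 It E.
by exfalso; apply: no; exists r, t.
Qed.

(** The disc is cut into two half discs, on each of which the exempt point has unique
    polar coordinates. *)
Lemma cauchy_circle h w rho : cont_disc h -> w != 0 -> 0 <= rho < 1 -> normc w <= rho ->
  (forall z, disc z -> z != w -> exists B, cder h z B) ->
  cint 0 (2 * pi) (fun t => h (rho%:C * cis t) * (rho%:C * ('i * cis t))) = 0.
Proof.
move=> ch w0 hrho wr hd; have pi0 := pi_ge0 R.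
have half (k : bool) : sector h 0 rho (if k then pi else 0) (if k then 2 * pi else pi) = 0.
  have [p [q [hp U]]] := half_circle_unique k w0.
  apply: (@sector_eq0 h p q) => //; [by case: k {U}; lra|lra|].
  move=> r t hr ht ne; apply: hd; first by rewrite discE nc_polar ger0_norm; lra.
  apply/eqP => E; have [||rp tq] := U r t _ _ E; [lra|by []|].
  by case: ne; rewrite ?rp ?tq eqxx.
have := half false; have := half true => /= h1 h2.
have := (sector_additive 0 (2 * pi) ch (_ : rho < 1)).2 0 rho 0 pi (2 * pi).
rewrite h1 h2 addr0 => K.
have {K} : sector h 0 rho 0 (2 * pi) = 0 by apply: K => //; lra.
rewrite /sector /rad cis0 cis2pi [X in X - _](_ : _ = cint 0 (2 * pi) (fun t =>
  h (rho%:C * cis t) * (rho%:C * ('i * cis t)))); last by rewrite /ang; ring.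
rewrite [X in _ - X](_ : _ = 0) ?subr0// /ang.
rewrite (@eq_cint _ _ _ _ (fun=> 0 * 0)); last by move=> t _; rewrite rmorph0 !mul0r mulr0.
by rewrite (@cintZ _ _ _ (fun=> 0)) ?mul0r//; exact: ccont_cst.
Qed.

End Sector.

(** * Holomorphic functions and Cauchy's formula *)

(** Locked, because comparing two derivability statements by conversion unfolds the
    underlying filters. *)
HB.lock Definition hol {R : realType} (f : R[i] -> R[i]) : Prop := holomorphic_disc f.

Section Holomorphic.
Variable R : realType.
Implicit Types (f g h : R[i] -> R[i]) (z w : R[i]) (a b : nat -> R[i]).

Lemma holP f : hol f <-> holomorphic_disc f.
Proof. by rewrite unlock. Qed.

Lemma holPc f : hol f <-> forall z, disc z -> exists B, cder f z B.
Proof.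
rewrite holP; split => H z hz; first exact/derivableP_cder/H.
exact/derivableP_cder/H.
Qed.

Lemma hol_cder f z : hol f -> disc z -> exists B, cder f z B.
Proof. by move=> /holPc; apply. Qed.

Lemma cder_hol f : (forall z, disc z -> exists B, cder f z B) -> hol f.
Proof. by move=> H; apply/holPc. Qed.

Lemma hol_cont f : hol f -> cont_disc f.
Proof. by move=> hf z hz; have [B hB] := hol_cder hf hz; exact: cder_cont hB. Qed.

Lemma disc_open z : disc z -> exists2 d : R, 0 < d & forall w, normc (w - z) < d -> disc w.
Proof.
rewrite discE => hz; exists (1 - normc z); first by lra.
move=> w hw; rewrite discE -[w](subrK z) (le_lt_trans (ncD _ _))//; lra.
Qed.

Lemma hol_ext f g : (forall z, disc z -> f z = g z) -> hol f -> hol g.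
Proof.
move=> fg hf; apply: cder_hol => z hz; have [B hB] := hol_cder hf hz.
have [d d0 Hd] := disc_open hz; exists B; apply: cder_ext hB _.
by exists d => // w wz; apply/fg/Hd.
Qed.

Lemma hol_cst (c : R[i]) : hol (fun=> c).
Proof. by apply/holP => z _; exact: derivable_cst. Qed.

Lemma hol_id : hol (fun z : R[i] => z).
Proof. by apply/holP => z _; exact: derivable_id. Qed.

Lemma holD f g : hol f -> hol g -> hol (fun z => f z + g z).
Proof.
by move=> /holP hf /holP hg; apply/holP => z hz; apply: derivableD; [exact: hf|exact: hg].
Qed.

Lemma holM f g : hol f -> hol g -> hol (fun z => f z * g z).
Proof.
move=> /holP hf /holP hg; apply/holP => z hz.
by apply: (@derivableM R[i] R[i]^o f g z 1); [exact: hf|exact: hg].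
Qed.

Lemma holZ c f : hol f -> hol (fun z => c * f z).
Proof. by move=> hf; apply: holM => //; exact: hol_cst. Qed.

Lemma holN f : hol f -> hol (fun z => - f z).
Proof. by move=> /holP hf; apply/holP => z hz; apply: derivableN; exact: hf. Qed.

Lemma holB f g : hol f -> hol g -> hol (fun z => f z - g z).
Proof. by move=> hf hg; apply: holD => //; exact: holN. Qed.

Lemma hol_inv f : hol f -> (forall z, disc z -> f z != 0) -> hol (fun z => (f z)^-1).
Proof.
by move=> /holP hf f0; apply/holP => z hz; apply: derivableV; [exact: f0|exact: hf].
Qed.

Lemma cder_comp f g z A B : cder f z A -> cder g (f z) B -> cder (g \o f) z (B * A).
Proof.
move=> hf hg e e0.
pose K := 1 + normc A; have K0 : 0 < K by rewrite /K ltr_pwDl.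
pose L := 1 + normc B; have L0 : 0 < L by rewrite /L ltr_pwDl.
have eK : 0 < e / (2 * K) by rewrite divr_gt0// mulr_gt0.
have eL : 0 < Num.min 1 (e / (2 * L)) by rewrite lt_min ltr01 divr_gt0// mulr_gt0.
have [d1 d10 H1] := hg _ eK; have [d2 d20 H2] := hf _ eL.
exists (Num.min d2 (d1 / K)); first by rewrite lt_min d20 divr_gt0.
move=> w; rewrite lt_min => /andP[w2 w1]; have := H2 w w2; set D := f (z + w) - f z => HD.
have HD1 : normc D <= K * normc w.
  rewrite -[D](subrK (A * w)) (le_trans (ncD _ _))// ncM /K mulrDl mul1r lerD//.
  by rewrite (le_trans HD)// ler_piMl// ge_min lexx.
have Dd : normc D < d1 by rewrite (le_lt_trans HD1)// mulrC -ltr_pdivlMr.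
have := H1 D Dd; rewrite /= {1}/D [f z + _]addrC subrK => HG.
rewrite (_ : _ - _ - _ = (g (f (z + w)) - g (f z) - B * D) + B * (D - A * w)); last by ring.
rewrite (le_trans (ncD _ _))// ncM.
rewrite (_ : e * _ = e / (2 * K) * (K * normc w) + L * (e / (2 * L) * normc w)); last first.
  by field; rewrite !gt_eqF.
apply: lerD; first by rewrite (le_trans HG)// ler_wpM2l// ltW.
rewrite ler_pM//; first by rewrite /L lerDr.
by rewrite (le_trans HD)// ler_wpM2r// ge_min lexx orbT.
Qed.

Lemma hol_comp f g : hol g -> hol f -> (forall z, disc z -> disc (f z)) ->
  hol (fun z => g (f z)).
Proof.
move=> hg hf fd; apply: cder_hol => z hz.
have [A hA] := hol_cder hf hz; have [B hB] := hol_cder hg (fd z hz).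
by exists (B * A); exact: cder_comp hA hB.
Qed.

Lemma ccont_bounded (x y : R) (F : R -> R[i]) : x <= y -> ccont x y F ->
  exists2 M : R, 0 <= M & forall t, x <= t <= y -> normc (F t) <= M.
Proof.
move=> xy cF.
have [c _ Hc] := EVT_max xy (ccont_comp_real (@nc_lip R) cF).
by exists (normc (F c)) => // t ht; apply: Hc; rewrite in_itv.
Qed.

Lemma cint_sum (x y : R) (F : nat -> R -> R[i]) N : (forall n, ccont x y (F n)) ->
  ccont x y (fun t => \sum_(n < N) F n t) /\
  cint x y (fun t => \sum_(n < N) F n t) = \sum_(n < N) cint x y (F n).
Proof.
move=> cF; elim: N => [|N [IH1 IH2]].
  have E : (fun t => \sum_(n < 0) F n t) = (fun=> 0 * 0).
    by apply/funext => t; rewrite big_ord0 mul0r.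
  rewrite E big_ord0; split; first exact: ccont_cst.
  by rewrite (@cintZ _ _ _ (fun=> 0)) ?mul0r//; exact: ccont_cst.
have E : (fun t => \sum_(n < N.+1) F n t) = (fun t => \sum_(n < N) F n t + F N t).
  by apply/funext => t; rewrite big_ord_recr.
by rewrite E big_ord_recr/= cintD// IH2; split => //; exact: ccontD.
Qed.

(** The [n]-th Taylor coefficient, as a mean over the circle of radius [rho]. *)
Definition circ_coef f (rho : R) n : R[i] :=
  (2 * pi * rho ^+ n)^-1%:C * cint 0 (2 * pi) (fun t => f (rho%:C * cis t) * (cis t)^* ^+ n).

Lemma ccont_cisJX n (x y : R) : ccont x y (fun t => (cis t)^* ^+ n).
Proof.
case: n => [|n]; last exact: cdrv_cont (cdrvX n (@cdrv_cisJ R)).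
exact: ccont_cst.
Qed.

Let pi2 : 0 < 2 * pi :> R. Proof. by rewrite mulr_gt0// pi_gt0. Qed.

(** Cauchy's formula: the kernel [z / (z - w)] is expanded in powers of [w / z], the
    remainder being controlled by the difference quotient of [f] at [w]. *)
Lemma circ_coef_conv f w (rho : R) : hol f -> w != 0 -> normc w < rho -> rho < 1 ->
  pconv (circ_coef f rho) w (f w).
Proof.
move=> hf w0 wr r1; have r0 : 0 < rho by rewrite (le_lt_trans _ wr).
have dw : disc w by rewrite discE; lra.
have [B hB] := hol_cder hf dw.
pose h z := if z == w then B else (f z - f w) / (z - w).
have hder z : disc z -> z != w -> exists B', cder h z B'.
  move=> hz zw; have d0 : 0 < normc (z - w) by rewrite nc_gt0 subr_eq0.
  have /derivableP_cder[B' hB'] : derivable ((fun z => (f z - f w) * (z - w)^-1) : R[i]^o -> R[i]^o) z 1.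
    apply: (@derivableM R[i] R[i]^o).
      by apply: derivableB; [move/holP : hf; exact|exact: derivable_cst].
    apply: derivableV; first by rewrite subr_eq0.
    by apply: derivableB; [exact: derivable_id|exact: derivable_cst].
  exists B'; apply: cder_ext hB' _; exists (normc (z - w)) => // u hu; rewrite /h.
  by case: eqP => // E; move: hu; rewrite E ncBC ltxx.
have ch : cont_disc h.
  move=> z hz; have [->|zw] := eqVneq z w; last first.
    by have [B' hB'] := hder z hz zw; exact: cder_cont hB'.
  move=> e e0; have [d d0 Hd] := hB _ e0; exists d => // u ud; rewrite /h eqxx.
  case: eqP => [_|/eqP uw]; first by rewrite subrr normc0 ltW.
  have uw0 : u - w != 0 by rewrite subr_eq0.
  have := Hd _ ud; rewrite [w + _]addrC subrK -[B * _](mulrC) => K.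
  rewrite -(@ler_pM2r _ (normc (u - w))) ?nc_gt0// -ncM mulrBl divfK//.
  by rewrite [B * _]mulrC.
have r01 : 0 <= rho < 1 by rewrite ltW.
have := cauchy_circle ch w0 r01 (ltW wr) hder.
pose F t := h (rho%:C * cis t) * (rho%:C * ('i * cis t)).
have cF : ccont 0 (2 * pi) F by apply: ccont_arc.
have [M M0 HM] := ccont_bounded (ltW pi2) cF.
rewrite -/F => F0.
pose q := normc w / rho; have q0 : 0 <= q by rewrite divr_ge0// ltW.
have q1 : q < 1 by rewrite ltr_pdivrMr// mul1r.
suff key N : (0 < N)%N -> normc (psum (circ_coef f rho) w N - f w) <= 2 * M * q ^+ N.
  move=> e e0.
  have : (fun N => 2 * M * q ^+ N) @ \oo --> (2 * M * 0 : R).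
    by apply: cvgMr; apply: cvg_expr; rewrite ger0_norm.
  rewrite mulr0 => /cvgrPdist_le /(_ _ e0)[N0 _ HN].
  exists N0.+1 => N hN; rewrite (le_trans (key N _))//; first exact: leq_trans hN.
  have := HN N (ltnW hN); rewrite sub0r normrN; apply: le_trans; exact: ler_norm.
move=> N0.
have i0 : ('i : R[i]) != 0 by rewrite eq_complex /= eqxx oner_eq0.
pose c := w / rho%:C.
have rC : rho%:C != 0 :> R[i] by rewrite eq_complex /= eqxx gt_eqF.
pose S t := \sum_(n < N) c ^+ n * (cis t)^* ^+ n.
have FE t : F t = 'i * ((f (rho%:C * cis t) - f w) * S t + c ^+ N * ((cis t)^* ^+ N * (-'i * F t))).
  have zw : rho%:C * cis t != w.
    by apply/eqP => E; move: wr; rewrite -E nc_polar gtr0_norm ?ltxx.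
  have zw' : rho%:C * cis t - w != 0 by rewrite subr_eq0.
  have i2 : 'i * - 'i = 1 :> R[i] by rewrite mulrN -expr2 sqr_i opprK.
  have ES : (1 - c * (cis t)^*) * S t = 1 - c ^+ N * (cis t)^* ^+ N.
    have geo (x : R[i]) : (1 - x) * \sum_(n < N) x ^+ n = 1 - x ^+ N.
      by rewrite -[1 - x]opprB mulNr -subrX1 opprB.
    rewrite -exprMn -geo /S; congr (_ * _).
    by apply: eq_bigr => i _; rewrite -exprMn.
  have Ec : rho%:C * cis t - w = rho%:C * cis t * (1 - c * (cis t)^*).
    have -> : rho%:C * cis t * (1 - c * (cis t)^*) =
        rho%:C * cis t - w * (rho%:C^-1 * rho%:C) * (cis t * (cis t)^*) by rewrite /c; ring.
    by rewrite cisJ mulVf// !mulr1.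
  rewrite /F /h (negbTE zw).
  set Z := rho%:C * cis t in zw zw' Ec *; set dd := f Z - f w.
  rewrite (_ : dd / (Z - w) * (rho%:C * ('i * cis t)) = 'i * (dd / (Z - w) * Z)); last first.
    by rewrite /Z; ring.
  congr ('i * _); set T := dd / (Z - w) * Z.
  have dE : dd = T * (1 - c * (cis t)^*) by rewrite /T -mulrA -Ec divfK.
  rewrite {1}dE -mulrA ES mulrA (_ : - 'i * ('i * T) = T * ('i * -'i)); last by ring.
  by rewrite i2; ring.
have cf : ccont 0 (2 * pi) (fun t => f (rho%:C * cis t)).
  by apply: ccont_circle => //; exact: hol_cont.
pose G1 n t := c ^+ n * (f (rho%:C * cis t) * (cis t)^* ^+ n).
pose G2 n t := (- f w * c ^+ n) * (cis t)^* ^+ n.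
have cG1 n : ccont 0 (2 * pi) (G1 n).
  by apply: ccontM; [exact: ccont_cst|apply: ccontM => //; exact: ccont_cisJX].
have cG2 n : ccont 0 (2 * pi) (G2 n).
  by apply: ccontM; [exact: ccont_cst|exact: ccont_cisJX].
pose E t := (cis t)^* ^+ N * (-'i * F t).
have cE : ccont 0 (2 * pi) E.
  by apply: ccontM; [exact: ccont_cisJX|apply: ccontM => //; exact: ccont_cst].
have [cS1 S1] := cint_sum N cG1; have [cS2 S2] := cint_sum N cG2.
have cTot : ccont 0 (2 * pi) (fun t => \sum_(n < N) G1 n t + \sum_(n < N) G2 n t + c ^+ N * E t).
  apply: ccontD; first exact: ccontD.
  by apply: ccontM => //; exact: ccont_cst.
have : cint 0 (2 * pi) F = 'i * (cint 0 (2 * pi) (fun t => \sum_(n < N) G1 n t) +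
    cint 0 (2 * pi) (fun t => \sum_(n < N) G2 n t) + c ^+ N * cint 0 (2 * pi) E).
  rewrite -(cintZ _ cE) -cintD// -cintD//; last 2 first.
  - exact: ccontD.
  - by apply: ccontM => //; exact: ccont_cst.
  rewrite -cintZ//; apply: eq_cint => t _; rewrite FE; congr ('i * (_ + _)).
  rewrite /S mulrBl !mulr_sumr -sumrN; congr (_ + _); apply: eq_bigr => n _.
    by rewrite /G1; ring.
  by rewrite /G2; ring.
rewrite F0 => /esym/eqP; rewrite mulf_eq0 (negbTE i0)/= addr_eq0 => /eqP Hsum.
have pC : (2 * pi)%:C != 0 :> R[i] by rewrite eq_complex /= eqxx gt_eqF.
have e1 : \sum_(n < N) cint 0 (2 * pi) (G1 n) = (2 * pi)%:C * psum (circ_coef f rho) w N.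
  rewrite /psum mulr_sumr; apply: eq_bigr => n _; rewrite /G1 cintZ; last first.
    by apply: ccontM => //; exact: ccont_cisJX.
  rewrite /circ_coef /c; set X := cint _ _ _.
  have -> : (2 * pi * rho ^+ n)^-1%:C = (2 * pi)%:C^-1 * (rho%:C ^+ n)^-1 :> R[i].
    by rewrite invfM rmorphM/= !fmorphV/= rmorphXn.
  rewrite expr_div_n; move: (expf_neq0 n rC) pC.
  by move: (rho%:C ^+ n) ((2 * pi)%:C) => r P hr hP; field; rewrite hr hP.
have e2 : \sum_(n < N) cint 0 (2 * pi) (G2 n) = - (2 * pi)%:C * f w.
  rewrite (bigD1 (Ordinal N0))//= big1; last first.
    move=> i i00; rewrite /G2 cintZ; last exact: ccont_cisJX.
    by rewrite cint_cisJX ifN ?mulr0.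
  rewrite addr0 /G2 cintZ; last exact: ccont_cisJX.
  by rewrite cint_cisJX eqxx expr0; ring.
rewrite S1 S2 e1 e2 mulNr -mulrBr in Hsum.
have := congr1 (@normc R) Hsum; rewrite ncN !ncM ncR gtr0_norm// ncX => HH.
rewrite -(@ler_pM2l _ (2 * pi))// HH.
have -> : normc c = q by rewrite /c ncM ncV ncR gtr0_norm.
rewrite (_ : 2 * pi * (2 * M * q ^+ N) = q ^+ N * (2 * M * (2 * pi - 0))); last by ring.
rewrite ler_wpM2l ?exprn_ge0//; apply: cint_bound => //; first exact: ltW.
move=> t ht; rewrite /E; move: (F t) (HM t ht) => y hy; rewrite !ncM ncX ncJ nc_cis expr1n mul1r ncN.
have -> : normc ('i : R[i]) = 1 by rewrite /= expr0n/= expr1n add0r sqrtr1.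
by rewrite mul1r.
Qed.

End Holomorphic.

(** * Taylor series *)

Section Taylor.
Variable R : realType.
Implicit Types (f g h : R[i] -> R[i]) (z w : R[i]) (a b : nat -> R[i]).

Lemma psum0 a N : psum a 0 N.+1 = a 0%N.
Proof.
rewrite /psum big_ord_recl/= expr0 mulr1 big1 ?addr0// => i _.
by rewrite expr0n mulr0.
Qed.

(** The terms of positive degree are dominated by a geometric series in [|w|]. *)
Lemma pconv_near0 a z0 s : z0 != 0 -> pconv a z0 s -> forall e : R, 0 < e ->
  exists2 d : R, 0 < d & forall w v, normc w < d -> pconv a w v -> normc (v - a 0%N) <= e.
Proof.
move=> z00 hz e e0; have [M M0 HM] := pconv_term_bounded hz.
pose r := normc z0; have r0 : 0 < r by rewrite nc_gt0.
exists (Num.min (r / 2) (e / 4 * r / (M + 1))).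
  by rewrite lt_min !divr_gt0// ?mulr_gt0//; lra.
move=> w v; rewrite lt_min => /andP[w1 w2] hv.
have e2 : 0 < e / 2 by lra.
have [N0 HN] := hv _ e2; have := HN N0.+1 (leqnSn _).
have K : normc (psum a w N0.+1 - a 0%N) <= e / 2.
  rewrite /psum big_ord_recl/= expr0 mulr1 addrAC subrr add0r.
  rewrite (le_trans (nc_sum _ _ _))//.
  rewrite (@le_trans _ _ (\sum_(i < N0) M * (normc w / r) ^+ i.+1))//.
    apply: ler_sum => i _; rewrite ncM ncX /bump/= add1n.
    have := HM i.+1; rewrite -ler_pdivlMr ?exprn_gt0//= => hM.
    rewrite expr_div_n mulrA mulrAC ler_wpM2r ?exprn_ge0//.
  rewrite -mulr_sumr.
  have -> : \sum_(i < N0) (normc w / r) ^+ i.+1 = \sum_(1 <= n < N0.+1) (normc w / r) ^+ n.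
    by rewrite big_add1/= big_mkord.
  have q0 : 0 <= normc w / r by rewrite divr_ge0// ltW.
  have q2 : normc w / r <= 1 / 2 by rewrite ler_pdivrMr//; lra.
  rewrite (le_trans (ler_wpM2l M0 (geo_tail_le _ _ q0 q2)))// expr1.
  have : normc w / r <= e / 4 / (M + 1).
    by rewrite ler_pdivrMr// ltW// mulrAC.
  move=> k; rewrite (le_trans (ler_wpM2l M0 (ler_wpM2l _ k)))//.
  rewrite (_ : M * _ = e / 2 * (M / (M + 1))); last by field; lra.
  by rewrite ler_piMr ?(ltW e2)// ler_pdivrMr ?mul1r; lra.
move=> k; rewrite (_ : v - _ = (psum a w N0.+1 - a 0%N) - (psum a w N0.+1 - v)); last by ring.
by rewrite (le_trans (ncB _ _))//; lra.
Qed.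

(** The means over a circle expand [f] off the centre by Cauchy's formula; the centre is
    reached by continuity, and uniqueness of the expansion makes the radius immaterial. *)
Lemma taylor f : hol f -> exists a, forall z, disc z -> pconv a z (f z).
Proof.
move=> hf; pose A := circ_coef f (1 / 2).
have half : (1 / 2 : R) < 1 by lra.
(* the value at the centre, by continuity *)
have fA (rho : R) : 0 < rho -> rho < 1 -> f 0 = circ_coef f rho 0%N.
  move=> r0 r1; set B := circ_coef f rho.
  apply/eqP; rewrite -subr_eq0; apply/eqP/nc_small0 => e e0.
  have e2 : 0 < e / 2 by lra.
  have [d1 d10 H1] := hol_cont hf (disc0 R) e2.
  have z0n : normc (rho / 2)%:C < rho by rewrite ncR gtr0_norm; lra.
  have z00 : (rho / 2)%:C != 0 :> R[i] by rewrite -nc_gt0 ncR gtr0_norm; lra.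
  have [d2 d20 H2] := pconv_near0 z00 (circ_coef_conv hf z00 z0n r1) e2.
  pose x := Num.min (rho / 2) (Num.min (d1 / 2) (d2 / 2)).
  have [x1 [x2 x3]] : x <= rho / 2 /\ x <= d1 / 2 /\ x <= d2 / 2.
    by rewrite /x !ge_min !lexx !orbT.
  have x0 : 0 < x by rewrite !lt_min !divr_gt0.
  have nx : normc x%:C = x by rewrite ncR gtr0_norm.
  have x00 : x%:C != 0 :> R[i] by rewrite -nc_gt0 nx.
  have xr : normc x%:C < rho by rewrite nx; lra.
  have := H2 x%:C _ _ (circ_coef_conv hf x00 xr r1); rewrite nx => /(_ ltac:(lra)) k2.
  have := H1 x%:C; rewrite subr0 nx => /(_ ltac:(lra)) k1.
  rewrite (_ : f 0 - B 0%N = (f x%:C - B 0%N) - (f x%:C - f 0)); last by ring.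
  by rewrite (le_trans (ncB _ _))//; lra.
have conv (rho : R) z : 0 < rho -> rho < 1 -> normc z < rho ->
    pconv (circ_coef f rho) z (f z).
  move=> r0 r1 zr; have [->|z0] := eqVneq z 0; last exact: circ_coef_conv.
  move=> e e0; exists 1%N => -[//|N] _.
  by rewrite psum0 -fA// subrr normc0 ltW.
exists A => z; rewrite discE => z1.
pose rho := (normc z + 1) / 2.
have r0 : 0 < rho by rewrite /rho; have := normc_ge0 z; lra.
have r1 : rho < 1 by rewrite /rho; lra.
rewrite (_ : A = circ_coef f rho); first by apply: conv => //; rewrite /rho; lra.
apply: (@pconv_unique _ _ _ f (Num.min (1 / 2) rho)).
- by rewrite lt_min r0; lra.
- by move=> u; rewrite lt_min => /andP[u1 u2]; apply: conv => //; lra.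
- by move=> u; rewrite lt_min => /andP[u1 u2]; apply: conv.
Qed.

(** Adding or subtracting the geometric tail turns the partial sums into a decreasing or
    an increasing sequence, so the limit is a supremum. *)
Lemma real_geo_sum (u : nat -> R) (M q : R) : 0 <= q < 1 -> 0 <= M ->
  (forall n, `|u n| <= M * q ^+ n) ->
  exists l : R, forall N, `|\sum_(n < N) u n - l| <= M * q ^+ N / (1 - q).
Proof.
move=> /andP[q0 q1] M0 Hu; have q1' : 0 < 1 - q by lra.
pose v N := \sum_(n < N) u n + M * q ^+ N / (1 - q).
pose v' N := \sum_(n < N) u n - M * q ^+ N / (1 - q).
have stepE N : M * q ^+ N / (1 - q) = M * q ^+ N + M * q ^+ N.+1 / (1 - q).
  by rewrite exprS; field; lra.
have dec m n : (m <= n)%N -> v n <= v m /\ v' m <= v' n.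
  move/subnK => <-; elim: (n - m)%N => [|k [IH1 IH2]]; first by split.
  have := Hu (k + m)%N; rewrite ler_norml => /andP[h1 h2].
  have := stepE (k + m)%N; move: IH1 IH2; rewrite /v /v' addSn !big_ord_recr/=.
  by lra.
have T0 N : 0 <= M * q ^+ N / (1 - q) by rewrite divr_ge0 ?mulr_ge0 ?exprn_ge0// ltW.
have vv' m n : v' m <= v n.
  have [mn|/ltnW nm] := leqP m n.
    by rewrite (le_trans (dec _ _ mn).2)// /v /v' ; have := T0 n; lra.
  by rewrite (le_trans _ (dec _ _ nm).1)// /v /v'; have := T0 m; lra.
exists (sup (range v')) => N.
have h1 : sup (range v') <= v N.
  by apply: ge_sup; [exists (v' 0%N), 0%N|move=> _ [m _ <-]].
have h2 : v' N <= sup (range v').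
  by apply: ub_le_sup; [exists (v 0%N) => _ [m _ <-]|exists N].
by rewrite ler_norml; move: h1 h2; rewrite /v /v'; lra.
Qed.

Lemma geo_sum (u : nat -> R[i]) (M q : R) : 0 <= q < 1 -> 0 <= M ->
  (forall n, normc (u n) <= M * q ^+ n) ->
  exists l : R[i], forall N, normc (\sum_(n < N) u n - l) <= 2 * (M * q ^+ N / (1 - q)).
Proof.
move=> hq M0 Hu.
have [x Hx] := @real_geo_sum (fun n => complex.Re (u n)) M q hq M0
  (fun n => le_trans (ncRe _) (Hu n)).
have [y Hy] := @real_geo_sum (fun n => complex.Im (u n)) M q hq M0
  (fun n => le_trans (ncIm _) (Hu n)).
exists (x +i* y) => N; rewrite (le_trans (nc_le_ReIm _))// cReD cImD cReN cImN/=.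
have -> : complex.Re (\sum_(n < N) u n) = \sum_(n < N) complex.Re (u n).
  by elim/big_ind2 : _ => // ? ? ? ? <- <-; rewrite cReD.
have -> : complex.Im (\sum_(n < N) u n) = \sum_(n < N) complex.Im (u n).
  by elim/big_ind2 : _ => // ? ? ? ? <- <-; rewrite cImD.
by have := Hx N; have := Hy N; lra.
Qed.

Lemma geo_small (M q : R) : 0 <= q < 1 -> forall e : R, 0 < e ->
  exists N0, forall N, (N0 <= N)%N -> M * q ^+ N <= e.
Proof.
move=> /andP[q0 q1] e e0.
have : (fun N => M * q ^+ N) @ \oo --> (M * 0 : R).
  by apply: cvgMr; apply: cvg_expr; rewrite ger0_norm.
rewrite mulr0 => /cvgrPdist_le /(_ _ e0)[N0 _ HN]; exists N0 => N hN.
by have := HN N hN; rewrite sub0r normrN; apply: le_trans; exact: ler_norm.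
Qed.

Lemma pconv_geo a z (M q : R) : 0 <= q < 1 -> 0 <= M ->
  (forall n, normc (a n) * normc z ^+ n <= M * q ^+ n) -> exists s, pconv a z s.
Proof.
move=> hq M0 H; have [l Hl] := @geo_sum (fun n => a n * z ^+ n) M q hq M0
  (fun n => ltac:(by rewrite ncM ncX)).
exists l => e e0; have [N0 HN] := geo_small (2 * (M / (1 - q))) hq e0.
exists N0 => N hN; rewrite (le_trans (Hl N))// (le_trans _ (HN N hN))//.
by rewrite le_eqVlt; apply/orP; left; apply/eqP; field; lra.
Qed.

(** Second-order remainder of the monomials, by induction on the degree. *)
Lemma monomial_remainder z w (d : R) n : 0 < d -> normc w <= d ->
  normc ((z + w) ^+ n - z ^+ n - n%:R * z ^+ n.-1 * w) <=
    (normc w / d) ^+ 2 * (normc z + d) ^+ n.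
Proof.
move=> d0 wd; have X0 : 0 <= normc z + d by rewrite addr_ge0// ltW.
have wd0 : 0 <= normc w / d by rewrite divr_ge0// ltW.
have U m : normc ((z + w) ^+ m - z ^+ m) <= normc w / d * (normc z + d) ^+ m.
  elim: m => [|m IH]; first by rewrite !expr0 subrr normc0 mulr1.
  rewrite (_ : _ - _ = z * ((z + w) ^+ m - z ^+ m) + w * (z + w) ^+ m); last by rewrite !exprS; ring.
  rewrite (le_trans (ncD _ _))// !ncM ncX.
  rewrite (_ : _ * _ ^+ m.+1 = normc z * (normc w / d * (normc z + d) ^+ m) +
    normc w * (normc z + d) ^+ m); last by rewrite exprS; field; rewrite gt_eqF.
  apply: lerD; rewrite ler_wpM2l// lerXn2r ?nnegrE//.
  by rewrite (le_trans (ncD _ _))// lerD2l.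
elim: n => [|n IH]; first by rewrite !expr0 mul0r mul0r subrr subr0 normc0 mulr1 exprn_ge0.
rewrite (_ : _ - _ - _ = z * ((z + w) ^+ n - z ^+ n - n%:R * z ^+ n.-1 * w) +
    w * ((z + w) ^+ n - z ^+ n)); last first.
  case: n {IH} => [|n]; first by rewrite !expr0 !expr1; ring.
  by rewrite /= -[n.+2%:R]natr1 !exprS; ring.
rewrite (le_trans (ncD _ _))// !ncM.
rewrite (_ : _ * _ ^+ n.+1 = normc z * ((normc w / d) ^+ 2 * (normc z + d) ^+ n) +
    normc w * (normc w / d * (normc z + d) ^+ n)); last first.
  by rewrite !exprS; field; rewrite gt_eqF.
by apply: lerD; rewrite ler_wpM2l.
Qed.

Definition dcoef a n : R[i] := n.+1%:R * a n.+1.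

(** The remainders of the monomials are quadratic in the increment, and their sum against
    the coefficients is dominated by a geometric series. *)
Lemma pconv_cder a f z : (forall z, disc z -> pconv a z (f z)) -> disc z ->
  exists B, pconv (dcoef a) z B /\ cder f z B.
Proof.
move=> Hf; rewrite discE => z1.
pose d := (1 - normc z) / 4; have d0 : 0 < d by rewrite /d; lra.
pose X := normc z + d; pose r := X + d.
have r1 : r < 1 by rewrite /r /X /d; lra.
have X0 : 0 < X by rewrite /X ltr_wpDl.
have r0 : 0 < r by rewrite /r; lra.
have [|M M0 HM] := @pconv_term_bounded _ a r%:C (f r%:C).
  by apply: Hf; rewrite discE ncR gtr0_norm.
rewrite ncR gtr0_norm// in HM.
pose q := X / r; have hq : 0 <= q < 1.
  by rewrite divr_ge0 ?(ltW X0) ?(ltW r0)//= ltr_pdivrMr// mul1r /r; lra.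
have aX n : normc (a n) * X ^+ n <= M * q ^+ n.
  rewrite /q expr_div_n mulrA mulrAC ler_wpM2r ?exprn_ge0 ?(ltW X0)//.
  by rewrite ler_pdivlMr ?exprn_gt0.
have nX n : n.+1%:R * normc z ^+ n <= X ^+ n.+1 / d.
  rewrite ler_pdivlMr//; elim: n => [|n IH].
    by rewrite expr0 expr1 mul1r mul1r /X lerDr.
  rewrite (_ : _ * d = normc z * (n.+1%:R * normc z ^+ n * d) + d * normc z ^+ n.+1); last first.
    by rewrite -[n.+2%:R]natr1 exprS; ring.
  rewrite (_ : X ^+ n.+2 = normc z * X ^+ n.+1 + d * X ^+ n.+1); last first.
    by rewrite [LHS]exprS -mulrDl.
  apply: lerD; first by rewrite ler_wpM2l.
  by rewrite ler_wpM2l ?(ltW d0)// lerXn2r ?nnegrE ?(ltW X0)// /X lerDl ltW.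
have [B HB] : exists B, pconv (dcoef a) z B.
  apply: (@pconv_geo _ _ (M * q / d) q) => //.
    by rewrite divr_ge0 ?(ltW d0)// mulr_ge0//; lra.
  move=> n; rewrite /dcoef ncM (_ : (n.+1%:R : R[i]) = n.+1%:R%:C); last by rewrite rmorph_nat.
  rewrite ncR ger0_norm// mulrAC mulrC.
  rewrite (le_trans (ler_wpM2l _ (nX n)))// mulrA (_ : M * q / d * q ^+ n = M * q ^+ n.+1 / d).
    by rewrite ler_wpM2r// invr_ge0 ltW.
  by rewrite exprS; ring.
exists B; split => // e e0.
pose K := M / (1 - q); have K0 : 0 <= K by rewrite divr_ge0//; lra.
pose d' := Num.min d (e * d ^+ 2 / (2 * (K + 1))).
have d'0 : 0 < d'.
  by rewrite lt_min d0 divr_gt0// ?mulr_gt0 ?exprn_gt0//; lra.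
exists d' => // w; rewrite lt_min => /andP[w1 w2].
have zw1 : disc (z + w).
  by rewrite discE (le_lt_trans (ncD _ _))//; move: w1; rewrite /d; lra.
have dz : disc z by rewrite discE.
(* three error terms and the remainder of the partial sums *)
apply/ler_addgt0Pr => e' e'0; have e6 : 0 < e' / 3 by lra.
have [N1 H1] := Hf _ zw1 _ e6; have [N2 H2] := Hf _ dz _ e6.
have e7 : 0 < e' / (3 * (normc w + 1)) by rewrite divr_gt0// mulr_gt0// ltr_wpDl.
have [N3 H3] := HB _ e7.
pose N := maxn N1 (maxn N2 N3.+1).
have := H1 N (leq_maxl _ _).
have := H2 N (leq_trans (leq_maxl _ _) (leq_maxr _ _)).
have hN3 : (N3 < N)%N by rewrite /N !leq_max ltnSn !orbT.
have N0 : (0 < N)%N by exact: leq_ltn_trans hN3.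
have := H3 N.-1; rewrite -ltnS prednK// => /(_ hN3) k3 k2 k1.
have E : psum a (z + w) N - psum a z N - psum (dcoef a) z N.-1 * w =
    \sum_(n < N) a n * ((z + w) ^+ n - z ^+ n - n%:R * z ^+ n.-1 * w).
  rewrite /psum mulr_suml.
  have -> : \sum_(n < N.-1) dcoef a n * z ^+ n * w = \sum_(n < N) a n * (n%:R * z ^+ n.-1 * w).
    rewrite -[in RHS](prednK N0) big_ord_recl/= !mul0r mulr0 add0r.
    by apply: eq_bigr => i _; rewrite /dcoef /bump/= add1n; ring.
  rewrite -!sumrB; apply: eq_bigr => i _; ring.
have Sb : normc (\sum_(n < N) a n * ((z + w) ^+ n - z ^+ n - n%:R * z ^+ n.-1 * w)) <=
    (normc w / d) ^+ 2 * K.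
  rewrite (le_trans (nc_sum _ _ _))//.
  rewrite (@le_trans _ _ (\sum_(n < N) (normc w / d) ^+ 2 * (M * q ^+ n)))//.
    apply: ler_sum => n _; rewrite ncM.
    rewrite (le_trans (ler_wpM2l _ (monomial_remainder z n d0 (ltW w1))))//.
    by rewrite mulrCA ler_wpM2l// sqr_ge0.
  rewrite -!mulr_sumr ler_wpM2l ?sqr_ge0// /K ler_wpM2l//.
  rewrite -[leRHS]mul1r ler_pdivlMr; last by lra.
  rewrite mulrC -[1 - q]opprB mulNr -subrX1 opprB gerBl exprn_ge0//; lra.
have wK : (normc w / d) ^+ 2 * K <= e * normc w.
  rewrite expr_div_n expr2 (_ : _ * _ = normc w * (normc w * K / d ^+ 2)); last by field; lra.
  rewrite mulrC ler_wpM2r// ler_pdivrMr ?exprn_gt0//.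
  rewrite (@le_trans _ _ (e * d ^+ 2 / (2 * (K + 1)) * K))//.
    by rewrite ler_wpM2r// ltW.
  have ed : 0 <= e * d ^+ 2 by rewrite mulr_ge0 ?sqr_ge0// ltW.
  rewrite -mulrA -[leRHS]mulr1 ler_wpM2l// mulrC ler_pdivrMr; lra.
rewrite (_ : _ - _ - _ = (\sum_(n < N) a n * ((z + w) ^+ n - z ^+ n - n%:R * z ^+ n.-1 * w)) -
  (psum a (z + w) N - f (z + w)) + (psum a z N - f z) +
  (psum (dcoef a) z N.-1 - B) * w); last by rewrite -E; ring.
have k4 : normc ((psum (dcoef a) z N.-1 - B) * w) <= e' / 3.
  rewrite ncM (le_trans (ler_wpM2r _ k3))//.
  have w0 : 0 < normc w + 1 by rewrite ltr_wpDl.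
  rewrite [leLHS](_ : _ = e' / 3 * (normc w / (normc w + 1))); last by field; lra.
  by rewrite ler_piMr ?(ltW e6)// ler_pdivrMr// mul1r lerDl.
apply: (le_trans (ncD _ _)); apply: (le_trans (lerD (ncD _ _) (lexx _))).
apply: (le_trans (lerD (lerD (ncB _ _) (lexx _)) (lexx _))).
by lra.
Qed.

Lemma pconv_hol a f : (forall z, disc z -> pconv a z (f z)) -> hol f.
Proof.
move=> Hf; apply: cder_hol => z hz.
by have [B [_ hB]] := pconv_cder Hf hz; exists B.
Qed.

(** Taylor coefficients at the origin, selected by choice: [taylor] gives existence. *)
Definition tc f : nat -> R[i] := xget (fun=> 0) [set a | forall z, disc z -> pconv a z (f z)].

Lemma tcP f z : hol f -> disc z -> pconv (tc f) z (f z).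
Proof.
move=> hf; have [a ha] := taylor hf.
have := xgetPex (fun=> 0) (ex_intro (fun a => forall z, disc z -> pconv a z (f z)) a ha).
by apply.
Qed.

Lemma tc_unique f a : (forall z, disc z -> pconv a z (f z)) -> tc f = a.
Proof.
move=> ha; have hf := pconv_hol ha.
apply: (@pconv_unique _ _ _ f 1) => // z; rewrite -discE => hz; last exact: ha.
exact: tcP.
Qed.

Lemma tc_ext f g : (forall z, disc z -> f z = g z) -> hol f -> tc g = tc f.
Proof. by move=> fg hf; apply: tc_unique => z hz; rewrite -fg//; exact: tcP. Qed.

Lemma tc_at0 f : hol f -> f 0 = tc f 0%N.
Proof.
move=> hf; apply: (@pconv_unique_val _ (tc f) 0); first exact/tcP/disc0.
by move=> e e0; exists 1%N => -[//|N] _; rewrite psum0 subrr normc0 ltW.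
Qed.

Lemma tc_derive1 f z : hol f -> disc z ->
  pconv (dcoef (tc f)) z (derive1 (f : R[i]^o -> R[i]^o) z).
Proof.
move=> hf hz; have [B [hB1 hB2]] := pconv_cder (fun z hz => @tcP f z hf hz) hz.
by rewrite (cder_derive1 hB2).
Qed.

End Taylor.

(** * Parseval's identity on the circle *)

Section Parseval.
Variable R : realType.
Implicit Types (t : R) (c : nat -> R[i]) (F : R -> R[i]).
Local Notation mu := (@lebesgue_measure R).

Lemma ccont_measurable (x y : R) F : ccont x y F ->
  measurable_fun `[x, y] (fun t => normc (F t)).
Proof.
move=> cF; apply/measurable_EFinP.
have : mu.-integrable `[x, y] (EFin \o (fun t => normc (F t))).
  apply: continuous_compact_integrable; first exact: segment_compact.
  exact: (ccont_comp_real (@nc_lip R) cF).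
exact: (@measurable_int _ _ _ mu).
Qed.

Lemma ccont_cisX n (x y : R) : ccont x y (fun t => cis t ^+ n).
Proof.
case: n => [|n]; last exact: cdrv_cont (cdrvX n (@cdrv_cis R)).
exact: ccont_cst.
Qed.

Lemma cint_cisX n : (0 < n)%N -> cint 0 (2 * pi) (fun t : R => cis t ^+ n) = 0.
Proof.
have p0 : 0 <= 2 * pi :> R by rewrite mulr_ge0// pi_ge0.
case: n => // n _.
have i0 : 'i * n.+1%:R != 0 :> R[i].
  rewrite mulf_neq0 ?pnatr_eq0// eq_complex /= eqxx oner_eq0//.
have dG : cdrv (fun t : R => ('i * n.+1%:R)^-1 * cis t ^+ n.+1) (fun t => cis t ^+ n.+1).
  apply: cdrv_ext (cdrvM (cdrv_cst _) (cdrvX n (@cdrv_cis R))) => t /=.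
  rewrite mul0r add0r exprS; move: (cis t) => d.
  rewrite (_ : _ * _ * _ = ('i * n.+1%:R) * (d * d ^+ n)); last by ring.
  by rewrite mulrA mulVf// mul1r.
rewrite (cint_FTC p0 dG); last exact: ccont_cisX.
by rewrite cis0 cis2pi subrr.
Qed.

Lemma cint_cisMJ n m : cint 0 (2 * pi) (fun t : R => cis t ^+ n * (cis t)^* ^+ m) =
  if n == m then (2 * pi)%:C else 0.
Proof.
have [nm|mn] := leqP n m.
  rewrite (@eq_cint _ _ _ _ (fun t => (cis t)^* ^+ (m - n))); last first.
    by move=> t _; rewrite -{1}(subnKC nm) exprD mulrA -exprMn cisJ expr1n mul1r.
  by rewrite cint_cisJX subn_eq0 eqn_leq nm.
rewrite (@eq_cint _ _ _ _ (fun t => cis t ^+ (n - m))); last first.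
  move=> t _; rewrite -{1}(subnKC (ltnW mn)) exprD mulrAC -exprMn cisJ expr1n mul1r//.
by rewrite cint_cisX ?subn_gt0// gtn_eqF.
Qed.

(** Orthogonality of the exponentials. *)
Lemma parseval_finite c N :
  (\int[mu]_(t in `[0%R, (2 * pi)%R])
    (normc (\sum_(n < N) c n * cis t ^+ n) ^+ 2)%:E)%E =
  (2 * pi * \sum_(n < N) normc (c n) ^+ 2)%:E.
Proof.
pose S t := \sum_(n < N) c n * cis t ^+ n.
have cn n : ccont 0 (2 * pi) (fun t => c n * cis t ^+ n).
  by apply: ccontM; [exact: ccont_cst|exact: ccont_cisX].
have [cS _] := cint_sum N cn.
pose G m t := (c m)^* * (\sum_(n < N) c n * (cis t ^+ n * (cis t)^* ^+ m)).
have cG2 m n : ccont 0 (2 * pi) (fun t => c n * (cis t ^+ n * (cis t)^* ^+ m)).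
  apply: ccontM; first exact: ccont_cst.
  by apply: ccontM; [exact: ccont_cisX|exact: ccont_cisJX].
have cG m : ccont 0 (2 * pi) (G m).
  by apply: ccontM; [exact: ccont_cst|exact: (cint_sum N (cG2 m)).1].
have [cT IT] := cint_sum N cG.
have ST t : (normc (S t) ^+ 2)%:C = \sum_(m < N) G m t.
  rewrite nc_sqJ [in X in _ * X]/S rmorph_sum/= mulr_sumr; apply: eq_bigr => m _.
  rewrite rmorphM rmorphXn/= /G mulrCA; congr (_ * _).
  by rewrite /S mulr_suml; apply: eq_bigr => n _; rewrite mulrA.
have I : cint 0 (2 * pi) (fun t => (normc (S t) ^+ 2)%:C) =
    (2 * pi * \sum_(n < N) normc (c n) ^+ 2)%:C.
  rewrite (@eq_cint _ _ _ _ (fun t => \sum_(m < N) G m t)); last by move=> t _; rewrite ST.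
  rewrite IT rmorphM rmorph_sum/= mulr_sumr; apply: eq_bigr => m _.
  rewrite /G cintZ; last exact: (cint_sum N (cG2 m)).1.
  rewrite (cint_sum N (cG2 m)).2 (bigD1 m)//= big1 ?addr0; last first.
    move=> n nm; rewrite cintZ; last first.
      by apply: ccontM; [exact: ccont_cisX|exact: ccont_cisJX].
    by rewrite cint_cisMJ ifN// mulr0.
  rewrite cintZ; last by apply: ccontM; [exact: ccont_cisX|exact: ccont_cisJX].
  by rewrite cint_cisMJ eqxx nc_sqJ; ring.
have cSS : ccont 0 (2 * pi) (fun t => (normc (S t) ^+ 2)%:C).
  move=> x hx e e0; have [d d0 Hd] := cT x hx e e0; exists d => // y hy xy.
  by rewrite !ST; exact: Hd.
have /integrable_fin_num := ccont_Re cSS.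
rewrite /= => /(_ (measurable_itv _)) fi.
have := congr1 (@complex.Re R) I; rewrite /= /Rintegral /= => <-.
by rewrite fineK.
Qed.

(** Parseval for absolutely convergent series, by dominated convergence. *)
Lemma parseval c F (M : R) : (forall N, \sum_(n < N) normc (c n) <= M) ->
  (forall t, (fun N => normc (\sum_(n < N) c n * cis t ^+ n - F t)) @ \oo --> (0 : R)) ->
  (fun N => (2 * pi * \sum_(n < N) normc (c n) ^+ 2)%:E) @ \oo -->
    (\int[mu]_(t in `[0%R, (2 * pi)%R]) (normc (F t) ^+ 2)%:E)%E.
Proof.
move=> HM HF.
have M0 : 0 <= M by have := HM 0%N; rewrite big_ord0.
pose S N t := \sum_(n < N) c n * cis t ^+ n.
have Sb N t : normc (S N t) <= M.
  rewrite (le_trans (nc_sum _ _ _))// (le_trans _ (HM N))// ler_sum// => n _.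
  by rewrite ncM ncX nc_cis expr1n mulr1.
have cn n : ccont 0 (2 * pi) (fun t => c n * cis t ^+ n).
  by apply: ccontM; [exact: ccont_cst|exact: ccont_cisX].
have mS N : measurable_fun `[0, 2 * pi] (fun t => normc (S N t) ^+ 2).
  by apply: measurable_funX; apply: ccont_measurable; exact: (cint_sum N cn).1.
have SF t : (fun N => normc (S N t)) @ \oo --> normc (F t).
  apply/cvgrPdist_le => e e0; have /cvgrPdist_le /(_ _ e0) := HF t.
  apply: filterS => N; rewrite sub0r normrN ger0_norm// => h.
  by rewrite (le_trans (nc_lip _ _))// ncBC.
have SF2 t : (fun N => normc (S N t) ^+ 2) @ \oo --> normc (F t) ^+ 2.
  by rewrite expr2; under eq_fun do rewrite expr2; apply: cvgM; exact: SF.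
under eq_fun do rewrite -parseval_finite.
have [] := @dominated_convergence _ _ _ mu `[0, 2 * pi]%classic (measurable_itv _)
  (fun N t => (normc (S N t) ^+ 2)%:E) (fun t => (normc (F t) ^+ 2)%:E) (fun=> (M ^+ 2)%:E).
- by move=> N; apply/measurable_EFinP; exact: mS.
- apply/measurable_EFinP; apply: (measurable_fun_cvg (h := fun N t => normc (S N t) ^+ 2)).
    exact: mS.
  by move=> t _; exact: SF2.
- apply: aeW => t _; apply: cvg_EFin; last exact: SF2.
  by apply: nearW.
- apply/integrableP; split; first exact: measurable_cst.
  rewrite integral_cst//= lebesgue_measure_itv/=; case: ifP => _; last by rewrite mule0.
  by rewrite -EFinB -EFinM ltry.
- apply: aeW => t N _; rewrite /= ger0_norm ?sqr_ge0// lee_fin.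
  by rewrite lerXn2r ?nnegrE.
by move=> _ _.
Qed.

End Parseval.

(** * Rotation invariance of plane measure *)

Section PlaneMeasure.
Variable R : realType.
Implicit Types (c t x y : R) (p : R * R).
Local Notation mu := (@lebesgue_measure R).
Local Notation mu2 := (product_measure1 mu mu).
Local Open Scope ereal_scope.

Lemma lebesgue_translation c (A : set R) : measurable A ->
  pushforward mu ((fun x => x + c)%R : _ -> measurableTypeR R) A = mu A.
Proof.
have mT : measurable_fun setT (fun x : R => x + c)%R by exact: measurable_funD.
move=> mA; apply/esym/lebesgue_measure_unique => //= _ [[a b]] _ <-.
rewrite /pushforward (_ : _ @^-1` _ = `]a - c, b - c]%classic)%R; last first.
  by apply/seteqP; split => x /=; rewrite !in_itv/= ltrBlDr lerBrDr.
by rewrite !lebesgue_measure_itv/= !lte_fin ltrD2r -!EFinB opprB addrA subrK.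
Qed.

Lemma integral_translation (h : R -> \bar R) c : measurable_fun setT h ->
  (forall x, 0 <= h x) -> \int[mu]_x h (x + c)%R = \int[mu]_x h x.
Proof.
have mT : measurable_fun setT ((fun x => x + c)%R : _ -> measurableTypeR R).
  exact: measurable_funD.
move=> mh h0; transitivity (\int[pushforward mu ((fun x => x + c)%R : _ -> measurableTypeR R)]_x h x).
  by rewrite ge0_integral_pushforward.
apply: eq_measure_integral => A mA _; exact: lebesgue_translation.
Qed.

Definition nonneg_meas (h : R * R -> \bar R) := measurable_fun setT h /\ forall p, 0 <= h p.

Lemma nonneg_meas_comp (h : R * R -> \bar R) (s : R * R -> R * R) :
  measurable_fun setT s -> nonneg_meas h -> nonneg_meas (h \o s).
Proof. by move=> ms [mh h0]; split; [exact: (measurableT_comp mh ms)|move=> p; exact: h0]. Qed.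

Lemma measurable_linear (a b a' b' : R) :
  measurable_fun setT (fun p => (a * p.1 + b * p.2, a' * p.1 + b' * p.2)%R).
Proof.
apply: measurable_fun_pair; apply: measurable_funD; apply: measurable_funM => //;
  by [exact: measurable_fst|exact: measurable_snd].
Qed.

Lemma measurable_flip : measurable_fun setT (fun p : R * R => (p.2, p.1)).
Proof. by apply: measurable_fun_pair; [exact: measurable_snd|exact: measurable_fst]. Qed.

Lemma integral_swap h : nonneg_meas h ->
  \int[mu2]_p h (p.2, p.1) = \int[mu2]_p h p.
Proof.
move=> [mh h0].
have ms : nonneg_meas (fun p => h (p.2, p.1)).
  by split; [exact: (measurableT_comp mh measurable_flip)|move=> p; exact: h0].
apply: etrans (@fubini_tonelli1 _ _ _ _ _ mu mu _ ms.1 ms.2) _.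
by apply: etrans (esym (@fubini_tonelli2 _ _ _ _ _ mu mu _ mh h0)).
Qed.

(** By Tonelli a shear acts on each horizontal line as a translation. *)
Lemma integral_shear1 h c : nonneg_meas h ->
  \int[mu2]_p h (p.1 + c * p.2, p.2)%R = \int[mu2]_p h p.
Proof.
move=> nh; have [mh h0] := nh.
have [ms s0] : nonneg_meas (h \o (fun p => (p.1 + c * p.2, p.2)%R)).
  apply: nonneg_meas_comp => //.
  apply: measurable_fun_pair; last exact: measurable_snd.
  by apply: measurable_funD; [exact: measurable_fst|apply: measurable_funM => //; exact: measurable_snd].
apply: etrans (@fubini_tonelli2 _ _ _ _ _ mu mu _ ms s0) _.
apply: etrans (esym (@fubini_tonelli2 _ _ _ _ _ mu mu _ mh h0)).
apply: eq_integral => y _; rewrite /fubini_G /=.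
rewrite (integral_translation (h := fun x => h (x, y))) //.
exact: measurableT_comp.
Qed.

Lemma integral_shear2 h c : nonneg_meas h ->
  \int[mu2]_p h (p.1, p.2 + c * p.1)%R = \int[mu2]_p h p.
Proof.
move=> nh; rewrite -(integral_swap nh).
have nh' : nonneg_meas (fun p => h (p.2, p.1)).
  by split => [|p]; [exact: (measurableT_comp nh.1 measurable_flip)|exact: nh.2].
rewrite -(integral_shear1 c nh') -[RHS]integral_swap//.
apply: (@nonneg_meas_comp (fun p => h (p.2, p.1)) (fun p => (p.1 + c * p.2, p.2)%R)) => //.
apply: measurable_fun_pair; last exact: measurable_snd.
by apply: measurable_funD; [exact: measurable_fst|apply: measurable_funM => //; exact: measurable_snd].
Qed.

Definition rot (a b : R) p : R * R := (a * p.1 - b * p.2, b * p.1 + a * p.2)%R.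

Lemma measurable_rot a b : measurable_fun setT (rot a b).
Proof.
rewrite (_ : rot a b = fun p => (a * p.1 + (- b) * p.2, b * p.1 + a * p.2)%R).
  exact: measurable_linear.
by apply/funext => p; rewrite /rot mulNr.
Qed.

(** Away from the half-turn a rotation is a product of three shears. *)
Lemma integral_rot_shear h (a b : R) : nonneg_meas h -> (a ^+ 2 + b ^+ 2 = 1)%R ->
  (a != -1)%R -> \int[mu2]_p h (rot a b p) = \int[mu2]_p h p.
Proof.
move=> nh ab a1; have a10 : (1 + a != 0)%R by rewrite addrC -[1%R]opprK subr_eq0.
pose al := (- b / (1 + a))%R.
have E p : rot a b p = let q1 := (p.1 + al * p.2, p.2)%R in
    let q2 := (q1.1, q1.2 + b * q1.1)%R in (q2.1 + al * q2.2, q2.2)%R.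
  have e1 : (1 + al * b = a)%R.
    rewrite /al; apply: (mulIf a10); rewrite mulrDl mul1r mulrAC divfK//.
    by rewrite -[X in (X + a + _)%R]ab; ring.
  have e2 : (2 * al + al ^+ 2 * b = - b)%R.
    rewrite (_ : _ + _ = al * (1 + (1 + al * b)))%R; last by ring.
    by rewrite e1 /al divfK.
  rewrite /rot /=; congr pair.
    rewrite (_ : (_ + _ * (_ + _))%R = (1 + al * b) * p.1 + (2 * al + al ^+ 2 * b) * p.2)%R; last by ring.
    by rewrite e1 e2 mulNr.
  rewrite (_ : (p.2 + _)%R = b * p.1 + (1 + al * b) * p.2)%R; last by ring.
  by rewrite e1.
have m1 : measurable_fun setT (fun p : R * R => (p.1 + al * p.2, p.2)%R).
  apply: measurable_fun_pair; last exact: measurable_snd.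
  by apply: measurable_funD; [exact: measurable_fst|apply: measurable_funM => //; exact: measurable_snd].
have m2 : measurable_fun setT (fun p : R * R => (p.1, p.2 + b * p.1)%R).
  apply: measurable_fun_pair; first exact: measurable_fst.
  by apply: measurable_funD; [exact: measurable_snd|apply: measurable_funM => //; exact: measurable_fst].
have n1 := nonneg_meas_comp m1 nh.
have n2 := nonneg_meas_comp m2 n1.
rewrite -(integral_shear1 al nh) -(integral_shear2 b n1) -(integral_shear1 al n2).
by apply: eq_integral => p _; rewrite E.
Qed.

(** The half-turn is the square of a quarter-turn. *)
Lemma integral_rot h (a b : R) : nonneg_meas h -> (a ^+ 2 + b ^+ 2 = 1)%R ->
  \int[mu2]_p h (rot a b p) = \int[mu2]_p h p.
Proof.
move=> nh ab; have [a1|a1] := eqVneq a (-1)%R; last exact: integral_rot_shear.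
have b0 : b = 0%R.
  by apply/eqP; rewrite -sqrf_eq0; apply/eqP; move: ab; rewrite a1 sqrrN expr1n; lra.
have q1 : (0 ^+ 2 + 1 ^+ 2 = 1 :> R)%R by rewrite expr0n expr1n add0r.
have q2 : (0 != -1 :> R)%R by rewrite eq_sym oppr_eq0 oner_eq0.
have nr := nonneg_meas_comp (measurable_rot 0 1) nh.
rewrite -[RHS](integral_rot_shear nh q1 q2) -[RHS](integral_rot_shear nr q1 q2).
by apply: eq_integral => p _; rewrite /= /rot /= a1 b0; congr (h (_, _)); ring.
Qed.

End PlaneMeasure.

(** * Moments of the disc *)

Section DiscMoments.
Variable R : realType.
Implicit Types (x y : R) (p : R * R).
Local Notation mu := (@lebesgue_measure R).
Local Notation mu2 := (product_measure1 mu mu).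

Definition planar_disc : set (R * R) := [set p | disc (p.1 +i* p.2)].

Lemma planar_discE p : planar_disc p <-> p.1 ^+ 2 + p.2 ^+ 2 < 1.
Proof.
rewrite /planar_disc /= discE -[normc _ < 1](@ltr_pXn2r _ 2)// ?nnegrE//.
by rewrite nc_sq expr1n.
Qed.

Lemma measurable_sqnorm : measurable_fun setT (fun p : R * R => p.1 ^+ 2 + p.2 ^+ 2).
Proof.
apply: measurable_funD; apply: measurable_funX; [exact: measurable_fst|exact: measurable_snd].
Qed.

Lemma measurable_planar_disc : measurable planar_disc.
Proof.
have -> : planar_disc = (fun p : R * R => p.1 ^+ 2 + p.2 ^+ 2) @^-1` `]-oo, 1[.
  by apply/seteqP; split => p; rewrite planar_discE /= in_itv.
by rewrite -[X in measurable X]setTI; apply: measurable_sqnorm.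
Qed.

(** The derivative in [y] of [y (x^2 + y^2)^n]. *)
Definition radial_dy n (p : R * R) : R :=
  (p.1 ^+ 2 + p.2 ^+ 2) ^+ n + n%:R * 2 * p.2 ^+ 2 * (p.1 ^+ 2 + p.2 ^+ 2) ^+ n.-1.

Lemma radial_dy_ge0 n p : 0 <= radial_dy n p.
Proof.
have r0 : 0 <= p.1 ^+ 2 + p.2 ^+ 2 by rewrite addr_ge0 ?sqr_ge0.
by rewrite /radial_dy addr_ge0 ?exprn_ge0// mulr_ge0 ?exprn_ge0// mulr_ge0 ?sqr_ge0// mulr_ge0.
Qed.

Lemma measurable_radial_dy n : measurable_fun setT (radial_dy n).
Proof.
have m k := measurable_funX k measurable_sqnorm.
have my : measurable_fun setT (fun p : R * R => n%:R * 2 * p.2 ^+ 2).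
  by apply: measurable_funM => //; apply: measurable_funX; exact: measurable_snd.
exact: (measurable_funD (m n) (measurable_funM my (m n.-1))).
Qed.

Lemma radial_section n x (s : R) : 0 < s -> x ^+ 2 + s ^+ 2 = 1 ->
  (\int[mu]_(y in `](- s)%R, s[) (radial_dy n (x, y))%:E = (2 * s)%:E)%E.
Proof.
move=> s0 xs; have ss : - s < s by rewrite gtrN.
pose P : {poly R} := 'X * ((x ^+ 2)%:P + 'X ^+ 2) ^+ n.
pose F y := P.[y].
have FE y : F y = y * (x ^+ 2 + y ^+ 2) ^+ n by rewrite /F /P !(hornerE, horner_exp).
have PE y : P^`().[y] = radial_dy n (x, y).
  rewrite /P /radial_dy derivM derivX mul1r deriv_exp derivD derivC add0r derivXn.
  rewrite !(hornerE, horner_exp, hornerMn) /= -mulr_natl; ring.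
have dF y : is_derive y 1 F (radial_dy n (x, y)) by rewrite -PE; exact: is_derive_poly.
have cf : {within `[- s, s], continuous (fun y => radial_dy n (x, y))}.
  apply: continuous_subspaceT => y.
  rewrite (_ : (fun _ => _) = horner P^`()); last by apply/funext => u; rewrite PE.
  exact: continuous_horner.
rewrite -(@integral_itv_bndoo _ (- s) s _ true false); last first.
  apply/measurable_EFinP; apply: measurable_funTS.
  apply: (measurableT_comp (measurable_radial_dy n)).
  by apply: measurable_fun_pair => //; exact: measurable_cst.
rewrite (@continuous_FTC2 _ _ F)//.
- rewrite !FE sqrrN xs expr1n !mulr1 -EFinB; congr (_%:E); ring.
- have cF y : {for y, continuous F}.
    by apply: differentiable_continuous; apply/derivable1_diffP; exact: (@ex_derive _ _ _ _ _ _ _ (dF y)).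
  split; first by move=> y _; exact: (@ex_derive _ _ _ _ _ _ _ (dF y)).
  + exact/cvg_at_right_filter/cF.
  + exact/cvg_at_left_filter/cF.
- by move=> y _; rewrite derive1E; exact: (@derive_val _ _ _ _ _ _ _ (dF y)).
Qed.

End DiscMoments.

Section DiscArea.
Variable R : realType.
Implicit Types (x y : R) (p : R * R).
Local Notation mu := (@lebesgue_measure R).
Local Notation mu2 := (product_measure1 mu mu).
Local Notation D := (@planar_disc R).
Local Open Scope ereal_scope.

Lemma disc_fiber n x : \int[mu]_y ((fun p => (radial_dy n p)%:E) \_ D) (x, y) =
  if (x ^+ 2 < 1)%R then (2 * Num.sqrt (1 - x ^+ 2))%R%:E else 0.
Proof.
have inD y : ((x, y) \in D) = (y ^+ 2 < 1 - x ^+ 2)%R.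
  by apply/idP/idP => [/set_mem/planar_discE/=|h]; [|apply/mem_set/planar_discE => /=]; lra.
case: ifPn => [x1|x1].
  have s0 : (0 < Num.sqrt (1 - x ^+ 2))%R by rewrite sqrtr_gt0 subr_gt0.
  have ss : (Num.sqrt (1 - x ^+ 2) ^+ 2 = 1 - x ^+ 2)%R by rewrite sqr_sqrtr// subr_ge0 ltW.
  rewrite -(@radial_section _ n x _ s0); last by rewrite ss addrC subrK.
  rewrite [RHS]integral_mkcond; apply: eq_integral => y _; rewrite !patchE inD.
  suff -> : (y ^+ 2 < 1 - x ^+ 2)%R = (y \in `](- Num.sqrt (1 - x ^+ 2))%R, (Num.sqrt (1 - x ^+ 2))%R[%classic).
    by [].
  rewrite mem_setE in_itv/= -ltr_norml -{1}ss -[(y ^+ 2)%R]real_normK ?num_real//.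
  by rewrite ltr_pXn2r// nnegrE ltW.
apply: integral0_eq => y _; rewrite patchE inD ifF//.
apply/negbTE; rewrite -leNgt (le_trans _ (sqr_ge0 y))//.
by rewrite subr_le0 leNgt.
Qed.

Lemma nonneg_meas_restrict (g : R * R -> R) : measurable_fun D g ->
  (forall p, 0 <= g p)%R -> nonneg_meas ((fun p => (g p)%:E) \_ D).
Proof.
move=> mg g0; split.
  apply/(measurable_restrictT _ (@measurable_planar_disc R)).
  exact/measurable_EFinP.
by move=> p; rewrite patchE; case: ifP => _; rewrite ?lee_fin.
Qed.

Definition disc_area := \int[mu2]_(p in D) 1%:E.

(** The value of the flux does not depend on [n], because the boundary is the unit circle. *)
Lemma integral_radial_dy n : \int[mu2]_(p in D) (radial_dy n p)%:E = disc_area.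
Proof.
have H k : \int[mu2]_(p in D) (radial_dy k p)%:E = \int[mu]_x
    if (x ^+ 2 < 1)%R then (2 * Num.sqrt (1 - x ^+ 2))%R%:E else 0.
  rewrite integral_mkcond.
  have [m0 h0] := nonneg_meas_restrict (measurable_funTS (@measurable_radial_dy R k))
    (@radial_dy_ge0 R k).
  apply: etrans (@fubini_tonelli1 _ _ _ _ _ mu mu _ m0 h0) _.
  by apply: eq_integral => x _; rewrite /fubini_F disc_fiber.
rewrite H -(H 0%N) /disc_area; apply: eq_integral => p _.
by rewrite /radial_dy expr0 !mul0r addr0.
Qed.

(** Comparison with an inscribed and a circumscribed square. *)
Lemma disc_area_bounds : 1 <= disc_area <= 4%:E.
Proof.
rewrite /disc_area integral_cst//; last exact: measurable_planar_disc.
rewrite mul1e.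
have sq (r : R) : (0 <= r)%R -> mu2 (`[(- r)%R, r]%classic `*` `[(- r)%R, r]%classic)%classic = (4 * r ^+ 2)%:E.
  move=> r0; rewrite product_measure1E//= !lebesgue_measure_itv/= lte_fin.
  case: ifPn => [_|]; first by rewrite -EFinB -EFinM; congr (_%:E); ring.
  rewrite -leNgt => r1; have -> : r = 0%R by lra.
  by rewrite mul0e expr0n mulr0.
have mR (r : R) : measurable (`[(- r)%R, r]%classic `*` `[(- r)%R, r]%classic)%classic by exact: measurableX.
apply/andP; split.
  have -> : 1 = (4 * (1 / 2) ^+ 2)%R%:E :> \bar R by congr (_%:E); field.
  rewrite -sq//; apply: le_measure; rewrite ?inE; [exact: mR|exact: measurable_planar_disc|].
  move=> [x y] /=; rewrite !in_itv/= => -[hx hy]; apply/planar_discE => /=.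
  have : (x ^+ 2 <= 1 / 4)%R by nra.
  have : (y ^+ 2 <= 1 / 4)%R by nra.
  by lra.
have -> : 4%:E = (4 * 1 ^+ 2)%R%:E :> \bar R by rewrite expr1n mulr1.
rewrite -sq//; apply: le_measure; rewrite ?inE; [exact: measurable_planar_disc|exact: mR|].
move=> [x y] /planar_discE /= h; rewrite !in_itv/=.
by split; apply/andP; split; nra.
Qed.

Definition area_const : R := fine disc_area.

Lemma area_constE : disc_area = area_const%:E.
Proof.
have /andP[h1 h2] := disc_area_bounds; rewrite /area_const fineK//.
by rewrite fin_numE; apply/andP; split; apply/eqP => E; move: h1 h2; rewrite E.
Qed.

Lemma area_const_gt0 : (0 < area_const)%R.
Proof.
by rewrite -lte_fin -area_constE (@lt_le_trans _ _ 1)//; case/andP: disc_area_bounds.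
Qed.

(** Moments of the disc, from the divergence of [|z|^(2n) z]. *)
Lemma disc_moment n :
  \int[mu2]_(p in D) ((p.1 ^+ 2 + p.2 ^+ 2) ^+ n)%:E = (area_const / n.+1%:R)%:E.
Proof.
have mD := @measurable_planar_disc R.
have m1 : measurable_fun D (fun p => (radial_dy n p)%:E).
  by apply/measurable_EFinP; apply: measurable_funTS; exact: measurable_radial_dy.
have m2 : measurable_fun D (fun p : R * R => (radial_dy n (p.2, p.1))%:E).
  apply/measurable_EFinP; apply: measurable_funTS.
  exact: (measurableT_comp (measurable_radial_dy n) (@measurable_flip R)).
have m3 : measurable_fun D (fun p : R * R => ((p.1 ^+ 2 + p.2 ^+ 2) ^+ n)%:E).
  by apply/measurable_EFinP; apply: measurable_funTS; apply: measurable_funX; exact: measurable_sqnorm.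
have r0 p : (0 <= p.1 ^+ 2 + p.2 ^+ 2 :> R)%R by rewrite addr_ge0 ?sqr_ge0.
have Hs : \int[mu2]_(p in D) (radial_dy n (p.2, p.1))%:E = disc_area.
  rewrite -(integral_radial_dy n) integral_mkcond [RHS]integral_mkcond.
  have nm := nonneg_meas_restrict (measurable_funTS (@measurable_radial_dy R n))
    (@radial_dy_ge0 R n).
  rewrite -(integral_swap nm); apply: eq_integral => p _; rewrite !patchE.
  suff -> : (p \in D) = ((p.2, p.1) \in D) by [].
  by apply/idP/idP => /set_mem/planar_discE/= h; apply/mem_set/planar_discE => /=; lra.
have : \int[mu2]_(p in D) ((n.+1%:R * 2)%:E * ((p.1 ^+ 2 + p.2 ^+ 2) ^+ n)%:E) =
    disc_area + disc_area.
  rewrite -{1}(integral_radial_dy n) -Hs -ge0_integralD//; last 2 first.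
  - by move=> p _; rewrite lee_fin radial_dy_ge0.
  - by move=> p _; rewrite lee_fin radial_dy_ge0.
  apply: eq_integral => p _; rewrite -EFinM -EFinD; congr (_%:E).
  rewrite /radial_dy /=; case: n {m1 m2 m3 Hs} => [|n] /=; first by rewrite !expr0; ring.
  rewrite (addrC (p.2 ^+ 2)%R) !exprS -[n.+2%:R]natr1.
  by move: (p.1) (p.2) => x y; ring.
rewrite ge0_integralZl//; last by move=> p _; rewrite lee_fin exprn_ge0.
set I := (X in _ * X = _); rewrite area_constE -EFinD => E.
have n0 : (n.+1%:R * 2 != 0 :> R)%R by rewrite mulf_neq0.
have : ((n.+1%:R * 2)^-1)%:E * ((n.+1%:R * 2)%:E * I) = ((n.+1%:R * 2)^-1 * (area_const + area_const))%:E.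
  by rewrite E -EFinM.
rewrite muleA -EFinM mulVf// mul1e => HI; transitivity I; first by [].
rewrite HI; congr (_%:E); field.
by rewrite addrC natr1.
Qed.

End DiscArea.

(** * Parseval's identity on the disc *)

Section PlaneSigmaFinite.
Variable R : realType.
Local Notation mu := (@lebesgue_measure R).
(** A name for the product measure, to which an instance can be attached. *)
Definition plane_measure : set (measurableTypeR R * measurableTypeR R)%type -> \bar R := product_measure1 mu mu.
HB.instance Definition _ := Measure.on plane_measure.
Let sf : sigma_finite setT plane_measure.
Proof.
have /sigma_finiteP[F [TF ndF Foo]] := sigma_finiteT mu.
exists (fun n => F n `*` F n).
  apply/seteqP; split => [[x y] _|//].
  have [n _ Fn] : (\bigcup_i F i) x by rewrite -TF.
  have [m _ Fm] : (\bigcup_i F i) y by rewrite -TF.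
  exists (maxn n m) => //; split.
    by move: x Fn; exact/subsetPset/ndF/leq_maxl.
  by move: y Fm; exact/subsetPset/ndF/leq_maxr.
move=> k; have [? ?] := Foo k; split; first exact: measurableX.
by rewrite /plane_measure product_measure1E// lte_mul_pinfty// ge0_fin_numE.
Qed.
HB.instance Definition _ := @Measure_isSigmaFinite.Build _ _ _ plane_measure sf.
End PlaneSigmaFinite.

Section DiscParseval.
Variable R : realType.
Implicit Types (t : R) (p : R * R) (c : nat -> R[i]) (g : R[i] -> R[i]).
Local Notation mu := (@lebesgue_measure R).
Local Notation mu2 := (product_measure1 mu mu).
Local Notation D := (@planar_disc R).

Definition pt p : R[i] := p.1 +i* p.2.

Lemma pconv_abs_bounded c g z : (forall z, disc z -> pconv c z (g z)) -> disc z ->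
  exists M : R, forall N, \sum_(n < N) normc (c n * z ^+ n) <= M.
Proof.
move=> Hg; rewrite discE => z1.
pose r := (normc z + 1) / 2.
have zr : normc z < r by rewrite /r; lra.
have r0 : 0 < r by rewrite (le_lt_trans _ zr).
have [|M M0 HM] := @pconv_term_bounded _ c r%:C (g r%:C).
  by apply: Hg; rewrite discE ncR gtr0_norm// /r; lra.
rewrite ncR gtr0_norm// in HM.
pose q := normc z / r; have q0 : 0 <= q by rewrite divr_ge0// ltW.
have q1 : q < 1 by rewrite ltr_pdivrMr// mul1r.
exists (M / (1 - q)) => N.
rewrite (@le_trans _ _ (\sum_(n < N) M * q ^+ n))//.
  apply: ler_sum => n _; rewrite ncM ncX /q expr_div_n mulrA mulrAC ler_wpM2r ?exprn_ge0//.
  by rewrite ler_pdivlMr ?exprn_gt0.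
rewrite -mulr_sumr ler_wpM2l// -[leRHS]mul1r ler_pdivlMr ?subr_gt0//.
by rewrite mulrC -[1 - q]opprB mulNr -subrX1 opprB gerBl exprn_ge0.
Qed.

Lemma pconv_cvg c z s : pconv c z s ->
  (fun N => normc (psum c z N - s)) @ \oo --> (0 : R).
Proof.
move=> H; apply/cvgrPdist_le => e e0; have [N0 HN] := H e e0.
by exists N0 => // N hN; rewrite sub0r normrN ger0_norm// HN.
Qed.

Lemma measurable_psum c N :
  measurable_fun setT (fun p => complex.Re (psum c (pt p) N)) /\
  measurable_fun setT (fun p => complex.Im (psum c (pt p) N)).
Proof.
pose mc (F : R * R -> R[i]) := measurable_fun setT (fun p => complex.Re (F p)) /\
  measurable_fun setT (fun p => complex.Im (F p)).
have mcst w : mc (fun=> w) by split; exact: measurable_cst.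
have mM F G : mc F -> mc G -> mc (fun p => F p * G p).
  move=> [f1 f2] [g1 g2]; split.
    under eq_fun do rewrite cReM.
    by apply: measurable_funB; exact: measurable_funM.
  under eq_fun do rewrite cImM.
  by apply: measurable_funD; exact: measurable_funM.
have mD F G : mc F -> mc G -> mc (fun p => F p + G p).
  move=> [f1 f2] [g1 g2]; split; [under eq_fun do rewrite cReD|under eq_fun do rewrite cImD];
    exact: measurable_funD.
have mpt : mc pt by split; [exact: measurable_fst|exact: measurable_snd].
have mX n : mc (fun p => pt p ^+ n).
  elim: n => [|n IH]; first exact: mcst.
  by under [X in mc X]eq_fun do rewrite exprS; exact: mM.
suff : mc (fun p => psum c (pt p) N) by [].
elim: N => [|N IH].
  by under [X in mc X]eq_fun do rewrite /psum big_ord0; exact: mcst.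
by under [X in mc X]eq_fun do rewrite psumS; apply: mD => //; exact: mM.
Qed.

Lemma measurable_sq_sum c g : (forall z, disc z -> pconv c z (g z)) ->
  measurable_fun D (fun p => normc (g (pt p)) ^+ 2).
Proof.
move=> Hg; apply: (measurable_fun_cvg (h := fun N p => normc (psum c (pt p) N) ^+ 2)).
  move=> N; have [m1 m2] := measurable_psum c N.
  under eq_fun do rewrite nc_sq.
  by apply: measurable_funTS; apply: measurable_funD; apply: measurable_funX.
move=> p hp; have := pconv_cvg (Hg _ hp) => H.
have SF : (fun N => normc (psum c (pt p) N)) @ \oo --> normc (g (pt p)).
  apply/cvgrPdist_le => e e0; move/cvgrPdist_le : H => /(_ _ e0).
  apply: filterS => N; rewrite sub0r normrN ger0_norm// => h.
  by rewrite (le_trans (nc_lip _ _))// ncBC.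
by rewrite expr2; under eq_fun do rewrite expr2; apply: cvgM; exact: SF.
Qed.

Lemma pt_rot t p : pt (rot (cos t) (sin t) p) = cis t * pt p.
Proof. by apply: cplx_eq; rewrite /pt /rot /cis /= // addrC. Qed.

Lemma rot_disc t p : (rot (cos t) (sin t) p \in D) = (p \in D).
Proof.
have E : disc (pt (rot (cos t) (sin t) p)) <-> disc (pt p).
  by rewrite pt_rot !discE ncM nc_cis mul1r.
by apply/idP/idP => /set_mem h; apply/mem_set; [exact: (E.1 h)|exact: (E.2 h)].
Qed.

Local Open Scope ereal_scope.

Lemma circle_mean_rot c g p : (forall z, disc z -> pconv c z (g z)) -> D p ->
  \int[mu]_(t in `[0%R, (2 * pi)%R]) (normc (g (pt (rot (cos t) (sin t) p))) ^+ 2)%:E =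
  (2 * pi)%:E * \sum_(n <oo) (normc (c n) ^+ 2 * (p.1 ^+ 2 + p.2 ^+ 2) ^+ n)%:E.
Proof.
move=> Hg hp; have [M HM] := pconv_abs_bounded Hg hp.
have := @parseval R (fun n => c n * pt p ^+ n)%R (fun t => g (cis t * pt p)%R) M HM.
have E : (fun N => (2 * pi * \sum_(n < N) normc (c n * pt p ^+ n) ^+ 2)%:E) =
    (fun N => (2 * pi)%:E * \sum_(0 <= n < N) (normc (c n) ^+ 2 * (p.1 ^+ 2 + p.2 ^+ 2) ^+ n)%:E).
  apply/funext => N; rewrite EFinM; congr (_ * _); rewrite sumEFin big_mkord; congr (_%:E).
  apply: eq_bigr => n _; rewrite ncM ncX exprMn; congr (_ * _)%R.
  by rewrite -exprM mulnC exprM nc_sq.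
rewrite E => H.
transitivity (\int[mu]_(t in `[0%R, (2 * pi)%R]) (normc (g (cis t * pt p)%R) ^+ 2)%:E).
  by apply: eq_integral => t _; rewrite pt_rot.
have K t : (fun N => normc (\sum_(n < N) c n * pt p ^+ n * cis t ^+ n - g (cis t * pt p)))%R @ \oo --> (0%R : R).
  have dz : disc (cis t * pt p)%R by rewrite discE ncM nc_cis mul1r -discE.
  have E2 N : psum c (cis t * pt p)%R N = (\sum_(n < N) c n * pt p ^+ n * cis t ^+ n)%R.
    by apply: eq_bigr => n _; rewrite exprMn [(cis t ^+ n * _)%R]mulrC mulrA.
  by have := pconv_cvg (Hg _ dz); under eq_fun do rewrite E2; exact: id.
have L : (fun N => (2 * pi)%:E * \sum_(0 <= n < N) (normc (c n) ^+ 2 * (p.1 ^+ 2 + p.2 ^+ 2) ^+ n)%:E) @ \oo -->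
    (2 * pi)%:E * \sum_(n <oo) (normc (c n) ^+ 2 * (p.1 ^+ 2 + p.2 ^+ 2) ^+ n)%:E.
  apply: cvgeZl => //; apply: is_cvg_nneseries => n _ _.
  by rewrite lee_fin mulr_ge0 ?exprn_ge0// addr_ge0 ?sqr_ge0.
exact: (cvg_unique _ (H K) L).
Qed.

(** Averaging over all rotations of the disc turns the area integral into integrals over
    circles, and only the moments of the disc remain. *)
Lemma disc_parseval c g : (forall z, disc z -> pconv c z (g z)) ->
  \int[mu2]_(p in D) (normc (g (pt p)) ^+ 2)%:E =
  \sum_(n <oo) (normc (c n) ^+ 2 * (area_const R / n.+1%:R))%:E.
Proof.
move=> Hg; have mD := @measurable_planar_disc R.
pose h := (fun p => (normc (g (pt p)) ^+ 2)%:E) \_ D.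
have nh : nonneg_meas h.
  by apply: nonneg_meas_restrict; [exact: measurable_sq_sum Hg|move=> p; exact: sqr_ge0].
have tp : (0 < 2 * pi :> R)%R by rewrite mulr_gt0// pi_gt0.
pose I2 : set R := `[0%R, (2 * pi)%R]%classic.
have mI : measurable I2 by exact: measurable_itv.
have muI : mu I2 = (2 * pi)%:E by rewrite lebesgue_measure_itv/= lte_fin tp sube0.
pose f (q : R * (R * R)) := (\1_I2 q.1)%:E * h (rot (cos q.1) (sin q.1) q.2).
have f0 q : 0 <= f q by rewrite mule_ge0// ?lee_fin//; exact: nh.2.
have mf : measurable_fun setT f.
  apply: emeasurable_funM.
    apply/measurable_EFinP; apply: measurableT_comp; last exact: measurable_fst.
    exact: measurable_indic.
  apply: (measurableT_comp nh.1).
  have mc (u : R -> R) : measurable_fun setT u -> measurable_fun setT (fun q : R * (R * R) => u q.1).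
    by move=> mu'; apply: (measurableT_comp mu'); exact: measurable_fst.
  have m1 : measurable_fun setT (fun q : R * (R * R) => q.2.1).
    by apply: (measurableT_comp measurable_fst); exact: measurable_snd.
  have m2 : measurable_fun setT (fun q : R * (R * R) => q.2.2).
    by apply: (measurableT_comp measurable_snd); exact: measurable_snd.
  have cm : measurable_fun setT (@cos R) by apply: continuous_measurable_fun; exact: continuous_cos.
  have sm : measurable_fun setT (@sin R) by apply: continuous_measurable_fun; exact: continuous_sin.
  apply: measurable_fun_pair.
    by apply: measurable_funB; apply: measurable_funM => //; exact: mc.
  by apply: measurable_funD; apply: measurable_funM => //; exact: mc.
have := @fubini_tonelli _ _ _ _ _ mu (@plane_measure R) f mf f0.
rewrite [LHS](_ : _ = (2 * pi)%:E * \int[mu2]_p h p); last first.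
  transitivity (\int[mu]_t ((\1_I2 t)%:E * \int[mu2]_p h p)).
    apply: eq_integral => t _; rewrite /f /= ge0_integralZl//; last 2 first.
    - exact: (measurableT_comp nh.1 (measurable_rot _ _)).
    - by move=> p _; exact: nh.2.
    by congr (_ * _); apply: integral_rot => //; exact: cos2Dsin2.
  rewrite ge0_integralZr//; try by [apply/measurable_EFinP; exact: measurable_indic
    |move=> t _; rewrite lee_fin|apply: integral_ge0 => p _; exact: nh.2].
  by rewrite integral_indic//; congr (_ * _); rewrite setIT; exact: muI.
rewrite [RHS](_ : _ = (2 * pi)%:E * \sum_(n <oo) (normc (c n) ^+ 2 * (area_const R / n.+1%:R))%:E).
  move=> E; rewrite integral_mkcond -/h.
  have : ((2 * pi)^-1)%:E * ((2 * pi)%:E * \int[mu2]_p h p) = ((2 * pi)^-1)%:E *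
    ((2 * pi)%:E * \sum_(n <oo) (normc (c n) ^+ 2 * (area_const R / n.+1%:R))%:E) by rewrite E.
  by rewrite !muleA -!EFinM mulVf ?gt_eqF// !mul1e.
transitivity (\int[mu2]_(p in D) ((2 * pi)%:E *
    \sum_(n <oo) (normc (c n) ^+ 2 * (p.1 ^+ 2 + p.2 ^+ 2) ^+ n)%:E)).
  rewrite [RHS]integral_mkcond; apply: eq_integral => p _; rewrite patchE.
  case: ifPn => hp.
    rewrite -(circle_mean_rot Hg (set_mem hp)) [RHS]integral_mkcond.
    apply: eq_integral => t _; rewrite /f /= /h patchE rot_disc hp patchE indicE.
    by case: (t \in I2); rewrite ?mul1e ?mul0e.
  rewrite integral0_eq// => t _; rewrite /f /= /h patchE rot_disc (negbTE hp).
  by rewrite mule0.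
have m3 n : measurable_fun D (fun p : R * R => (normc (c n) ^+ 2 * (p.1 ^+ 2 + p.2 ^+ 2) ^+ n)%:E).
  apply/measurable_EFinP; apply: measurable_funTS; apply: measurable_funM => //.
  by apply: measurable_funX; exact: measurable_sqnorm.
have p3 n p : 0 <= (normc (c n) ^+ 2 * (p.1 ^+ 2 + p.2 ^+ 2) ^+ n)%:E.
  by rewrite lee_fin mulr_ge0 ?exprn_ge0// addr_ge0 ?sqr_ge0.
rewrite ge0_integralZl//; try by [exact: (ge0_emeasurable_sum (P := xpredT) (fun n p _ _ => p3 n p) (fun n _ => m3 n))
  |move=> p _; apply: nneseries_ge0 => n _ _; exact: p3|rewrite lee_fin ltW].
congr (_ * _); rewrite integral_nneseries//.
apply: eq_eseriesr => n _; under eq_integral do rewrite EFinM.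
rewrite ge0_integralZl//; try by [apply/measurable_EFinP; apply: measurable_funTS;
    apply: measurable_funX; exact: measurable_sqnorm
  |move=> p _; rewrite lee_fin exprn_ge0// addr_ge0 ?sqr_ge0|rewrite lee_fin sqr_ge0].
by rewrite disc_moment -EFinM.
Qed.

End DiscParseval.

(** * The Dirichlet norm in Taylor coefficients *)

Section DirichletCoefficients.
Variable R : realType.
Implicit Types (f g : R[i] -> R[i]) (z : R[i]).

Section NonnegativeSums.
Variable x : nat -> R.
Hypothesis x0 : forall n, 0 <= x n.

Lemma nneg_partial_mono m n : (m <= n)%N -> \sum_(i < m) x i <= \sum_(i < n) x i.
Proof.
move/subnK => <-; elim: (n - m)%N => // k IH.
by rewrite addSn big_ord_recr/= (le_trans IH)// lerDl.
Qed.

Lemma nneg_series_sup (M : R) : (forall N, \sum_(i < N) x i <= M) ->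
  (\sum_(n <oo) (x n)%:E = (sup (range (fun N => \sum_(i < N) x i)))%:E)%E.
Proof.
move=> HM; apply/cvg_lim => //.
rewrite (_ : (fun n => _) = EFin \o (fun N => \sum_(i < N) x i)); last first.
  by apply/funext => N /=; rewrite sumEFin big_mkord.
apply: cvg_EFin; first by apply: nearW.
apply: nondecreasing_cvgn; first by move=> m n; exact: nneg_partial_mono.
by exists M => _ [N _ <-]; exact: HM.
Qed.

Lemma nneg_series_bounded : (\sum_(n <oo) (x n)%:E < +oo)%E ->
  exists M, forall N, \sum_(i < N) x i <= M.
Proof.
move=> fin; exists (fine (\sum_(n <oo) (x n)%:E)%E) => N.
have g0 : (0 <= \sum_(n <oo) (x n)%:E)%E by apply: nneseries_ge0 => n _ _; rewrite lee_fin.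
rewrite -lee_fin fineK ?ge0_fin_numE// -(big_mkord xpredT x) -sumEFin.
by apply: nneseries_lim_ge => n _ _; rewrite lee_fin.
Qed.

End NonnegativeSums.

(** Partial sums of the squared Hardy norm and of the Dirichlet integral. *)
Definition hsum f N : R := \sum_(n < N) normc (tc f n) ^+ 2.
Definition dsum f N : R := \sum_(n < N) n%:R * normc (tc f n) ^+ 2.

Definition dbounded f := exists M : R, forall N, dsum f N <= M.
Definition dtotal f : R := sup (range (dsum f)).

Lemma dterm_ge0 f n : 0 <= n%:R * normc (tc f n) ^+ 2.
Proof. by rewrite mulr_ge0// sqr_ge0. Qed.

Lemma dsum_mono f m n : (m <= n)%N -> dsum f m <= dsum f n.
Proof. exact: (@nneg_partial_mono _ (dterm_ge0 f)). Qed.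

Lemma hsum_mono f m n : (m <= n)%N -> hsum f m <= hsum f n.
Proof. exact: (@nneg_partial_mono (fun n => normc (tc f n) ^+ 2) (fun n => sqr_ge0 _)). Qed.

Lemma dsum_ge0 f N : 0 <= dsum f N.
Proof. by rewrite sumr_ge0// => n _; exact: dterm_ge0. Qed.

Lemma hsum_ge0 f N : 0 <= hsum f N.
Proof. by rewrite sumr_ge0// => n _; exact: sqr_ge0. Qed.

Lemma dsum_le_total f N : dbounded f -> dsum f N <= dtotal f.
Proof.
move=> [M HM]; apply: ub_le_sup; last by exists N.
by exists M => _ [k _ <-]; exact: HM.
Qed.

Lemma dtotal_le f (M : R) : (forall N, dsum f N <= M) -> dtotal f <= M.
Proof.
move=> HM; apply: ge_sup; first by exists (dsum f 0), 0%N.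
by move=> _ [N _ <-]; exact: HM.
Qed.

Lemma dtotal_ge0 f : dbounded f -> 0 <= dtotal f.
Proof. by move=> hf; rewrite (le_trans _ (dsum_le_total 0 hf))// dsum_ge0. Qed.

(** The mass of the disc for the normalized area measure. Its positivity is what makes the
    two descriptions of the norm equivalent. *)
Definition kappa : R := area_const R / pi.

Lemma kappa_gt0 : 0 < kappa.
Proof. by rewrite divr_gt0 ?area_const_gt0 ?pi_gt0. Qed.

Lemma dirichlet_series f : hol f -> (area_integral
    (fun z => (normc (derive1 (f : R[i]^o -> R[i]^o) z) ^+ 2)%:E) =
  kappa%:E * \sum_(n <oo) (n.+1%:R * normc (tc f n.+1) ^+ 2)%:E)%E.
Proof.
move=> hf; rewrite /area_integral.
have Hd z : disc z -> pconv (dcoef (tc f)) z (derive1 (f : R[i]^o -> R[i]^o) z).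
  exact: tc_derive1.
have := disc_parseval Hd => E.
transitivity ((pi^-1)%:E * (\sum_(n <oo) (area_const R)%:E * (n.+1%:R * normc (tc f n.+1) ^+ 2)%:E))%E.
  congr (_ * _)%E; apply: etrans E _; apply: eq_eseriesr => n _.
  rewrite -EFinM /dcoef ncM; congr (_%:E).
  rewrite (_ : (n.+1%:R : R[i]) = n.+1%:R%:C); last by rewrite rmorph_nat.
  rewrite ncR ger0_norm// exprMn; field.
  by rewrite addrC natr1.
rewrite nneseriesZl//; last by move=> n _; rewrite lee_fin dterm_ge0.
by rewrite muleA -EFinM mulrC.
Qed.

Lemma dsumS f N : dsum f N.+1 = \sum_(n < N) n.+1%:R * normc (tc f n.+1) ^+ 2.
Proof. by rewrite /dsum big_ord_recl/= mul0r add0r. Qed.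

(** By Parseval the area integral of [|f'|^2] is [kappa] times the sum of
    [n |tc f n|^2]. *)
Lemma dirichletP f : dirichlet f <-> hol f /\ dbounded f.
Proof.
split=> [[/holP hf fin]|[hf [M HM]]].
  split => //; rewrite /dirichlet_sqnorm dirichlet_series// in fin.
  have [|M HM] := @nneg_series_bounded (fun n => n.+1%:R * normc (tc f n.+1) ^+ 2)
    (fun n => dterm_ge0 f n.+1).
    rewrite ltey; apply/eqP => E; move: fin; rewrite E gt0_muley ?lte_fin ?kappa_gt0//.
  by exists M => N; rewrite (le_trans (dsum_mono f (leqnSn N)))// dsumS HM.
split; first exact/holP.
rewrite /dirichlet_sqnorm dirichlet_series// (@nneg_series_sup _ _ M); first last.
- by move=> N; rewrite -dsumS HM.
- by move=> n; exact: dterm_ge0.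
by rewrite -EFinM -EFinD ltry.
Qed.

Lemma dirichlet_hol f : dirichlet f -> hol f.
Proof. by move/dirichletP => []. Qed.

Lemma dirichlet_dbounded f : dirichlet f -> dbounded f.
Proof. by move/dirichletP => []. Qed.

(** The squared norm of the Dirichlet space, by [dirichlet_normE]. *)
Definition dsq f : R := normc (tc f 0) ^+ 2 + kappa * dtotal f.

Lemma dsq_ge0 f : dirichlet f -> 0 <= dsq f.
Proof.
move=> /dirichlet_dbounded hf.
by rewrite addr_ge0 ?sqr_ge0// mulr_ge0 ?dtotal_ge0// ltW// kappa_gt0.
Qed.

Lemma dirichlet_normE f : dirichlet f -> dirichlet_norm f = Num.sqrt (dsq f).
Proof.
move=> /dirichletP[hf [M HM]]; congr Num.sqrt.
rewrite /dirichlet_sqnorm dirichlet_series// (@nneg_series_sup _ _ M); first last.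
- by move=> N; rewrite -dsumS HM.
- by move=> n; exact: dterm_ge0.
rewrite -EFinM -EFinD /= tc_at0//; congr (_ + _ * _).
apply/eqP; rewrite eq_le; apply/andP; split.
  apply: ge_sup; first by eexists; exists 0%N.
  by move=> _ [N _ <-]; rewrite -dsumS dsum_le_total//; exists M.
apply: dtotal_le => N; rewrite (le_trans (dsum_mono f (leqnSn N)))// dsumS.
apply: ub_le_sup; last by exists N.
by exists M => _ [k _ <-]; rewrite -dsumS HM.
Qed.

End DirichletCoefficients.

(** * Coefficient rules and Blaschke factors *)

Section CoefficientRules.
Variable R : realType.
Implicit Types (f g q : R[i] -> R[i]) (z w a : R[i]) (u v : nat -> R[i]).

Lemma pconvD u v z s s' : pconv u z s -> pconv v z s' ->
  pconv (fun n => u n + v n) z (s + s').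
Proof.
move=> h1 h2 e e0; have e2 : 0 < e / 2 by lra.
have [N1 H1] := h1 _ e2; have [N2 H2] := h2 _ e2.
exists (maxn N1 N2) => N; rewrite geq_max => /andP[n1 n2].
have := H1 N n1; have := H2 N n2 => k2 k1.
rewrite (_ : _ - _ = (psum u z N - s) + (psum v z N - s')).
  by rewrite (le_trans (ncD _ _))//; lra.
rewrite /psum; under eq_bigr do rewrite mulrDl; rewrite big_split/=; ring.
Qed.

Lemma pconvZ u z s (c : R[i]) : pconv u z s -> pconv (fun n => c * u n) z (c * s).
Proof.
move=> h e e0; have c0 : 0 < 1 + normc c by rewrite ltr_pwDl.
have e1 : 0 < e / (1 + normc c) by rewrite divr_gt0.
have [N0 HN] := h _ e1; exists N0 => N hN.
rewrite (_ : _ - _ = c * (psum u z N - s)).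
  rewrite ncM (@le_trans _ _ ((1 + normc c) * normc (psum u z N - s)))//.
    by rewrite ler_wpM2r// lerDr.
  by rewrite mulrC -ler_pdivlMr// HN.
by rewrite /psum mulrBr mulr_sumr; congr (_ - _); apply: eq_bigr => n _; rewrite mulrA.
Qed.

Definition shiftr u n : R[i] := if n is m.+1 then u m else 0.

Lemma psum_shiftr u z N : psum (shiftr u) z N.+1 = z * psum u z N.
Proof.
rewrite /psum big_ord_recl/= mul0r add0r mulr_sumr; apply: eq_bigr => n _.
by rewrite /bump/= add1n exprS mulrCA.
Qed.

Lemma pconv_shiftr u z s : pconv u z s -> pconv (shiftr u) z (z * s).
Proof.
move=> h e e0; have c0 : 0 < 1 + normc z by rewrite ltr_pwDl.
have e1 : 0 < e / (1 + normc z) by rewrite divr_gt0.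
have [N0 HN] := h _ e1; exists N0.+1 => -[//|N] hN.
rewrite psum_shiftr -mulrBr ncM (@le_trans _ _ ((1 + normc z) * normc (psum u z N - s)))//.
  by rewrite ler_wpM2r// lerDr.
by rewrite mulrC -ler_pdivlMr// HN.
Qed.

Lemma tcD f g : hol f -> hol g -> tc (fun z => f z + g z) = (fun n => tc f n + tc g n).
Proof. by move=> hf hg; apply: tc_unique => z hz; apply: pconvD; exact: tcP. Qed.

Lemma tcZ c f : hol f -> tc (fun z => c * f z) = (fun n => c * tc f n).
Proof. by move=> hf; apply: tc_unique => z hz; apply: pconvZ; exact: tcP. Qed.

Lemma tcB f g : hol f -> hol g -> tc (fun z => f z - g z) = (fun n => tc f n - tc g n).
Proof. by move=> hf hg; apply: tc_unique => z hz; apply: pconvB; exact: tcP. Qed.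

Lemma tc_mulz f : hol f -> tc (fun z => z * f z) = shiftr (tc f).
Proof. by move=> hf; apply: tc_unique => z hz; apply: pconv_shiftr; exact: tcP. Qed.

Lemma tc_cst (c : R[i]) : tc (fun=> c) = (fun n => if n is 0%N then c else 0).
Proof.
apply: tc_unique => z _ e e0; exists 1%N => -[//|N] _.
rewrite /psum big_ord_recl/= expr0 mulr1 big1 ?addr0 ?subrr ?normc0 ?ltW// => i _.
by rewrite mul0r.
Qed.

Lemma tc_den a q : hol q ->
  tc (fun z => (1 - a^* * z) * q z) = (fun n => tc q n - a^* * shiftr (tc q) n).
Proof.
move=> hq; have hz : hol (fun z => z * q z) by apply: holM => //; exact: hol_id.
transitivity (tc (fun z => q z - a^* * (z * q z))).
  by congr tc; apply/funext => z; rewrite mulrBl mul1r mulrA.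
by rewrite tcB ?tcZ ?tc_mulz//; exact: holZ.
Qed.

Lemma tc_num a q : hol q ->
  tc (fun z => (z - a) * q z) = (fun n => shiftr (tc q) n - a * tc q n).
Proof.
move=> hq; have hz : hol (fun z => z * q z) by apply: holM => //; exact: hol_id.
transitivity (tc (fun z => z * q z - a * q z)).
  by congr tc; apply/funext => z; rewrite mulrBl.
by rewrite tcB ?tcZ ?tc_mulz//; exact: holZ.
Qed.

End CoefficientRules.

Section Moebius.
Variable R : realType.
Implicit Types (f g q : R[i] -> R[i]) (z w a : R[i]).

Definition mob a z : R[i] := (z - a) / (1 - a^* * z).

(** The source of every energy balance: applied to consecutive coefficients it telescopes,
    and for [y = 1] it is the classical formula for [1 - |mob a x|^2]. *)
Lemma moebius_identity (a x y : R[i]) :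
  normc (x - a * y) ^+ 2 - normc (y - a^* * x) ^+ 2 =
  (1 - normc a ^+ 2) * (normc x ^+ 2 - normc y ^+ 2).
Proof. by case: a x y => [a1 a2] [x1 x2] [y1 y2]; rewrite !nc_sq /=; ring. Qed.

Lemma disc_gap a : disc a -> 0 < 1 - normc a ^+ 2.
Proof. by rewrite discE => h; have := normc_ge0 a; nra. Qed.

Lemma den_neq0 a z : disc a -> disc z -> 1 - a^* * z != 0.
Proof.
rewrite !discE => ha hz; apply/eqP => E.
have : normc (a^* * z) = 1 by rewrite -(normc1 R); congr normc; apply/esym/eqP; rewrite -subr_eq0 E.
by rewrite ncM ncJ; have := normc_ge0 a; have := normc_ge0 z; nra.
Qed.

Lemma mob_defect a z : disc a -> disc z ->
  1 - normc (mob a z) ^+ 2 =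
  (1 - normc a ^+ 2) * (1 - normc z ^+ 2) / normc (1 - a^* * z) ^+ 2.
Proof.
move=> ha hz; have d0 : normc (1 - a^* * z) ^+ 2 != 0.
  by rewrite expf_neq0// nc_eq0 den_neq0.
have := moebius_identity a z 1; rewrite mulr1 normc1 expr1n => E.
rewrite /mob ncM ncV expr_div_n; apply: (mulIf d0); rewrite divfK//.
by rewrite mulrBl divfK// mul1r; move: E; lra.
Qed.

Lemma mob_disc a z : disc a -> disc z -> disc (mob a z).
Proof.
move=> ha hz; have d0 : 0 < normc (1 - a^* * z) ^+ 2 by rewrite exprn_gt0// nc_gt0 den_neq0.
have : 0 < 1 - normc (mob a z) ^+ 2.
  by rewrite mob_defect// divr_gt0// mulr_gt0// disc_gap.
by rewrite discE => h; have := normc_ge0 (mob a z); nra.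
Qed.

Lemma disc_opp a : disc a -> disc (- a).
Proof. by rewrite !discE ncN. Qed.

Lemma mobK a z : disc a -> disc z -> mob (- a) (mob a z) = z.
Proof.
move=> ha hz; have d1 := den_neq0 ha hz; have d2 := den_neq0 ha ha.
have : 1 - (- a)^* * mob a z != 0 by apply: den_neq0; [exact: disc_opp|exact: mob_disc].
rewrite /mob rmorphN/= mulNr !opprK => d3.
have E : 1 + a^* * ((z - a) / (1 - a^* * z)) = (1 - a^* * a) / (1 - a^* * z).
  by apply: (mulIf d1); rewrite mulrDl mulrA !divfK//; ring.
rewrite E; apply: (mulIf (_ : (1 - a^* * a) / (1 - a^* * z) != 0)).
  by rewrite mulf_neq0// invr_neq0.
rewrite divfK; last by rewrite mulf_neq0// invr_neq0.
by apply: (mulIf d1); rewrite mulrDl mulrA !divfK//; ring.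
Qed.

Lemma mob_opp0 a : mob (- a) 0 = a.
Proof. by rewrite /mob mulr0 subr0 invr1 mulr1 sub0r opprK. Qed.

Lemma hol_den_inv a : disc a -> hol (fun z => (1 - a^* * z)^-1).
Proof.
move=> ha; apply: hol_inv; last by move=> z hz; exact: den_neq0.
by apply: holB; [exact: hol_cst|apply: holZ; exact: hol_id].
Qed.

Lemma hol_sub a : hol (fun z => z - a).
Proof. by apply: holB; [exact: hol_id|exact: hol_cst]. Qed.

Lemma hol_mob a : disc a -> hol (mob a).
Proof. by move=> ha; apply: holM; [exact: hol_sub|exact: hol_den_inv]. Qed.

Lemma divide_at0 g : hol g -> exists2 h, hol h & forall z, disc z -> g z = g 0 + z * h z.
Proof.
move=> hg; pose h z := if z == 0 then tc g 1 else (g z - g 0) / z.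
have gh z : disc z -> g z = g 0 + z * h z.
  move=> hz; rewrite /h; case: eqP => [->|/eqP z0]; first by rewrite mul0r addr0.
  by rewrite mulrCA mulfV// mulr1 addrC subrK.
exists h => //; apply: (@pconv_hol _ (fun n => tc g n.+1)) => z hz.
have psE N : psum (tc g) z N.+1 = g 0 + z * psum (fun n => tc g n.+1) z N.
  rewrite /psum big_ord_recl/= expr0 mulr1 -tc_at0// mulr_sumr; congr (_ + _).
  by apply: eq_bigr => n _; rewrite /bump/= add1n exprS; ring.
have [z0|z0] := eqVneq z 0.
  rewrite z0 /h eqxx => e e0; exists 1%N => -[//|N] _.
  by rewrite psum0 subrr normc0 ltW.
move=> e e0; have e1 : 0 < e * normc z by rewrite mulr_gt0// nc_gt0.
have [N0 HN] := tcP hg hz e1; exists N0 => N hN.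
have := HN N.+1 (leqW hN); rewrite psE (gh z hz).
rewrite (_ : _ - _ = z * (psum (fun n => tc g n.+1) z N - h z)); last by ring.
by rewrite ncM mulrC ler_pM2r// nc_gt0.
Qed.

(** Division by [z - a]: a Moebius change of variable reduces it to the shift. *)
Lemma divide_at a g : disc a -> hol g ->
  exists2 q, hol q & forall z, disc z -> g z = g a + (z - a) * q z.
Proof.
move=> ha hg.
have hG : hol (fun w => g (mob (- a) w)).
  apply: hol_comp => //; first exact/hol_mob/disc_opp.
  by move=> z hz; apply: mob_disc => //; exact: disc_opp.
have [h hh hE] := divide_at0 hG.
exists (fun z => h (mob a z) / (1 - a^* * z)).
  apply: holM; last exact: hol_den_inv.
  apply: hol_comp => //; first exact: hol_mob.
  by move=> z hz; exact: mob_disc.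
move=> z hz; have := hE (mob a z) (mob_disc ha hz).
by rewrite mobK// mob_opp0 => ->; rewrite /mob; congr (_ + _); ring.
Qed.

End Moebius.

Section Telescoping.
Variable R : realType.
Implicit Types (p : nat -> R[i]) (a : R[i]).

(** With [p] listing a value at [a] and then the coefficients of the quotient by [z - a],
    the two sides are the coefficients of a function and of its backward shift. *)
Lemma telescope_hardy a p N :
  \sum_(n < N) normc (p n - a * p n.+1) ^+ 2 + (1 - normc a ^+ 2) * normc (p N) ^+ 2 =
  \sum_(n < N) normc (p n.+1 - a^* * p n) ^+ 2 + (1 - normc a ^+ 2) * normc (p 0%N) ^+ 2.
Proof.
elim: N => [|N IH]; first by rewrite !big_ord0.
by rewrite !big_ord_recr/=; have := moebius_identity a (p N) (p N.+1); lra.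
Qed.

(** Weighted by [n] the same telescoping leaves a sum over all of [p] behind. *)
Lemma telescope_dirichlet a p N :
  \sum_(n < N.+1) n%:R * normc (p n - a * p n.+1) ^+ 2 +
    (1 - normc a ^+ 2) * (N%:R * normc (p N.+1) ^+ 2) =
  \sum_(n < N.+1) n%:R * normc (p n.+1 - a^* * p n) ^+ 2 +
    (1 - normc a ^+ 2) * \sum_(n < N) normc (p n.+1) ^+ 2.
Proof.
elim: N => [|N IH].
  by rewrite !big_ord_recr !big_ord0/= !mul0r !mulr0.
rewrite big_ord_recr [in RHS]big_ord_recr [X in _ = _ + _ * X]big_ord_recr/=.
have := moebius_identity a (p N.+1) (p N.+2) => E.
have := congr1 (fun t => N.+1%:R * t) E; rewrite -natr1; lra.
Qed.

End Telescoping.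

(** * Energy balance of a division *)

Section HardyTotals.
Variable R : realType.
Implicit Types (f g q : R[i] -> R[i]) (z a v : R[i]).

Definition hbounded f := exists M : R, forall N, hsum f N <= M.
Definition htotal f : R := sup (range (hsum f)).

Lemma hsum_le_total f N : hbounded f -> hsum f N <= htotal f.
Proof.
move=> [M HM]; apply: ub_le_sup; last by exists N.
by exists M => _ [k _ <-]; exact: HM.
Qed.

Lemma htotal_le f (M : R) : (forall N, hsum f N <= M) -> htotal f <= M.
Proof.
move=> HM; apply: ge_sup; first by exists (hsum f 0), 0%N.
by move=> _ [N _ <-]; exact: HM.
Qed.

Lemma htotal_ge0 f : hbounded f -> 0 <= htotal f.
Proof. by move=> hf; rewrite (le_trans _ (hsum_le_total 0 hf))// hsum_ge0. Qed.

Lemma hsum_le_dsum f N : hsum f N <= normc (tc f 0) ^+ 2 + dsum f N.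
Proof.
case: N => [|N]; first by rewrite /hsum big_ord0 addr_ge0 ?sqr_ge0 ?dsum_ge0.
rewrite dsumS /hsum big_ord_recl/= lerD2l; apply: ler_sum => n _.
by rewrite /bump/= add1n -[leLHS]mul1r ler_wpM2r ?sqr_ge0// ler1n.
Qed.

Lemma dbounded_hbounded f : dbounded f -> hbounded f.
Proof.
move=> [M HM]; exists (normc (tc f 0) ^+ 2 + M) => N.
by rewrite (le_trans (hsum_le_dsum f N))// lerD2l.
Qed.

Lemma ncD_sq z w : normc (z + w) ^+ 2 <= 2 * normc z ^+ 2 + 2 * normc w ^+ 2.
Proof.
have := lerXn2r 2 (normc_ge0 (z + w)) (addr_ge0 (normc_ge0 z) (normc_ge0 w)) (ncD z w).
by have := sqr_ge0 (normc z - normc w); lra.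
Qed.

Lemma dbounded_small f : dbounded f -> forall e : R, 0 < e ->
  exists N0, forall m, (N0 <= m)%N -> m%:R * normc (tc f m) ^+ 2 <= e.
Proof.
move=> hf e e0; have [N0 HN] : exists N0, dtotal f - e < dsum f N0.
  have [] := @sup_adherent _ (range (dsum f)) e e0.
    by split; [exists (dsum f 0), 0%N|case: hf => M HM; exists M => _ [N _ <-]; exact: HM].
  by move=> _ [N0 _ <-] h; exists N0.
exists N0 => m hm; have := dsum_le_total m.+1 hf; have := dsum_mono f hm.
have -> : dsum f m.+1 = dsum f m + m%:R * normc (tc f m) ^+ 2 by rewrite /dsum big_ord_recr.
by move: HN; lra.
Qed.

End HardyTotals.

Section MoebiusStep.
Variable R : realType.
Implicit Types (f g q : R[i] -> R[i]) (z a v : R[i]).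

(** If [h = h(a) + (z - a) q] then [h = stepU a (h a) q], and [L = stepL a (h a) q] is its
    backward shift at [a]: [h = (1 - |a|^2) h(a) / (1 - a^* z) + mob a L]. For [v = 0] the
    two functions are [mob a L] and [L]. *)
Definition stepU a v q z : R[i] := v + (z - a) * q z.
Definition stepL a v q z : R[i] := (1 - a^* * z) * q z - a^* * v.

Definition seqp v q n : R[i] := if n is m.+1 then tc q m else v.

Lemma hol_num a q : hol q -> hol (fun z => (z - a) * q z).
Proof. by move=> hq; apply: holM => //; exact: hol_sub. Qed.

Lemma hol_den a q : hol q -> hol (fun z => (1 - a^* * z) * q z).
Proof.
move=> hq; apply: holM => //; apply: holB; first exact: hol_cst.
by apply: holZ; exact: hol_id.
Qed.

Lemma hol_stepL a v q : hol q -> hol (stepL a v q).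
Proof. by move=> hq; apply: holB; [exact: hol_den|exact: hol_cst]. Qed.

Lemma tc_stepU a v q n : hol q -> tc (stepU a v q) n = seqp v q n - a * seqp v q n.+1.
Proof.
move=> hq; rewrite /stepU (tcD (hol_cst v) (hol_num a hq)) tc_cst tc_num//.
by case: n => [|n] /=; rewrite ?sub0r ?add0r.
Qed.

Lemma tc_stepL a v q n : hol q -> tc (stepL a v q) n = seqp v q n.+1 - a^* * seqp v q n.
Proof.
move=> hq; rewrite /stepL (tcB (hol_den a hq) (hol_cst _)) tc_cst tc_den//.
by case: n => [|n] /=; rewrite ?mulr0 ?subr0.
Qed.

Lemma hardy_step a v q N : hol q ->
  hsum (stepU a v q) N + (1 - normc a ^+ 2) * normc (seqp v q N) ^+ 2 =
  hsum (stepL a v q) N + (1 - normc a ^+ 2) * normc v ^+ 2.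
Proof.
move=> hq; have := telescope_hardy a (seqp v q) N; rewrite /hsum.
under eq_bigr do rewrite -tc_stepU//.
by under [in RHS]eq_bigr do rewrite -tc_stepL//.
Qed.

(** The shift lowers the Dirichlet integral by [1 - |a|^2] times the Hardy norm of the
    quotient; both directions of the theorem rest on this identity. *)
Lemma dirichlet_step a v q N : hol q ->
  dsum (stepU a v q) N.+1 + (1 - normc a ^+ 2) * (N%:R * normc (tc q N) ^+ 2) =
  dsum (stepL a v q) N.+1 + (1 - normc a ^+ 2) * hsum q N.
Proof.
move=> hq; have := telescope_dirichlet a (seqp v q) N; rewrite /dsum.
under eq_bigr do rewrite -tc_stepU//.
by under [in X in _ = X + _]eq_bigr do rewrite -tc_stepL//.
Qed.

(** Iterating [q_n = h_(n+1) + a q_(n+1)]: the remainder [a^K q_(n+K)] vanishes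
    because the radius of convergence of [q] exceeds [|a|]. *)
Lemma quotient_coef_le a q N (d : R) : disc a -> hol q ->
  (forall m, (N <= m)%N -> normc (tc q m - a * tc q m.+1) <= d) ->
  normc (tc q N) <= d / (1 - normc a).
Proof.
rewrite discE => ha hq H; set t := normc a in ha *.
have t0 : 0 <= t by exact: normc_ge0.
have t1 : 0 < 1 - t by lra.
set D := d / (1 - t); have dD : d = D * (1 - t) by rewrite /D divfK// gt_eqF.
have it K : normc (tc q N) - D <= t ^+ K * (normc (tc q (N + K)) - D).
  elim: K => [|K IH]; first by rewrite addn0 expr0 mul1r.
  rewrite (le_trans IH)// exprSr -mulrA ler_wpM2l ?exprn_ge0//.
  have := H (N + K)%N (leq_addr _ _); have := ncM a (tc q (N + K).+1); rewrite -/t => e1 e2.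
  have := ncD (tc q (N + K) - a * tc q (N + K).+1) (a * tc q (N + K).+1).
  by rewrite subrK addnS; nra.
pose r := (1 + t) / 2; have r0 : 0 < r by rewrite /r; lra.
have dr : disc (r%:C : R[i]) by rewrite discE ncR ger0_norm /r; lra.
have [M M0 HM] := pconv_term_bounded (tcP hq dr).
have tr : 0 <= t / r < 1.
  by apply/andP; split; [rewrite divr_ge0// ltW|rewrite ltr_pdivrMr// mul1r /r; lra].
apply/ler_addgt0Pr => e e0; have e2 : 0 < e / 2 by lra.
have [K0 HK0] := geo_small (M / r ^+ N) tr e2.
have [K1 HK1] := geo_small `|D| (ltac:(apply/andP; split; lra) : 0 <= t < 1) e2.
pose K := maxn K0 K1; have := HK0 K (leq_maxl _ _); have := HK1 K (leq_maxr _ _).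
have q1 : t ^+ K * normc (tc q (N + K)) <= M / r ^+ N * (t / r) ^+ K.
  have := HM (N + K)%N; rewrite ncR ger0_norm; last by lra.
  rewrite exprD [(t / r) ^+ K]expr_div_n => h.
  have -> : M / r ^+ N * (t ^+ K / r ^+ K) = t ^+ K * (M / (r ^+ N * r ^+ K)).
    by rewrite invfM; ring.
  by rewrite ler_wpM2l ?exprn_ge0// ler_pdivlMr// mulr_gt0 ?exprn_gt0.
have := it K; rewrite mulrBr.
have : - (t ^+ K * D) <= `|D| * t ^+ K.
  by rewrite -mulrN mulrC ler_wpM2r ?exprn_ge0// -normrN ler_norm.
by move: q1; lra.
Qed.

(** Hence the boundary terms of both identities are negligible for Dirichlet data. *)
Lemma quotient_negligible a v q : disc a -> hol q -> dbounded (stepU a v q) ->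
  forall e : R, 0 < e -> exists N0, forall N, (N0 <= N)%N -> N%:R * normc (tc q N) ^+ 2 <= e.
Proof.
move=> ha hq hU e e0; have t1 : 0 < 1 - normc a by move: ha; rewrite discE; lra.
have e1 : 0 < e * (1 - normc a) ^+ 2 by rewrite mulr_gt0// exprn_gt0.
have [N0 HN] := dbounded_small hU e1; exists N0.+1 => N hN.
have Npos : 0 < N%:R :> R by rewrite ltr0n (leq_ltn_trans _ hN).
have s0 : 0 <= e * (1 - normc a) ^+ 2 / N%:R by apply: divr_ge0; exact: ltW.
have Hm m : (N <= m)%N ->
    normc (tc q m - a * tc q m.+1) <= Num.sqrt (e * (1 - normc a) ^+ 2 / N%:R).
  move=> hm; have := HN m.+1 (leq_trans (ltnW hN) (leqW hm)).
  rewrite tc_stepU//= => h.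
  rewrite -(@ler_pXn2r _ 2)// ?nnegrE ?sqrtr_ge0// sqr_sqrtr//.
  rewrite ler_pdivlMr// mulrC (le_trans _ h)// ler_wpM2r ?sqr_ge0// ler_nat.
  exact: leqW.
have := quotient_coef_le ha hq Hm.
move=> h; have := lerXn2r 2 (normc_ge0 _) (divr_ge0 (sqrtr_ge0 _) (ltW t1)) h; move: h => _.
rewrite expr_div_n sqr_sqrtr// => h.
rewrite mulrC -ler_pdivlMr// (le_trans h)// le_eqVlt; apply/orP; left; apply/eqP.
by field; rewrite gt_eqF//= gt_eqF.
Qed.

Lemma step_hardy_le a v q : disc a -> hol q -> dbounded (stepU a v q) -> forall N,
  hsum (stepL a v q) N + (1 - normc a ^+ 2) * normc v ^+ 2 <= htotal (stepU a v q).
Proof.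
move=> ha hq hU N; have g := disc_gap ha; apply/ler_addgt0Pr => e e0.
have [N0 HN] := quotient_negligible ha hq hU e0.
pose m := maxn (maxn N N0) 1; have mN0 : (N0 <= m)%N by rewrite !leq_max leqnn orbT.
have mN : (N <= m.+1)%N by rewrite ltnW// ltnS !leq_max leqnn.
have m1 : 1 <= m%:R :> R by rewrite ler1n leq_max orbT.
have := HN m mN0; have := hardy_step a v m.+1 hq => /=.
have := hsum_mono (stepL a v q) mN.
have := hsum_le_total m.+1 (dbounded_hbounded hU).
have := sqr_ge0 (normc (tc q m)); have := sqr_ge0 (normc a).
move: g m1; set A := normc a ^+ 2; set Q := normc (tc q m) ^+ 2.
move=> g m1 A0 Q0 k1 k2 E k3.
have : (1 - A) * Q <= e.
  rewrite (le_trans _ k3)// (@le_trans _ _ (1 * Q))// ler_wpM2r//; lra.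
by move: k1 k2 E; lra.
Qed.

Lemma step_dirichlet_le a v q : disc a -> hol q -> dbounded (stepU a v q) -> forall N M,
  dsum (stepL a v q) N + (1 - normc a ^+ 2) * hsum q M <= dtotal (stepU a v q).
Proof.
move=> ha hq hU N M; have g := disc_gap ha; apply/ler_addgt0Pr => e e0.
have [N0 HN] := quotient_negligible ha hq hU e0.
pose m := maxn (maxn N N0) M; have mN0 : (N0 <= m)%N by rewrite !leq_max leqnn orbT.
have mN : (N <= m.+1)%N by rewrite ltnW// ltnS !leq_max leqnn.
have mM : (M <= m)%N by rewrite leq_max leqnn orbT.
have := HN m mN0; have := dirichlet_step a v m hq.
have := dsum_mono (stepL a v q) mN; have := hsum_mono q mM.
have := dsum_le_total m.+1 hU.
have := dterm_ge0 q m; have := sqr_ge0 (normc a).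
move: g; set A := normc a ^+ 2; set Q := _ * normc (tc q m) ^+ 2.
move=> g A0 Q0 k1 k2 k4 E k3.
have : (1 - A) * Q <= e by rewrite (le_trans _ k3)// -[leRHS]mul1r ler_wpM2r//; lra.
have : (1 - A) * hsum q M <= (1 - A) * hsum q m by rewrite ler_wpM2l// ltW.
by move: k1 k4 E; lra.
Qed.

Lemma step_bounded a v q : disc a -> hol q -> dbounded (stepU a v q) ->
  dbounded (stepL a v q) /\ hbounded q.
Proof.
move=> ha hq hU; have g := disc_gap ha; split.
  exists (dtotal (stepU a v q)) => N; have := step_dirichlet_le ha hq hU N 0.
  by rewrite /hsum big_ord0 mulr0 addr0.
exists (dtotal (stepU a v q) / (1 - normc a ^+ 2)) => N.
have := step_dirichlet_le ha hq hU 0 N; rewrite /dsum big_ord0 add0r.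
by rewrite ler_pdivlMr// mulrC.
Qed.

Lemma step_htotal a v q : disc a -> hol q -> dbounded (stepU a v q) ->
  htotal (stepL a v q) + (1 - normc a ^+ 2) * normc v ^+ 2 <= htotal (stepU a v q).
Proof.
move=> ha hq hU; rewrite -lerBrDr; apply: htotal_le => N.
by rewrite lerBrDr step_hardy_le.
Qed.

Lemma step_dtotal a v q : disc a -> hol q -> dbounded (stepU a v q) ->
  dtotal (stepL a v q) + (1 - normc a ^+ 2) * htotal q <= dtotal (stepU a v q).
Proof.
move=> ha hq hU; have g := disc_gap ha.
rewrite addrC -lerBrDr mulrC -ler_pdivlMr//; apply: htotal_le => M.
rewrite ler_pdivlMr// mulrC lerBrDr addrC -lerBrDr; apply: dtotal_le => N.
by rewrite lerBrDr step_dirichlet_le.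
Qed.

Lemma shiftr_sqsum (w : nat -> R) (u : nat -> R[i]) N :
  \sum_(n < N.+1) w n * normc (shiftr u n) ^+ 2 = \sum_(n < N) w n.+1 * normc (u n) ^+ 2.
Proof.
rewrite big_ord_recl (_ : normc (shiftr u ord0) = 0) ?normc0//.
by rewrite expr0n/= mulr0 add0r.
Qed.

Lemma shiftr_hsum q N : \sum_(n < N) normc (shiftr (tc q) n) ^+ 2 <= hsum q N.
Proof.
case: N => [|N]; first by rewrite /hsum !big_ord0.
have := shiftr_sqsum (fun=> 1) (tc q) N; under eq_bigr do rewrite mul1r.
by under [in RHS]eq_bigr do rewrite mul1r; move=> ->; exact/hsum_mono/leqnSn.
Qed.

Lemma den_hsum a q N : disc a -> hol q ->
  hsum (fun z => (1 - a^* * z) * q z) N <= 4 * hsum q N.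
Proof.
rewrite discE => ha hq; have : hsum (fun z => (1 - a^* * z) * q z) N <=
    \sum_(n < N) (2 * normc (tc q n) ^+ 2 + 2 * normc (shiftr (tc q) n) ^+ 2).
  apply: ler_sum => n _; rewrite tc_den// (le_trans (ncD_sq _ _))// lerD2l ncN ncM ncJ.
  rewrite ler_wpM2l// exprMn -[leRHS]mul1r ler_wpM2r ?sqr_ge0//.
  by have := normc_ge0 a; nra.
rewrite big_split/= -!mulr_sumr -/(hsum q N).
by have := shiftr_hsum q N; lra.
Qed.

(** Convexity of the square, for the recursion [q_n = F_n + a^* q_(n-1)] that inverts the
    multiplication by [1 - a^* z]. *)
Lemma convex_sq (x y t : R) : 0 <= t < 1 -> (x + t * y) ^+ 2 <= x ^+ 2 / (1 - t) + t * y ^+ 2.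
Proof.
move=> /andP[t0 t1]; have t2 : 0 < 1 - t by lra.
rewrite -subr_ge0 (_ : _ - _ = t / (1 - t) * (x - (1 - t) * y) ^+ 2).
  by rewrite mulr_ge0 ?sqr_ge0 ?divr_ge0// ltW.
by field; rewrite gt_eqF.
Qed.

Lemma den_coef_le a q n : disc a -> hol q ->
  normc (tc q n) ^+ 2 <= normc (tc (fun z => (1 - a^* * z) * q z) n) ^+ 2 / (1 - normc a)
    + normc a * normc (shiftr (tc q) n) ^+ 2.
Proof.
rewrite discE => ha hq.
apply: le_trans (convex_sq _ _ (_ : 0 <= normc a < 1)); last by rewrite normc_ge0.
rewrite lerXn2r ?nnegrE ?addr_ge0 ?mulr_ge0//.
rewrite tc_den// -{1}(subrK (a^* * shiftr (tc q) n) (tc q n)) (le_trans (ncD _ _))//.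
by rewrite ncM ncJ.
Qed.

Lemma den_inv_hsum a q N : disc a -> hol q ->
  hsum q N <= hsum (fun z => (1 - a^* * z) * q z) N / (1 - normc a) ^+ 2.
Proof.
move=> ha hq; have t1 : 0 < 1 - normc a by move: ha; rewrite discE; lra.
rewrite expr2 invfM mulrA ler_pdivlMr//.
have : hsum q N <= \sum_(n < N) (normc (tc (fun z => (1 - a^* * z) * q z) n) ^+ 2 / (1 - normc a)
    + normc a * normc (shiftr (tc q) n) ^+ 2).
  by apply: ler_sum => n _; exact: den_coef_le.
rewrite big_split/= -mulr_suml -mulr_sumr -/(hsum _ N).
suff : normc a * \sum_(n < N) normc (shiftr (tc q) n) ^+ 2 <= normc a * hsum q N by lra.
by rewrite ler_wpM2l// shiftr_hsum.
Qed.

Lemma den_inv_dsum a q N : disc a -> hol q ->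
  (1 - normc a) * dsum q N <=
    dsum (fun z => (1 - a^* * z) * q z) N / (1 - normc a) + normc a * hsum q N.
Proof.
move=> ha hq; have : dsum q N <= \sum_(n < N)
    (n%:R * normc (tc (fun z => (1 - a^* * z) * q z) n) ^+ 2 / (1 - normc a)
    + normc a * (n%:R * normc (shiftr (tc q) n) ^+ 2)).
  apply: ler_sum => n _; have := den_coef_le n ha hq.
  move/(ler_wpM2l (ler0n R n)) => h; rewrite (le_trans h)// le_eqVlt; apply/orP; left; apply/eqP.
  ring.
rewrite big_split/= -mulr_suml -mulr_sumr -/(dsum _ N).
suff : normc a * \sum_(n < N) (n%:R * normc (shiftr (tc q) n) ^+ 2) <=
    normc a * (hsum q N + dsum q N) by lra.
rewrite ler_wpM2l//; case: N => [|N]; first by rewrite /hsum /dsum !big_ord0 addr0.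
rewrite (shiftr_sqsum (fun n => n%:R)).
rewrite /hsum /dsum -big_split/= big_ord_recr/= -[leLHS]addr0 lerD ?addr_ge0 ?dterm_ge0 ?sqr_ge0//.
rewrite le_eqVlt; apply/orP; left; apply/eqP; apply: eq_bigr => n _; rewrite -natr1; ring.
Qed.

End MoebiusStep.

(** * The Dirichlet space and products of Blaschke factors *)

Arguments normc : simpl never.

Section DirichletClosure.
Variable R : realType.
Implicit Types (f g q : R[i] -> R[i]) (z a c : R[i]).

Lemma hsum_ext f g N : (forall z, disc z -> f z = g z) -> hol f -> hsum g N = hsum f N.
Proof. by move=> fg hf; rewrite /hsum (tc_ext fg hf). Qed.

Lemma dsum_ext f g N : (forall z, disc z -> f z = g z) -> hol f -> dsum g N = dsum f N.
Proof. by move=> fg hf; rewrite /dsum (tc_ext fg hf). Qed.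

Lemma dbounded_ext f g : (forall z, disc z -> f z = g z) -> hol f -> dbounded f -> dbounded g.
Proof. by move=> fg hf [M HM]; exists M => N; rewrite (dsum_ext N fg hf). Qed.

Lemma dtotal_ext f g : (forall z, disc z -> f z = g z) -> hol f -> dtotal g = dtotal f.
Proof. by move=> fg hf; rewrite /dtotal /dsum (tc_ext fg hf). Qed.

Lemma htotal_ext f g : (forall z, disc z -> f z = g z) -> hol f -> htotal g = htotal f.
Proof. by move=> fg hf; rewrite /htotal /hsum (tc_ext fg hf). Qed.

Lemma dirichlet_ext f g : (forall z, disc z -> f z = g z) -> dirichlet f -> dirichlet g.
Proof.
move=> fg /dirichletP[hf bf]; apply/dirichletP; split; first exact: hol_ext hf.
exact: dbounded_ext bf.
Qed.

Lemma dirichletI f : hol f -> dbounded f -> dirichlet f.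
Proof. by move=> hf bf; apply/dirichletP. Qed.

Lemma dirichlet_cst c : dirichlet (fun=> c).
Proof.
apply: dirichletI; first exact: hol_cst.
exists 0 => N; rewrite /dsum big1// => -[[|n] ?] _ /=; rewrite ?mul0r//.
by rewrite tc_cst normc0 expr0n/= mulr0.
Qed.

Lemma dirichletD f g : dirichlet f -> dirichlet g -> dirichlet (fun z => f z + g z).
Proof.
move=> /dirichletP[hf [M HM]] /dirichletP[hg [M' HM']].
apply: dirichletI; first exact: holD.
exists (2 * M + 2 * M') => N; rewrite (@le_trans _ _ (2 * dsum f N + 2 * dsum g N))//.
  rewrite /dsum !mulr_sumr -big_split/=; apply: ler_sum => n _.
  rewrite (tcD hf hg); have := ler_wpM2l (ler0n R n) (ncD_sq (tc f n) (tc g n)); lra.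
by rewrite lerD// ler_wpM2l.
Qed.

Lemma dsumZ c f N : hol f -> dsum (fun z => c * f z) N = normc c ^+ 2 * dsum f N.
Proof.
move=> hf; rewrite /dsum mulr_sumr; apply: eq_bigr => n _.
by rewrite (tcZ c hf) ncM exprMn; ring.
Qed.

Lemma hsumZ c f N : hol f -> hsum (fun z => c * f z) N = normc c ^+ 2 * hsum f N.
Proof.
move=> hf; rewrite /hsum mulr_sumr; apply: eq_bigr => n _.
by rewrite (tcZ c hf) ncM exprMn.
Qed.

Lemma dirichletZ c f : dirichlet f -> dirichlet (fun z => c * f z).
Proof.
move=> /dirichletP[hf [M HM]]; apply: dirichletI; first exact: holZ.
by exists (normc c ^+ 2 * M) => N; rewrite dsumZ// ler_wpM2l ?sqr_ge0.
Qed.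

Lemma dirichletB f g : dirichlet f -> dirichlet g -> dirichlet (fun z => f z - g z).
Proof.
move=> hf hg; apply: dirichlet_ext (dirichletD hf (dirichletZ (-1) hg)) => z _.
by rewrite mulN1r.
Qed.

Lemma dirichlet_sum (I : Type) (r : seq I) (F : I -> R[i] -> R[i]) :
  (forall i, dirichlet (F i)) -> dirichlet (fun z => \sum_(i <- r) F i z).
Proof.
move=> hF; elim: r => [|i r IH].
  by apply: dirichlet_ext (dirichlet_cst 0) => z _; rewrite big_nil.
by apply: dirichlet_ext (dirichletD (hF i) IH) => z _; rewrite big_cons.
Qed.

Lemma dirichlet_id : dirichlet (fun z : R[i] => z).
Proof.
apply: dirichletI; first exact: hol_id.
have E : tc (fun z : R[i] => z) = shiftr (fun n => if n is 0%N then 1 else 0).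
  rewrite -tc_cst -(tc_mulz (hol_cst 1)); congr tc; apply/funext => z; exact/esym/mulr1.
exists 1 => N; rewrite /dsum E; case: N => [|[|N]]; rewrite ?big_ord_recl ?big_ord0 /=.
- by [].
- by rewrite mul0r add0r.
rewrite mul0r add0r big1 ?addr0 => [|n _]; first by rewrite normc1 expr1n mulr1.
by rewrite normc0 expr0n/= mulr0.
Qed.

End DirichletClosure.

Section BlaschkeFactors.
Variable R : realType.
Implicit Types (f g q F : R[i] -> R[i]) (z a c : R[i]).

(** The Szego kernel of the Hardy space at [a]. *)
Definition kern a z : R[i] := (1 - a^* * z)^-1.

Lemma hol_kern_mul a F : disc a -> hol F -> hol (fun z => kern a z * F z).
Proof. by move=> ha hF; apply: holM => //; exact: hol_den_inv. Qed.

Lemma hol_mob_mul a F : disc a -> hol F -> hol (fun z => mob a z * F z).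
Proof. by move=> ha hF; apply: holM => //; exact: hol_mob. Qed.

Lemma kernK a F z : disc a -> disc z -> (1 - a^* * z) * (kern a z * F z) = F z.
Proof. by move=> ha hz; rewrite mulrA /kern mulfV ?mul1r// den_neq0. Qed.

Lemma stepU0 a F z : stepU a 0 (fun z => kern a z * F z) z = mob a z * F z.
Proof. by rewrite /stepU add0r /mob mulrA. Qed.

Lemma stepL0 a F z : disc a -> disc z -> stepL a 0 (fun z => kern a z * F z) z = F z.
Proof. by move=> ha hz; rewrite /stepL mulr0 subr0 kernK. Qed.

Lemma kern_hsum a F N : disc a -> hol F ->
  hsum (fun z => kern a z * F z) N <= hsum F N / (1 - normc a) ^+ 2.
Proof.
move=> ha hF; have hk := hol_kern_mul ha hF.
rewrite (le_trans (den_inv_hsum N ha hk))//.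
rewrite (@hsum_ext _ F)// => z hz; exact/esym/kernK.
Qed.

Lemma dirichlet_kern_mul a F : disc a -> dirichlet F -> dirichlet (fun z => kern a z * F z).
Proof.
move=> ha /dirichletP[hF bF]; have hk := hol_kern_mul ha hF.
have t1 : 0 < 1 - normc a by move: ha; rewrite discE; lra.
apply: dirichletI => //; have [M HM] := dbounded_hbounded bF; have [D HD] := bF.
exists ((D / (1 - normc a) + normc a * (M / (1 - normc a) ^+ 2)) / (1 - normc a)) => N.
rewrite ler_pdivlMr// mulrC (le_trans (den_inv_dsum N ha hk))//.
rewrite (@dsum_ext _ F) => [|z hz|//]; last exact/esym/kernK.
rewrite lerD// ?ler_wpM2r ?invr_ge0 ?(ltW t1)// ler_wpM2l// (le_trans (kern_hsum N ha hF))//.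
by rewrite ler_wpM2r// invr_ge0 sqr_ge0.
Qed.

Lemma mob_hsum a F N : disc a -> hol F -> hsum (fun z => mob a z * F z) N <= hsum F N.
Proof.
move=> ha hF; have hk := hol_kern_mul ha hF; have g := disc_gap ha.
have := hardy_step a 0 N hk; rewrite normc0 expr0n/= mulr0 addr0.
rewrite (@hsum_ext _ (fun z => mob a z * F z) (stepU a 0 _)) => [|z hz|]; first last.
- exact: hol_mob_mul.
- by rewrite stepU0.
rewrite (@hsum_ext _ F (stepL a 0 _)) => [<-|z hz|//]; last by rewrite stepL0.
by rewrite lerDl mulr_ge0 ?sqr_ge0// ltW.
Qed.

(** Multiplication by a Blaschke factor adds at most the squared Hardy norm of
    [kern a * F] to the Dirichlet integral. *)
Lemma mob_dsum a F N : disc a -> hol F ->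
  dsum (fun z => mob a z * F z) N <= dsum F N + hsum F N / (1 - normc a) ^+ 2.
Proof.
move=> ha hF; have hk := hol_kern_mul ha hF; have g := disc_gap ha.
case: N => [|N]; first by rewrite /dsum /hsum !big_ord0 mul0r addr0.
have := dirichlet_step a 0 N hk.
rewrite (@dsum_ext _ (fun z => mob a z * F z) (stepU a 0 _)) => [|z hz|]; first last.
- exact: hol_mob_mul.
- by rewrite stepU0.
rewrite (@dsum_ext _ F (stepL a 0 _)) => [E|z hz|//]; last by rewrite stepL0.
have : (1 - normc a ^+ 2) * hsum (fun z => kern a z * F z) N <= hsum F N.+1 / (1 - normc a) ^+ 2.
  rewrite (@le_trans _ _ (1 * hsum (fun z => kern a z * F z) N))//.
    by rewrite ler_wpM2r ?hsum_ge0//; have := sqr_ge0 (normc a); lra.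
  rewrite mul1r (le_trans (kern_hsum N ha hF))// ler_wpM2r ?hsum_mono//.
  by rewrite invr_ge0 sqr_ge0.
have : 0 <= (1 - normc a ^+ 2) * (N%:R * normc (tc (fun z => kern a z * F z) N) ^+ 2).
  by rewrite mulr_ge0 ?dterm_ge0// ltW.
by move: E; lra.
Qed.

Lemma dirichlet_mob_mul a F : disc a -> dirichlet F -> dirichlet (fun z => mob a z * F z).
Proof.
move=> ha /dirichletP[hF bF]; apply: dirichletI; first exact: hol_mob_mul.
have [M HM] := dbounded_hbounded bF; have [D HD] := bF.
exists (D + M / (1 - normc a) ^+ 2) => N; rewrite (le_trans (mob_dsum N ha hF))// lerD//.
by rewrite ler_wpM2r// invr_ge0 sqr_ge0.
Qed.

Definition blaschke c (s : seq R[i]) z : R[i] := c * \prod_(a <- s) mob a z.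

Definition in_disc (s : seq R[i]) := forall a, a \in s -> disc a.

Lemma in_disc_cons a s : in_disc (a :: s) -> disc a /\ in_disc s.
Proof.
move=> h; split; first by apply: h; rewrite mem_head.
by move=> b bs; apply: h; rewrite in_cons bs orbT.
Qed.

Lemma blaschke_cons c a s z : blaschke c (a :: s) z = mob a z * blaschke c s z.
Proof. by rewrite /blaschke big_cons mulrCA. Qed.

Lemma hol_blaschke c s : in_disc s -> hol (blaschke c s).
Proof.
elim: s => [_|a s IH /in_disc_cons[ha hs]].
  by apply: hol_ext (hol_cst c) => z _; rewrite /blaschke big_nil mulr1.
apply: hol_ext (hol_mob_mul ha (IH hs)) => z _; by rewrite blaschke_cons.
Qed.

Lemma hol_blaschke_mul c s F : in_disc s -> hol F -> hol (fun z => blaschke c s z * F z).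
Proof. by move=> hs hF; apply: holM => //; exact: hol_blaschke. Qed.

Lemma blaschke_hsum c s F N : normc c = 1 -> in_disc s -> hol F ->
  hsum (fun z => blaschke c s z * F z) N <= hsum F N.
Proof.
move=> c1; elim: s => [_ hF|a s IH /in_disc_cons[ha hs] hF].
  rewrite (@hsum_ext _ (fun z => c * F z)) ?hsumZ// ?c1 ?expr1n ?mul1r//.
    by move=> z _; rewrite /blaschke big_nil mulr1.
  exact: holZ.
apply: le_trans (IH hs hF); have h := hol_blaschke_mul c hs hF.
rewrite (@hsum_ext _ (fun z => mob a z * (blaschke c s z * F z))) ?mob_hsum//.
  by move=> z _; rewrite blaschke_cons mulrA.
exact: hol_mob_mul.
Qed.

Lemma blaschke_dsum c s : normc c = 1 -> in_disc s -> exists2 C : R, 0 <= C &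
  forall F N, hol F -> dsum (fun z => blaschke c s z * F z) N <= dsum F N + C * hsum F N.
Proof.
move=> c1; elim: s => [_|a s IH /in_disc_cons[ha hs]].
  exists 0 => // F N hF; rewrite mul0r addr0.
  rewrite (@dsum_ext _ (fun z => c * F z)) ?dsumZ// ?c1 ?expr1n ?mul1r//.
    by move=> z _; rewrite /blaschke big_nil mulr1.
  exact: holZ.
have [C C0 HC] := IH hs.
exists (C + ((1 - normc a) ^+ 2)^-1); first by rewrite addr_ge0// invr_ge0 sqr_ge0.
move=> F N hF; have h := hol_blaschke_mul c hs hF.
rewrite (@dsum_ext _ (fun z => mob a z * (blaschke c s z * F z))); first last.
- exact: hol_mob_mul.
- by move=> z _; rewrite blaschke_cons mulrA.
rewrite (le_trans (mob_dsum N ha h))// mulrDl addrA lerD ?HC// mulrC.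
by rewrite ler_wpM2l ?invr_ge0 ?sqr_ge0// blaschke_hsum.
Qed.

Lemma blaschke_disc c a s z : normc c = 1 -> in_disc (a :: s) -> disc z ->
  normc (blaschke c (a :: s) z) <= normc (mob a z).
Proof.
move=> c1 /in_disc_cons[ha hs] hz; rewrite blaschke_cons ncM -[leRHS]mulr1 ler_wpM2l//.
rewrite /blaschke ncM c1 mul1r nc_prod; elim: s hs => [_|b s IH /in_disc_cons[hb hs]].
  by rewrite big_nil.
rewrite big_cons mulr_ile1// ?prodr_ge0//; last exact: IH.
by have := mob_disc hb hz; rewrite discE => /ltW.
Qed.

End BlaschkeFactors.

(** * Means over circles *)

Section CircleMeans.
Variable R : realType.
Local Notation mu := (@lebesgue_measure R).
Implicit Types (F : R[i] -> R[i]) (r B : R).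

Lemma disc_polar r t : 0 <= r < 1 -> disc (r%:C * cis t : R[i]).
Proof. by move=> /andP[r0 r1]; rewrite discE nc_polar ger0_norm. Qed.

Lemma circle_parseval F r : hol F -> 0 <= r < 1 ->
  (fun N => (2 * pi * \sum_(n < N) normc (tc F n) ^+ 2 * (r ^+ n) ^+ 2)%:E) @ \oo -->
    (\int[mu]_(t in `[0%R, (2 * pi)%R]) (normc (F (r%:C * cis t)) ^+ 2)%:E)%E.
Proof.
move=> hF hr; have [r0 r1] := andP hr.
have dr : disc (r%:C : R[i]) by rewrite discE ncR ger0_norm.
have [M HM] := pconv_abs_bounded (fun z hz => @tcP R F z hF hz) dr.
have HC t : (fun N => normc (\sum_(n < N) tc F n * r%:C ^+ n * cis t ^+ n - F (r%:C * cis t))) @ \oo --> (0 : R).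
  have E2 N : psum (tc F) (r%:C * cis t) N = \sum_(n < N) tc F n * r%:C ^+ n * cis t ^+ n.
    by apply: eq_bigr => n _; rewrite exprMn mulrA.
  by have := pconv_cvg (tcP hF (disc_polar t hr)); under eq_fun do rewrite E2; exact: id.
have := @parseval R (fun n => tc F n * r%:C ^+ n) (fun t => F (r%:C * cis t)) M HM HC.
rewrite (_ : (fun N => _) = (fun N => (2 * pi * \sum_(n < N) normc (tc F n) ^+ 2 * (r ^+ n) ^+ 2)%:E))//.
apply/funext => N; congr (_%:E); congr (_ * _); apply: eq_bigr => n _.
by rewrite ncM ncX ncR exprMn ger0_norm.
Qed.

Lemma measurable_circle F r : hol F -> 0 <= r < 1 ->
  measurable_fun `[0, 2 * pi] (fun t => (normc (F (r%:C * cis t)) ^+ 2)%:E).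
Proof.
move=> hF hr; apply/measurable_EFinP; apply: measurable_funX; apply: ccont_measurable.
by apply: ccont_circle => //; exact: hol_cont.
Qed.

Lemma integral_circle_cst B :
  (\int[mu]_(t in `[0%R, (2 * pi)%R]) (cst B%:E t) = (2 * pi * B)%:E)%E.
Proof.
rewrite integral_cst//= lebesgue_measure_itv/= lte_fin mulr_gt0 ?pi_gt0//.
by rewrite -EFinB -EFinM subr0 mulrC.
Qed.

Lemma pi2_gt0 : 0 < 2 * pi :> R.
Proof. by rewrite mulr_gt0// pi_gt0. Qed.

Lemma circle_sup F r B N : hol F -> 0 <= r < 1 ->
  (forall t, normc (F (r%:C * cis t)) <= B) ->
  \sum_(n < N) normc (tc F n) ^+ 2 * (r ^+ n) ^+ 2 <= B ^+ 2.
Proof.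
move=> hF hr HB; have := circle_parseval hF hr => cv.
rewrite -(ler_pM2l pi2_gt0) -lee_fin.
apply: (@le_trans _ _ (\int[mu]_(t in `[0%R, (2 * pi)%R]) (normc (F (r%:C * cis t)) ^+ 2)%:E)%E); last first.
  rewrite -integral_circle_cst; apply: ge0_le_integral => //.
  - by move=> t _; rewrite lee_fin sqr_ge0.
  - exact: measurable_circle.
  - by move=> t _; rewrite lee_fin lerXn2r ?nnegrE// (le_trans _ (HB 0)).
apply: cvge_ge cv; exists N => // m /= Nm; rewrite lee_fin ler_wpM2l ?(ltW pi2_gt0)//.
by apply: (@nneg_partial_mono _ (fun n => normc (tc F n) ^+ 2 * (r ^+ n) ^+ 2)) => // n; rewrite mulr_ge0 ?sqr_ge0.
Qed.

(** Cauchy's estimate on the circle of radius one half. *)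
Lemma cauchy_coef F (e : R) n : hol F -> (forall z, normc z <= 1 / 2 -> normc (F z) <= e) ->
  normc (tc F n) <= 2 ^+ n * e.
Proof.
move=> hF He; have hr : 0 <= (1 / 2 : R) < 1 by apply/andP; split; lra.
have H t : normc (F ((1 / 2)%:C * cis t)) <= e by apply: He; rewrite nc_polar ger0_norm; lra.
have e0 : 0 <= e by rewrite (le_trans _ (H 0)).
have := circle_sup n.+1 hF hr H; rewrite big_ord_recr/=.
have : 0 <= \sum_(i < n) normc (tc F i) ^+ 2 * ((1 / 2) ^+ i) ^+ 2.
  by apply: sumr_ge0 => i _; rewrite mulr_ge0 ?sqr_ge0.
rewrite -exprMn => h1 h2; have : (normc (tc F n) * (1 / 2) ^+ n) ^+ 2 <= e ^+ 2 by lra.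
rewrite ler_pXn2r ?nnegrE//; last by rewrite mulr_ge0// exprn_ge0//; lra.
by rewrite div1r exprVn ler_pdivrMr ?exprn_gt0// mulrC.
Qed.

(** On a circle of radius close to one the first [N] weights are close to one. *)
Lemma hsum_le_sup F B N : hol F -> (forall z, disc z -> normc (F z) <= B) -> hsum F N <= B ^+ 2.
Proof.
move=> hF HB; apply/ler_addgt0Pr => e e0.
set H := hsum F N; have H0 : 0 <= H := hsum_ge0 F N.
(* on this radius at most the fraction e / (H + 1) of the sum is lost *)
pose d := e / ((2 * N)%:R * (H + 1) + e).
have D0 : 0 < (2 * N)%:R * (H + 1) + e by rewrite ltr_wpDl// mulr_ge0//; lra.
have d0 : 0 < d by rewrite divr_gt0.
have d1 : d <= 1 by rewrite ler_pdivrMr// mul1r lerDr mulr_ge0//; lra.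
have hr : 0 <= 1 - d < 1 by lra.
have := circle_sup N hF hr (fun t => HB _ (disc_polar t hr)).
have bern k : 1 - k%:R * d <= (1 - d) ^+ k.
  elim: k => [|k IH]; first by rewrite mul0r subr0 expr0.
  have := ler_wpM2l (_ : 0 <= 1 - d) IH; rewrite -exprS => /(_ ltac:(lra)).
  have := ler0n R k; rewrite -natr1; nra.
have : (1 - (2 * N)%:R * d) * H <= \sum_(n < N) normc (tc F n) ^+ 2 * ((1 - d) ^+ n) ^+ 2.
  rewrite /H /hsum mulr_sumr; apply: ler_sum => n _; rewrite mulrC ler_wpM2l ?sqr_ge0//.
  rewrite -exprM; apply: le_trans (bern _) _.
  by rewrite ler_wiXn2l//; [lra|lra|rewrite mulnC leq_mul// ltnW].
suff : (2 * N)%:R * d * H <= e by lra.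
rewrite /d mulrA mulrAC ler_pdivrMr// mulrC; have := ler0n R (2 * N)%N; nra.
Qed.

End CircleMeans.

(** * Composition with a finite Blaschke product *)

Section Composition.
Variable R : realType.
Implicit Types (f g q F : R[i] -> R[i]) (z a v c : R[i]) (u : nat -> R[i]).

(** [kern a] is orthogonal to the multiples of [mob a]. *)
Lemma kernel_energy a v q N : disc a -> hol q ->
  hsum (fun z => kern a z * (v + (z - a) * q z)) N <=
    hsum q N + normc v ^+ 2 / (1 - normc a ^+ 2).
Proof.
move=> ha hq; have g := disc_gap ha.
have gC : (1 - normc a ^+ 2)%:C = 1 - a * a^* :> R[i] by rewrite rmorphB/= nc_sqJ.
have g0 : 1 - a * a^* != 0 :> R[i] by rewrite -gC eq_complex /= eqxx andbT gt_eqF.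
pose h0 := v / (1 - a * a^*).
pose Q z := kern a z * (q z + a^* * h0).
have hq' : hol (fun z => q z + a^* * h0) by apply: holD => //; exact: hol_cst.
have hQ : hol Q by exact: hol_kern_mul.
have EU z : disc z -> stepU a h0 Q z = kern a z * (v + (z - a) * q z).
  move=> hz; have d0 := den_neq0 ha hz; rewrite /stepU /Q /kern /h0.
  by move: d0 g0; move: (a^*) => b d0 g0; field; apply/andP.
have EL z : disc z -> stepL a h0 Q z = q z.
  by move=> hz; rewrite /stepL /Q (kernK (fun z => q z + a^* * h0))// addrK.
have := hardy_step a h0 N hQ.
rewrite (hsum_ext N (fun z hz => esym (EL z hz)) hq).
rewrite (@hsum_ext _ (fun z => kern a z * (v + (z - a) * q z)) (stepU a h0 Q)) => [E||]; first last.
- apply: hol_kern_mul => //; apply: holD; first exact: hol_cst.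
  exact: hol_num.
- by move=> z hz; exact/esym/EU.
have -> : normc v ^+ 2 / (1 - normc a ^+ 2) = (1 - normc a ^+ 2) * normc h0 ^+ 2.
  rewrite /h0 ncM ncV -gC ncR gtr0_norm//; by field; rewrite gt_eqF.
by rewrite -E lerDl mulr_ge0 ?sqr_ge0// ltW.
Qed.

Lemma psumSl u z m : psum u z m.+1 = u 0%N + z * psum (fun n => u n.+1) z m.
Proof.
rewrite /psum big_ord_recl/= expr0 mulr1 mulr_sumr; congr (_ + _).
by apply: eq_bigr => n _; rewrite /bump/= add1n exprS mulrCA.
Qed.

Lemma hol_psum u m : hol (fun z => psum u z m).
Proof.
elim: m u => [|m IH] u.
  by apply: hol_ext (hol_cst 0) => z _; rewrite /psum big_ord0.
apply: hol_ext (holD (hol_cst (u 0%N)) (holM (@hol_id R) (IH (fun n => u n.+1)))) => z _.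
by rewrite psumSl.
Qed.

Lemma common_threshold (P : nat -> nat -> Prop) :
  (forall n, exists m0, forall m, (m0 <= m)%N -> P n m) ->
  forall N, exists m0, forall m, (m0 <= m)%N -> forall n, (n < N)%N -> P n m.
Proof.
move=> H; elim=> [|N [m0 IH]]; first by exists 0%N.
have [m1 H1] := H N; exists (maxn m0 m1) => m; rewrite geq_max => /andP[h0 h1] n.
by rewrite ltnS leq_eqVlt => /orP[/eqP->|]; [exact: H1|exact: IH].
Qed.

Section Fixed.
Variables (c : R[i]) (a : R[i]) (s : seq R[i]).
Hypotheses (c1 : normc c = 1) (hin : in_disc (a :: s)).
Let phi := blaschke c (a :: s).
Let psi := blaschke c s.
Let ha : disc a := (in_disc_cons hin).1.
Let hs : in_disc s := (in_disc_cons hin).2.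

Lemma blaschke_disc_map z : disc z -> disc (phi z).
Proof.
move=> hz; rewrite discE (le_lt_trans (blaschke_disc c1 hin hz))// -discE.
exact: mob_disc.
Qed.

Lemma hol_psum_comp u m : hol (fun z => psum u (phi z) m).
Proof. by apply: (hol_comp (hol_psum u m)); [exact: hol_blaschke|exact: blaschke_disc_map]. Qed.

(** Horner's scheme: the kernel terms of successive steps are orthogonal. *)
Lemma comp_hsum u m N : hsum (fun z => kern a z * psum u (phi z) m) N <=
  (\sum_(i < m) normc (u i) ^+ 2) / (1 - normc a ^+ 2).
Proof.
have g := disc_gap ha; elim: m u => [|m IH] u.
  rewrite big_ord0 mul0r (@hsum_ext _ (fun=> 0)); first last.
  - exact: hol_cst.
  - by move=> z _; rewrite /psum big_ord0 mulr0.
  by rewrite /hsum big1// => n _; rewrite tc_cst; case: (nat_of_ord n) => [|k]; rewrite normc0 expr0n.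
pose T' z := psum (fun n => u n.+1) (phi z) m.
have hT' : hol (fun z => kern a z * T' z) by apply: hol_kern_mul => //; exact: hol_psum_comp.
have hq : hol (fun z => psi z * (kern a z * T' z)) by exact: hol_blaschke_mul.
rewrite (@hsum_ext _ (fun z => kern a z * (u 0%N + (z - a) * (psi z * (kern a z * T' z))))); first last.
- apply: hol_kern_mul => //; apply: holD; first exact: hol_cst.
  exact: hol_num.
- move=> z hz; rewrite psumSl -/(T' z) [phi z]blaschke_cons -/psi /mob /kern.
  by congr (_ * (_ + _)); move: (T' z) (psi z) => x y; ring.
rewrite (le_trans (kernel_energy (u 0%N) N ha hq))// big_ord_recl mulrDl addrC lerD2l.
exact: le_trans (blaschke_hsum N c1 hs hT') (IH _).
Qed.

Lemma comp_psum_hsum u m N : hsum (fun z => psum u (phi z) m) N <=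
  4 / (1 - normc a ^+ 2) * \sum_(i < m) normc (u i) ^+ 2.
Proof.
have hk : hol (fun z => kern a z * psum u (phi z) m).
  by apply: hol_kern_mul => //; exact: hol_psum_comp.
have := den_hsum N ha hk; rewrite (@hsum_ext _ (fun z => psum u (phi z) m)); first last.
- exact: hol_psum_comp.
- by move=> z hz; rewrite (kernK (fun z => psum u (phi z) m)).
by move=> /le_trans; apply; rewrite mulrAC -mulrA ler_wpM2l// comp_hsum.
Qed.

(** A Horner step [T = u_0 + phi T'] raises the Dirichlet integral by a multiple of the
    Hardy norm of [T'], that is, of a tail of [sum |u_i|^2]; adding the tails up counts
    [|u_i|^2] with weight [i]. *)
Lemma comp_psum_dsum : exists2 C : R, 0 <= C & forall u m N,
  dsum (fun z => psum u (phi z) m) N <= C * \sum_(i < m) i%:R * normc (u i) ^+ 2.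
Proof.
have g := disc_gap ha; have [C C0 HC] := blaschke_dsum c1 hin.
pose K := C * (4 / (1 - normc a ^+ 2)).
have K0 : 0 <= K by rewrite mulr_ge0// divr_ge0// ltW.
exists K => // u m N; elim: m u => [|m IH] u.
  rewrite big_ord0 mulr0 (@dsum_ext _ (fun=> 0)); first last.
  - exact: hol_cst.
  - by move=> z _; rewrite /psum big_ord0.
  rewrite /dsum big1// => n _; rewrite tc_cst.
  by case: (nat_of_ord n) => [|k]; rewrite normc0 expr0n/= mulr0.
pose T' z := psum (fun n => u n.+1) (phi z) m.
have hT' : hol T' by exact: hol_psum_comp.
have hp : hol (fun z => phi z * T' z) by exact: hol_blaschke_mul.
have -> : dsum (fun z => psum u (phi z) m.+1) N = dsum (fun z => phi z * T' z) N.
  rewrite (@dsum_ext _ (fun z => u 0%N + phi z * T' z)); first last.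
  - by apply: holD => //; exact: hol_cst.
  - by move=> z _; rewrite psumSl.
  rewrite /dsum (tcD (hol_cst _) hp) tc_cst; apply: eq_bigr => n _.
  by case: (nat_of_ord n) => [|k]; rewrite ?mul0r ?add0r.
rewrite (le_trans (HC _ _ hT'))//.
have := IH (fun n => u n.+1); rewrite -/T' => h1.
have := comp_psum_hsum (fun n => u n.+1) m N; rewrite -/T' => h2.
have h3 := ler_wpM2l C0 h2; rewrite mulrA -/K in h3.
rewrite (le_trans (lerD h1 h3))// -mulrDr ler_wpM2l// -big_split/=.
rewrite big_ord_recl mul0r add0r le_eqVlt; apply/orP; left; apply/eqP.
by apply: eq_bigr => n _; rewrite lift0 -natr1; ring.
Qed.

Lemma blaschke_half : exists2 rho : R, 0 <= rho < 1 &
  forall z, normc z <= 1 / 2 -> normc (phi z) <= rho.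
Proof.
have g := disc_gap ha; pose d := (1 - normc a ^+ 2) * (3 / 16).
have d0 : 0 < d by rewrite mulr_gt0//; lra.
have d1 : d < 1 by rewrite /d; have := sqr_ge0 (normc a); lra.
have sd0 : 0 <= Num.sqrt (1 - d) by exact: sqrtr_ge0.
have sd1 : Num.sqrt (1 - d) ^+ 2 = 1 - d by rewrite sqr_sqrtr; lra.
exists (Num.sqrt (1 - d)); first by apply/andP; split => //; nra.
move=> z hz; have dz : disc z by rewrite discE; lra.
apply: le_trans (blaschke_disc c1 hin dz) _.
rewrite -(@ler_pXn2r _ 2) ?nnegrE// sd1.
suff : d <= 1 - normc (mob a z) ^+ 2 by lra.
have dn : 0 < normc (1 - a^* * z) ^+ 2 by rewrite exprn_gt0// nc_gt0 den_neq0.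
rewrite mob_defect// ler_pdivlMr// /d -mulrA ler_wpM2l ?(ltW g)//.
have : normc (1 - a^* * z) ^+ 2 <= 4.
  have : normc (1 - a^* * z) <= 2.
    rewrite (le_trans (ncB _ _))// normc1 ncM ncJ.
    by move: ha; rewrite discE => h; have := normc_ge0 a; have := normc_ge0 z; nra.
  by have := normc_ge0 (1 - a^* * z); nra.
by have := normc_ge0 z; nra.
Qed.

(** The disc of radius one half is mapped into a smaller disc, where the partial sums of
    [f] converge uniformly; Cauchy's estimate does the rest. *)
Lemma comp_coef f n (e : R) : dirichlet f -> 0 < e -> exists m0, forall m, (m0 <= m)%N ->
  normc (tc (fun z => f (phi z)) n - tc (fun z => psum (tc f) (phi z) m) n) <= e.
Proof.
move=> hf e0; have hF := dirichlet_hol hf.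
have hc : hol (fun z => f (phi z)).
  by apply: hol_comp => //; [exact: hol_blaschke|exact: blaschke_disc_map].
have [rho hr Hrho] := blaschke_half.
have [M HM] := dbounded_hbounded (dirichlet_dbounded hf).
have M0 : 0 <= M by have := HM 0%N; rewrite /hsum big_ord0.
have cb k : normc (tc f k) <= Num.sqrt M.
  rewrite -(@ler_pXn2r _ 2)// ?nnegrE// sqr_sqrtr// (le_trans _ (HM k.+1))//.
  by rewrite /hsum big_ord_recr/= lerDr hsum_ge0.
have en : 0 < e / 2 ^+ n by rewrite divr_gt0// exprn_gt0.
have [m0 Hm] := geo_small (2 * (Num.sqrt M / (1 - rho))) hr en.
exists m0 => m /Hm hm.
have -> : tc (fun z => f (phi z)) n - tc (fun z => psum (tc f) (phi z) m) n =
    tc (fun z => f (phi z) - psum (tc f) (phi z) m) n.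
  by rewrite (tcB hc (hol_psum_comp _ _)).
have -> : e = 2 ^+ n * (e / 2 ^+ n) by rewrite mulrC divfK// expf_neq0.
apply: cauchy_coef; first by apply: holB => //; exact: hol_psum_comp.
move=> z hz; have hw := Hrho z hz; set w := phi z in hw *.
have dw : disc w by rewrite discE; case/andP: hr => _; lra.
have [l Hl] := @geo_sum _ (fun k => tc f k * w ^+ k) (Num.sqrt M) rho hr (sqrtr_ge0 _) (fun k =>
  ltac:(by rewrite ncM ncX ler_pM ?exprn_ge0// lerXn2r ?nnegrE//; case/andP: hr)).
have lE : l = f w.
  apply: (@pconv_unique_val _ (tc f) w); last exact: tcP.
  move=> e' e'0; have [N0 HN] := geo_small (2 * (Num.sqrt M / (1 - rho))) hr e'0.
  exists N0 => N /HN; apply: le_trans; apply: le_trans (Hl N) _.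
  by rewrite le_eqVlt; apply/orP; left; apply/eqP; ring.
rewrite ncBC -lE; apply: le_trans (Hl m) _; apply: le_trans hm.
by rewrite le_eqVlt; apply/orP; left; apply/eqP; ring.
Qed.

(** The bounds for partial sums pass to the limit coefficient by coefficient. *)
Lemma dirichlet_comp f : dirichlet f -> dirichlet (fun z => f (phi z)).
Proof.
move=> hf; have [C C0 HC] := comp_psum_dsum.
apply: dirichletI.
  apply: hol_comp; [exact: dirichlet_hol|exact: hol_blaschke|exact: blaschke_disc_map].
exists (2 * (C * dtotal f) + 2) => N.
have small : exists m0, forall m, (m0 <= m)%N -> forall n, (n < N)%N ->
    n%:R * normc (tc (fun z => f (phi z)) n - tc (fun z => psum (tc f) (phi z) m) n) ^+ 2 <=
    (N.+1%:R : R)^-1.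
  apply: common_threshold => n.
  pose e : R := (n.+1%:R * N.+1%:R)^-1.
  have e0 : 0 < e by rewrite invr_gt0 mulr_gt0// ltr0n.
  have [m0 Hm0] := comp_coef n hf e0; exists m0 => m /Hm0 h.
  have e1 : e <= 1 by rewrite invf_le1 ?mulr_gt0 ?ltr0n// -natrM ler1n.
  have : normc (tc (fun z => f (phi z)) n - tc (fun z => psum (tc f) (phi z) m) n) ^+ 2 <= e.
    by move: h; move: (normc_ge0 (tc (fun z => f (phi z)) n - tc (fun z => psum (tc f) (phi z) m) n)); nra.
  move=> /(ler_wpM2l (ler0n R n)) /le_trans; apply.
  rewrite /e invfM mulrA -[leRHS]mul1r ler_wpM2r ?invr_ge0//.
  by rewrite ler_pdivrMr ?ltr0n// mul1r ler_nat.
have [m /(_ m (leqnn _)) Hm] := small.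
have B1 : dsum (fun z => psum (tc f) (phi z) m) N <= C * dtotal f.
  by rewrite (le_trans (HC _ _ _))// ler_wpM2l// dsum_le_total//; exact: dirichlet_dbounded.
have B2 : \sum_(n < N) n%:R * normc (tc (fun z => f (phi z)) n - tc (fun z => psum (tc f) (phi z) m) n) ^+ 2 <= 1.
  rewrite (@le_trans _ _ (\sum_(n < N) (N.+1%:R : R)^-1))//.
    by apply: ler_sum => n _; exact: Hm.
  rewrite sumr_const card_ord -[leLHS]mulr_natl ler_pdivrMr ?ltr0n// mul1r ler_nat; exact: leqW.
suff : dsum (fun z => f (phi z)) N <= 2 * dsum (fun z => psum (tc f) (phi z) m) N +
  2 * \sum_(n < N) n%:R * normc (tc (fun z => f (phi z)) n - tc (fun z => psum (tc f) (phi z) m) n) ^+ 2 by lra.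
rewrite /dsum !mulr_sumr -big_split/=; apply: ler_sum => n _.
set x := tc _ n; set y := tc _ n; have := ncD_sq y (x - y); rewrite [y + _]addrC subrK.
by move=> /(ler_wpM2l (ler0n R n)); lra.
Qed.

End Fixed.
End Composition.

(** * The Dirichlet space as a module over compositions *)

Section Decomposition.
Variable R : realType.
Implicit Types (f g h q F : R[i] -> R[i]) (z a v c : R[i]) (u : nat -> R[i]).

Lemma hsumB_cst f v N : hol f -> hsum (fun z => f z - v) N <= 2 * hsum f N + 2 * normc v ^+ 2.
Proof.
move=> hf; rewrite /hsum (tcB hf (hol_cst v)) tc_cst.
case: N => [|N]; first by rewrite !big_ord0 mulr0 add0r mulr_ge0// sqr_ge0.
rewrite !big_ord_recl/= mulrDr -addrA [2 * _ + 2 * normc v ^+ 2]addrC addrA lerD//.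
  by have := ncD_sq (tc f 0) (- v); rewrite ncN.
by rewrite mulr_sumr; apply: ler_sum => n _; rewrite subr0 mulr_natl mulr2n lerDl sqr_ge0.
Qed.

(** The last bound is the gain of the step: up to a constant [L] is [(1 - a^* z) q], where
    [E(q)] is controlled by the loss of [D] and the constant by the loss of [E]. *)
Lemma backward_step a : disc a -> exists2 K : R, 0 <= K & forall h, dirichlet h ->
  exists (x : R[i]) (L : R[i] -> R[i]), [/\ dirichlet L, forall z, disc z -> h z = x * kern a z + mob a z * L z,
    normc x ^+ 2 <= htotal h - htotal L, dtotal L <= dtotal h &
    htotal L <= K * ((dtotal h - dtotal L) + (htotal h - htotal L))].
Proof.
move=> ha; have g := disc_gap ha.
have g1 : 1 - normc a ^+ 2 <= 1 by have := sqr_ge0 (normc a); lra.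
have gC : (1 - normc a ^+ 2)%:C = 1 - a * a^* :> R[i] by rewrite rmorphB/= nc_sqJ.
exists (8 / (1 - normc a ^+ 2)); first by rewrite divr_ge0// ltW.
move=> h /dirichletP[hh bh]; have [q hq hE] := divide_at ha hh; set v := h a in hE.
have bU : dbounded (stepU a v q) by apply: dbounded_ext bh => // z hz; exact: hE.
have EH : htotal (stepU a v q) = htotal h by apply: htotal_ext => // z hz; exact: hE.
have ED : dtotal (stepU a v q) = dtotal h by apply: dtotal_ext => // z hz; exact: hE.
have [bL bq] := step_bounded ha hq bU.
have := step_htotal ha hq bU; have := step_dtotal ha hq bU; rewrite EH ED => I2 I1.
have q0 := htotal_ge0 bq; have v0 := sqr_ge0 (normc v).
exists ((1 - a * a^*) * v), (stepL a v q); split.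
- by apply: dirichletI => //; exact: hol_stepL.
- move=> z hz; rewrite hE// /stepL /mob /kern; have d0 := den_neq0 ha hz.
  by move: d0; move: (a^*) (q z) => b y d0; field.
- rewrite ncM -gC ncR gtr0_norm// exprMn; move: I1 v0; set V := normc v ^+ 2 => I1 v0.
  rewrite (@le_trans _ _ ((1 - normc a ^+ 2) * V))//; last by lra.
  by rewrite ler_wpM2r// expr2 -[leRHS]mul1r ler_wpM2r// ltW.
- have : 0 <= (1 - normc a ^+ 2) * htotal q by rewrite mulr_ge0// ltW.
  by move: I2; lra.
rewrite mulrAC ler_pdivlMr//.
have : htotal (stepL a v q) <= 8 * htotal q + 2 * normc v ^+ 2.
  apply: htotal_le => N; apply: le_trans (hsumB_cst _ _ (hol_den a hq)) _.
  rewrite lerD//.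
    by have := den_hsum N ha hq; have := hsum_le_total N bq; lra.
  rewrite ler_wpM2l// ncM ncJ exprMn -[leRHS]mul1r ler_wpM2r//.
  by move: ha; rewrite discE; have := normc_ge0 a; nra.
have : 0 <= (1 - normc a ^+ 2) * normc v ^+ 2 by rewrite mulr_ge0// ltW.
move=> p0 /(ler_wpM2r (ltW g)); move: I1 I2; lra.
Qed.

(** A full pass over the zeros, written with the resulting basis [e].  The energy
    bound comes from the first zero alone, the later steps being contractive. *)
Lemma backward_pass c s : normc c = 1 -> in_disc s ->
  exists (e : nat -> R[i] -> R[i]) (K : R), [/\ 0 <= K,
  forall i f, dirichlet f -> dirichlet (fun z => e i z * f z) &
  forall h, dirichlet h -> exists (x : nat -> R[i]) (h' : R[i] -> R[i]), [/\ dirichlet h',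
    forall z, disc z -> h z = \sum_(i < size s) x i * e i z + blaschke c s z * h' z,
    \sum_(i < size s) normc (x i) ^+ 2 <= htotal h - htotal h', dtotal h' <= dtotal h &
    s != [::] -> htotal h' <= K * ((dtotal h - dtotal h') + (htotal h - htotal h'))]].
Proof.
move=> c1; have c0 : c != 0 by rewrite -nc_gt0 c1.
elim: s => [_|a s IH /in_disc_cons[ha hs]].
  exists (fun _ _ => 0), 0; split=> [|_ f hf|h hh]; first exact: lexx.
    by apply: dirichlet_ext (dirichlet_cst 0) => z _; rewrite mul0r.
  have hZ := dirichlet_hol hh; have cn : normc c^-1 ^+ 2 = 1 by rewrite ncV c1 invr1 expr1n.
  exists (fun=> 0), (fun z => c^-1 * h z); split; first exact: dirichletZ.
  - by move=> z _; rewrite big_ord0 add0r /blaschke big_nil mulr1 mulVKf.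
  - rewrite big_ord0 /htotal (_ : hsum (fun z => c^-1 * h z) = hsum h) ?subrr//.
    by apply/funext => N; rewrite hsumZ// cn mul1r.
  - rewrite /dtotal (_ : dsum (fun z => c^-1 * h z) = dsum h)//.
    by apply/funext => N; rewrite dsumZ// cn mul1r.
  - by rewrite eqxx.
have [e [K1 [_ he He]]] := IH hs; have [K K0 HK] := backward_step ha.
exists (fun i z => if i is j.+1 then mob a z * e j z else kern a z), K; split; first exact: K0.
  move=> [|j] f hf; first exact: dirichlet_kern_mul.
  by apply: dirichlet_ext (dirichlet_mob_mul ha (he j _ hf)) => z _; rewrite mulrA.
move=> h hh; have [x0 [L [dL EL I1 I2 I3]]] := HK h hh.
have [x [h' [dh' Eh' J1 J2 _]]] := He L dL.
have J0 : 0 <= \sum_(i < size s) normc (x i) ^+ 2 by apply: sumr_ge0 => i _; exact: sqr_ge0.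
exists (fun i => if i is j.+1 then x j else x0), h'; split; first exact: dh'.
- move=> z hz; rewrite EL// Eh'// big_ord_recl/= blaschke_cons mulrDr mulr_sumr addrA mulrA.
  by congr (_ + _ + _); apply: eq_bigr => i _; rewrite mulrCA.
- by rewrite big_ord_recl/=; move: I1 J1; lra.
- exact: le_trans I2.
move=> _; apply: (@le_trans _ _ (htotal L)); first by lra.
by apply: le_trans I3 _; rewrite ler_wpM2l//; lra.
Qed.

Lemma coef_le_htotal f n : hbounded f -> normc (tc f n) <= Num.sqrt (htotal f).
Proof.
move=> bf; rewrite -(@ler_pXn2r _ 2) ?nnegrE// sqr_sqrtr ?htotal_ge0//.
apply: le_trans (hsum_le_total n.+1 bf).
by rewrite /hsum big_ord_recr/= lerDr hsum_ge0.
Qed.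

Lemma psum_bound u z N (B : R) : disc z -> (forall n, normc (u n) <= B) ->
  normc (psum u z N) <= B / (1 - normc z).
Proof.
rewrite discE => hz HB; have B0 : 0 <= B by rewrite (le_trans _ (HB 0%N)).
have z1 : 0 < 1 - normc z by lra.
rewrite ler_pdivlMr//; have : normc (psum u z N) <= \sum_(n < N) B * normc z ^+ n.
  apply: le_trans (nc_sum _ _ _) _; apply: ler_sum => n _.
  by rewrite ncM ncX ler_wpM2r ?exprn_ge0.
rewrite -mulr_sumr => h; rewrite (le_trans (ler_wpM2r (ltW z1) h))// -mulrA ler_piMr//.
have -> : (\sum_(n < N) normc z ^+ n) * (1 - normc z) = 1 - normc z ^+ N.
  by rewrite -[RHS]opprB subrX1 mulrC -mulNr opprB.
by rewrite lerBlDr lerDl exprn_ge0.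
Qed.

Lemma pconv_bound u z s (B : R) : pconv u z s -> (forall N, normc (psum u z N) <= B) ->
  normc s <= B.
Proof.
move=> hs HB; apply/ler_addgt0Pr => e e0; have [N0 /(_ N0 (leqnn _)) h] := hs e e0.
rewrite -[s](subKr (psum u z N0)) (le_trans (ncB _ _))// lerD//.
Qed.

Lemma point_bound f z : hol f -> hbounded f -> disc z ->
  normc (f z) <= Num.sqrt (htotal f) / (1 - normc z).
Proof.
move=> hf bf hz; apply: pconv_bound (tcP hf hz) _ => N.
by apply: psum_bound => // n; exact: coef_le_htotal.
Qed.

Lemma bounded_series u (B : R) : (forall n, normc (u n) <= B) ->
  exists2 f, hol f & tc f = u.
Proof.
move=> HB; pose f z := xget 0 [set s | pconv u z s].
have B0 : 0 <= B by rewrite (le_trans _ (HB 0%N)).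
have Hf z : disc z -> pconv u z (f z).
  move=> hz; have : exists s, pconv u z s.
    apply: (@pconv_geo _ u z B (normc z)) => // [|n]; last by rewrite ler_wpM2r ?exprn_ge0.
    by rewrite normc_ge0 -discE.
  by case=> s hs; apply: (@xgetPex _ 0 [set s | pconv u z s]); exists s.
exists f; first exact: pconv_hol Hf.
exact: tc_unique.
Qed.

(** Iterating the pass expands [g] in powers of [phi] with coefficients in the span of the
    [e i]. As the coefficients of pass [k] are bounded by the Hardy energy lost there,
    summation by parts bounds their sum weighted by [k] by the sum of all remaining
    energies, and each of these is at most a multiple of a loss of [D + E]. *)
Lemma blaschke_module c a s : normc c = 1 -> in_disc (a :: s) ->
  exists d (e : nat -> R[i] -> R[i]),
  (forall i f, dirichlet f -> dirichlet (fun z => e i z * f z)) /\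
  forall g, dirichlet g -> exists G : nat -> R[i] -> R[i],
    (forall i, (i < d)%N -> dirichlet (G i)) /\
    forall z, disc z -> g z = \sum_(i < d) e i z * G i (blaschke c (a :: s) z).
Proof.
move=> c1 hin; have [e [K [K0 he Hp]]] := backward_pass c1 hin.
pose d := size (a :: s).
exists d, e; split=> [|g hg]; first exact: he.
set phi := blaschke c (a :: s).
have /choice[st Hst] h : exists p : (nat -> R[i]) * (R[i] -> R[i]), dirichlet h ->
    [/\ dirichlet p.2, forall z, disc z -> h z = \sum_(i < d) p.1 i * e i z + phi z * p.2 z,
    \sum_(i < d) normc (p.1 i) ^+ 2 <= htotal h - htotal p.2, dtotal p.2 <= dtotal h &
    htotal p.2 <= K * ((dtotal h - dtotal p.2) + (htotal h - htotal p.2))].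
  have [hh|nh] := pselect (dirichlet h); last by exists (fun=> 0, h).
  have [x [h' [p1 p2 p3 p4 p5]]] := Hp h hh; exists (x, h') => _.
  by split; [exact: p1|exact: p2|exact: p3|exact: p4|exact: p5].
pose h k := iter k (fun f => (st f).2) g; pose X i k := (st (h k)).1 i.
have dh k : dirichlet (h k).
  by elim: k => [|k IH]; [exact: hg|have [hd _ _ _ _] := Hst _ IH; exact: hd].
have S k := Hst _ (dh k).
have bh k : hbounded (h k) by exact: (dbounded_hbounded (dirichlet_dbounded (dh k))).
pose E k := htotal (h k); pose V k := dtotal (h k) + E k.
have E0 k : 0 <= E k by exact: htotal_ge0.
have D0 k : 0 <= dtotal (h k) by exact: (dtotal_ge0 (dirichlet_dbounded (dh k))).
have X0 k : 0 <= \sum_(i < d) normc (X i k) ^+ 2 by apply: sumr_ge0 => i _; exact: sqr_ge0.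
have XE k : \sum_(i < d) normc (X i k) ^+ 2 <= E k - E k.+1 by have [_ _ H _ _] := S k; exact: H.
have EV k : E k.+1 <= K * (V k - V k.+1).
  by have [_ _ _ _ H] := S k; apply: le_trans H _; rewrite ler_wpM2l// /V /E /=; lra.
have Em k : E k <= E 0%N.
  by elim: k => // k; apply: le_trans; have := X0 k; have := XE k; lra.
have Xle i k : (i < d)%N -> normc (X i k) ^+ 2 <= \sum_(i < d) normc (X i k) ^+ 2.
  move=> hi; rewrite (bigD1 (Ordinal hi))//= lerDl sumr_ge0// => j _; exact: sqr_ge0.
have Xb i k : (i < d)%N -> normc (X i k) <= Num.sqrt (E 0%N).
  move=> hi; rewrite -(@ler_pXn2r _ 2) ?nnegrE// sqr_sqrtr//.
  by have := Xle i k hi; have := XE k; have := Em k; have := E0 k.+1; lra.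
have Xd n : \sum_(k < n) k%:R * (\sum_(i < d) normc (X i k) ^+ 2) + n%:R * E n + K * V n <= K * V 0%N.
  elim: n => [|n IH]; first by rewrite big_ord0 mul0r !add0r.
  apply: le_trans IH; rewrite big_ord_recr/=.
  have := ler_wpM2l (ler0n R n) (XE n); have := EV n; rewrite -natr1; lra.
have /choice[G HG] i : exists Gi, (i < d)%N -> hol Gi /\ tc Gi = X i.
  have [hi|] := ltnP i d; last by exists (fun=> 0).
  by have [Gi h1 h2] := bounded_series (fun k => Xb i k hi); exists Gi.
exists G; split=> [i hi|z hz].
  have [h1 h2] := HG i hi; apply: dirichletI => //; exists (K * V 0%N) => n.
  rewrite /dsum h2; apply: le_trans (Xd n).
  have : \sum_(k < n) k%:R * normc (X i k) ^+ 2 <= \sum_(k < n) k%:R * (\sum_(i < d) normc (X i k) ^+ 2).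
    by apply: ler_sum => k _; rewrite ler_wpM2l// Xle.
  have : 0 <= n%:R * E n by rewrite mulr_ge0.
  have : 0 <= K * V n by rewrite mulr_ge0// addr_ge0.
  lra.
have dw : disc (phi z) by exact: blaschke_disc_map.
pose Y k := \sum_(i < d) e i z * X i k.
have c2 : pconv Y (phi z) (\sum_(i < d) e i z * G i (phi z)).
  have H m : (m <= d)%N -> pconv (fun k => \sum_(i < m) e i z * X i k) (phi z) (\sum_(i < m) e i z * G i (phi z)).
    elim: m => [_|m IH md].
      move=> eps eps0; exists 0%N => N _.
      by rewrite big_ord0 /psum big1 ?subrr ?normc0 ?ltW// => k _; rewrite big_ord0 mul0r.
    rewrite big_ord_recr/=; under eq_fun do rewrite big_ord_recr/=.
    apply: pconvD; first by apply: IH; exact: ltnW.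
    by apply: pconvZ; have [h1 <-] := HG m md; exact: tcP.
  exact: H.
have rem n : g z - psum Y (phi z) n = phi z ^+ n * h n z.
  elim: n => [|n IH]; first by rewrite /psum big_ord0 subr0 expr0 mul1r.
  have [_ /(_ z hz) Hz _ _ _] := S n.
  rewrite psumS opprD addrA IH Hz exprS -/(X _ n) mulrDr.
  rewrite (_ : \sum_(i < d) (st (h n)).1 i * e i z = Y n).
    by rewrite /h /=; ring.
  by apply: eq_bigr => i _; rewrite mulrC.
have c3 : pconv Y (phi z) (g z).
  have hb n : normc (h n z) <= Num.sqrt (E 0%N) / (1 - normc z).
    apply: le_trans (point_bound (dirichlet_hol (dh n)) (bh n) hz) _.
    rewrite ler_wpM2r ?invr_ge0 ?ler_wsqrtr//; first by move: hz; rewrite discE; lra.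
    exact: Em.
  move=> eps eps0; have hr : 0 <= normc (phi z) < 1 by rewrite normc_ge0 -discE.
  have [N0 HN] := geo_small (Num.sqrt (E 0%N) / (1 - normc z)) hr eps0.
  exists N0 => N /HN; apply: le_trans; rewrite ncBC rem ncM ncX mulrC.
  by rewrite ler_wpM2r ?exprn_ge0.
exact: pconv_unique_val c3 c2.
Qed.

End Decomposition.

(** * Automatic boundedness *)

Section UniformBoundedness.
Variable R : realType.
Implicit Types (f g h x : R[i] -> R[i]) (z c : R[i]) (v w : nat -> R[i]).

(** Truncated squared norm of a sequence of Taylor coefficients. *)
Definition qsq m v : R := normc (v 0%N) ^+ 2 + kappa R * \sum_(j < m) j%:R * normc (v j) ^+ 2.

Lemma kappa_ge0 : 0 <= kappa R. Proof. exact/ltW/kappa_gt0. Qed.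

Lemma qsq_ge0 m v : 0 <= qsq m v.
Proof.
rewrite addr_ge0 ?sqr_ge0// mulr_ge0 ?kappa_ge0// sumr_ge0// => j _.
by rewrite mulr_ge0// sqr_ge0.
Qed.

Lemma qsqD m v w : qsq m (fun j => v j + w j) <= 2 * qsq m v + 2 * qsq m w.
Proof.
have H : \sum_(j < m) j%:R * normc (v j + w j) ^+ 2 <=
    2 * \sum_(j < m) j%:R * normc (v j) ^+ 2 + 2 * \sum_(j < m) j%:R * normc (w j) ^+ 2.
  rewrite !mulr_sumr -big_split/=; apply: ler_sum => j _.
  by have := ler_wpM2l (ler0n R j) (ncD_sq (v j) (w j)); lra.
have := ler_wpM2l kappa_ge0 H; have := ncD_sq (v 0%N) (w 0%N); rewrite /qsq; lra.
Qed.

Lemma qsqZ m c v : qsq m (fun j => c * v j) = normc c ^+ 2 * qsq m v.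
Proof.
have H : \sum_(j < m) j%:R * normc (c * v j) ^+ 2 =
    normc c ^+ 2 * \sum_(j < m) j%:R * normc (v j) ^+ 2.
  by rewrite mulr_sumr; apply: eq_bigr => j _; rewrite ncM exprMn mulrCA.
by rewrite /qsq H ncM exprMn; move: (\sum_(j < m) _) => S; ring.
Qed.

Lemma nc_parallelogram z c :
  normc (z + c) ^+ 2 + normc (z - c) ^+ 2 = 2 * normc z ^+ 2 + 2 * normc c ^+ 2.
Proof. by case: z c => [a b] [a' b']; rewrite !nc_sq /=; ring. Qed.

Lemma qsq_parallelogram m v w : qsq m (fun j => v j + w j) + qsq m (fun j => v j - w j) =
  2 * qsq m v + 2 * qsq m w.
Proof.
have H : \sum_(j < m) j%:R * normc (v j + w j) ^+ 2 + \sum_(j < m) j%:R * normc (v j - w j) ^+ 2 =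
    2 * (\sum_(j < m) j%:R * normc (v j) ^+ 2) + 2 * \sum_(j < m) j%:R * normc (w j) ^+ 2.
  rewrite !mulr_sumr -!big_split/=; apply: eq_bigr => j _.
  by have := congr1 (fun t => j%:R * t) (nc_parallelogram (v j) (w j)); rewrite !mulrDr; lra.
have := congr1 (fun t => kappa R * t) H; have := nc_parallelogram (v 0%N) (w 0%N).
by rewrite /qsq !mulrDr; lra.
Qed.

Lemma qsq_small m v (d : R) : (forall j, normc (v j) <= d) ->
  qsq m v <= (1 + kappa R * (m%:R * m%:R)) * d ^+ 2.
Proof.
move=> H; have d0 : 0 <= d by rewrite (le_trans _ (H 0%N)).
have H2 j : normc (v j) ^+ 2 <= d ^+ 2 by rewrite lerXn2r ?nnegrE.
rewrite mulrDl mul1r lerD ?H2// -mulrA ler_wpM2l ?kappa_ge0//.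
apply: (@le_trans _ _ (\sum_(j < m) m%:R * d ^+ 2)).
  by apply: ler_sum => j _; rewrite ler_pM ?sqr_ge0// ler_nat ltnW.
by rewrite sumr_const card_ord -[leLHS]mulr_natl mulrA.
Qed.

Lemma qsq_le_dsq m f : dirichlet f -> qsq m (tc f) <= dsq f.
Proof.
move=> hf; rewrite /dsq lerD2l ler_wpM2l ?kappa_ge0//.
exact: (dsum_le_total m (dirichlet_dbounded hf)).
Qed.

Lemma dsq_le f (M : R) : (forall m, qsq m (tc f) <= M) -> dsq f <= M.
Proof.
move=> H; rewrite /dsq addrC -lerBrDr mulrC -ler_pdivlMr ?kappa_gt0//; apply: dtotal_le => N.
by rewrite ler_pdivlMr ?kappa_gt0// lerBrDr mulrC addrC; exact: H.
Qed.

Lemma htotal_le_dsq f : dirichlet f -> htotal f <= (1 + (kappa R)^-1) * dsq f.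
Proof.
move=> hf; have bf := dirichlet_dbounded hf; have k0 := kappa_gt0 R.
apply: htotal_le => N; apply: le_trans (hsum_le_dsum f N) _.
have := dsum_le_total N bf; have := dtotal_ge0 bf; have := sqr_ge0 (normc (tc f 0)).
rewrite /dsq; set A := normc _ ^+ 2; set D := dtotal f => A0 D0 h.
have -> : (1 + (kappa R)^-1) * (A + kappa R * D) = A + D + (kappa R)^-1 * A + kappa R * D.
  by field; rewrite gt_eqF.
have : 0 <= (kappa R)^-1 * A by rewrite mulr_ge0// invr_ge0 ltW.
have : 0 <= kappa R * D by rewrite mulr_ge0// ltW.
by lra.
Qed.

Lemma coef_le_dsq f n : dirichlet f -> dsq f <= 1 ->
  normc (tc f n) <= Num.sqrt (1 + (kappa R)^-1).
Proof.
move=> hf h; apply: le_trans (coef_le_htotal n (dbounded_hbounded (dirichlet_dbounded hf))) _.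
rewrite ler_wsqrtr// (le_trans (htotal_le_dsq hf))// -[leRHS]mulr1 ler_wpM2l//.
by rewrite addr_ge0// invr_ge0 kappa_ge0.
Qed.

(** The ratio of the series below, so small that each term dominates the remainder. *)
Definition lam : R[i] := (1 / 10)%:C.

Lemma nc_lam : normc lam = 1 / 10 :> R.
Proof. by rewrite ncR ger0_norm//; lra. Qed.

(** Completeness of [D], for the geometrically convergent series needed below. *)
Lemma dirichlet_complete (g : nat -> R[i] -> R[i]) :
  (forall k, dirichlet (g k)) -> (forall k, dsq (g k) <= 1) ->
  exists2 x, dirichlet x & forall K,
    dsq (fun z => x z - \sum_(k < K) lam ^+ k * g k z) <= 7 * (1 / 100) ^+ K.
Proof.
move=> hg g1; pose y k := tc (g k); pose B := Num.sqrt (1 + (kappa R)^-1).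
have yB k j : normc (y k j) <= B by exact: coef_le_dsq.
have B0 : 0 <= B by exact: sqrtr_ge0.
have l1 : 0 <= (1 / 10 : R) < 1 by apply/andP; split; lra.
have /choice[xs Hxs] j : exists l : R[i], forall N,
    normc (\sum_(k < N) lam ^+ k * y k j - l) <= 2 * (B * (1 / 10) ^+ N / (1 - 1 / 10)).
  apply: (@geo_sum _ (fun k => lam ^+ k * y k j) B (1 / 10) l1 B0) => k.
  by rewrite ncM ncX nc_lam mulrC ler_wpM2r// exprn_ge0//; lra.
have [|x hx xE] := @bounded_series R xs (2 * (B * (1 / 10) ^+ 0 / (1 - 1 / 10))).
  by move=> j; have := Hxs j 0%N; rewrite big_ord0 sub0r ncN.
pose S K z := \sum_(k < K) lam ^+ k * g k z.
have dS K : dirichlet (S K).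
  elim: K => [|K IH]; first by apply: dirichlet_ext (dirichlet_cst 0) => z _; rewrite /S big_ord0.
  apply: dirichlet_ext (dirichletD IH (dirichletZ (lam ^+ K) (hg K))) => z _.
  by rewrite /S big_ord_recr.
have tS K j : tc (S K) j = \sum_(k < K) lam ^+ k * y k j.
  elim: K => [|K IH].
    rewrite (_ : S 0%N = fun=> 0); last by apply/funext => z; rewrite /S big_ord0.
    by rewrite tc_cst big_ord0; case: j.
  rewrite (_ : S K.+1 = fun z => S K z + lam ^+ K * g K z); last first.
    by apply/funext => z; rewrite /S big_ord_recr.
  have hgK := dirichlet_hol (hg K).
  by rewrite (tcD (dirichlet_hol (dS K)) (holZ (lam ^+ K) hgK)) tcZ// IH big_ord_recr.
(* 3 is stable under adding a term: 2 + 2 * 3 / 100 <= 3 *)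
have A m n K : qsq m (fun j => \sum_(k < n) lam ^+ k * y (K + k)%N j) <= 3.
  elim: n K => [|n IH] K.
    apply: le_trans (@qsq_small _ _ 0 _) _ => [j|]; first by rewrite big_ord0 normc0.
    by rewrite expr0n/= mulr0.
  rewrite (_ : (fun j => _) = fun j => y K j + lam * \sum_(k < n) lam ^+ k * y (K.+1 + k)%N j); last first.
    apply/funext => j; rewrite big_ord_recl expr0 mul1r addn0 mulr_sumr; congr (_ + _).
    by apply: eq_bigr => k _; rewrite lift0 exprS mulrA addSnnS.
  apply: le_trans (qsqD _ _ _) _; rewrite qsqZ nc_lam.
  have := IH K.+1; have := le_trans (qsq_le_dsq m (hg K)) (g1 K); rewrite -/(y K).
  by set P := qsq _ _; set Q := qsq _ _; lra.
(* 7 = 2 * 3 + 1: the block bounded above, and the remainder of the series after it *)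
have T m K : qsq m (fun j => xs j - tc (S K) j) <= 7 * (1 / 100) ^+ K.
  pose E : R := 1 + kappa R * (m%:R * m%:R).
  have E1 : 1 <= E by rewrite lerDl mulr_ge0 ?kappa_ge0// mulr_ge0.
  have p0 : 0 < (1 / 100 : R) ^+ K by rewrite exprn_gt0//; lra.
  pose d : R := (1 / 100) ^+ K / (2 * E); have d0 : 0 < d by rewrite divr_gt0//; lra.
  have d1 : d <= 1.
    rewrite /d ler_pdivrMr ?mul1r; last by lra.
    apply: (@le_trans _ _ 1); last by lra.
    by rewrite exprn_ile1//; lra.
  have [N0 HN] := geo_small (2 * (B / (1 - 1 / 10))) l1 d0.
  have Hd j : normc (xs j - tc (S (K + N0)) j) <= d.
    rewrite tS ncBC; apply: le_trans (Hxs j _) _; apply: le_trans (HN _ (leq_addl K N0)).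
    by rewrite le_eqVlt; apply/orP; left; apply/eqP; ring.
  rewrite (_ : (fun j => _) = fun j => lam ^+ K * (\sum_(k < N0) lam ^+ k * y (K + k)%N j)
      + (xs j - tc (S (K + N0)) j)); last first.
    apply/funext => j; rewrite !tS.
    rewrite -(big_mkord xpredT (fun k => lam ^+ k * y k j)).
    rewrite -[X in _ = _ + (_ - X)](big_mkord xpredT (fun k => lam ^+ k * y k j)).
    rewrite (big_cat_nat (leq0n K) (leq_addr N0 K))/=.
    rewrite -{5}[K]add0n big_addn addKn [X in _ - (_ + X)]big_mkord mulr_sumr.
    rewrite [X in _ - (_ + X)](_ : _ = \sum_(k < N0) lam ^+ K * (lam ^+ k * y (K + k)%N j)).
      by ring.
    by apply: eq_bigr => k _; rewrite mulrA -exprD addnC.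
  apply: le_trans (qsqD _ _ _) _; rewrite qsqZ ncX nc_lam -exprM mulnC exprM.
  have -> : (1 / 10 : R) ^+ 2 = 1 / 100 by lra.
  have a1 := A m N0 K; have a2 := qsq_small m Hd; rewrite -/E in a2.
  have a3 : E * d ^+ 2 <= (1 / 100) ^+ K / 2.
    apply: (@le_trans _ _ (E * d)); first by rewrite ler_wpM2l//; [lra|nra].
    rewrite /d le_eqVlt; apply/orP; left; apply/eqP; field; lra.
  have a4 := ler_wpM2l (ltW p0) a1.
  move: a2 a3 a4; set P := (1 / 100) ^+ K; set Q := qsq _ _; set Q' := qsq _ _; lra.
have tE K : tc (fun z => x z - S K z) = fun j => xs j - tc (S K) j.
  by rewrite (tcB hx (dirichlet_hol (dS K))) xE.
exists x; last by move=> K; apply: dsq_le => m; rewrite tE.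
apply: dirichletI => //; exists (7 / kappa R) => m.
rewrite ler_pdivlMr ?kappa_gt0// mulrC; have := T m 0%N; rewrite expr0 mulr1 /dsum xE.
have -> : (fun j => xs j - tc (S 0%N) j) = xs.
  by apply/funext => j; rewrite tS big_ord0 subr0.
by apply: le_trans; rewrite lerDr sqr_ge0.
Qed.

End UniformBoundedness.

Section BoundedOperators.
Variable R : realType.
Implicit Types (f g h x u : R[i] -> R[i]) (z c : R[i]).

Lemma dsqZ c f : dirichlet f -> dsq (fun z => c * f z) = normc c ^+ 2 * dsq f.
Proof.
move=> hf; have hh := dirichlet_hol hf; apply/eqP; rewrite eq_le; apply/andP; split.
  apply: dsq_le => m; rewrite (tcZ c hh) qsqZ ler_wpM2l ?sqr_ge0//.
  exact: qsq_le_dsq.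
have [c0|c0] := eqVneq c 0.
  by rewrite c0 normc0 expr0n/= mul0r; apply: dsq_ge0; exact: dirichletZ.
have p : 0 < normc c ^+ 2 by rewrite exprn_gt0// nc_gt0.
rewrite mulrC -ler_pdivlMr//; apply: dsq_le => m; rewrite ler_pdivlMr// mulrC -qsqZ -tcZ//.
by apply: qsq_le_dsq; exact: dirichletZ.
Qed.

Section Operator.
Variable W : (R[i] -> R[i]) -> R[i] -> R[i].
Hypothesis WD : forall f g, W (fun z => f z + g z) = (fun z => W f z + W g z).
Hypothesis WZ : forall c f, W (fun z => c * f z) = (fun z => c * W f z).
Hypothesis Wdir : forall f, dirichlet f -> dirichlet (W f).
Hypothesis Wcoef : forall n, exists2 B : R, 0 <= B &
  forall f, dirichlet f -> normc (tc (W f) n) ^+ 2 <= B * dsq f.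

Let Q m f := qsq m (tc (W f)).

Let QZ m c f : dirichlet f -> Q m (fun z => c * f z) = normc c ^+ 2 * Q m f.
Proof. by move=> hf; rewrite /Q WZ (tcZ c (dirichlet_hol (Wdir hf))) qsqZ. Qed.

Let QD m f g : dirichlet f -> dirichlet g ->
  Q m (fun z => f z + g z) <= 2 * Q m f + 2 * Q m g.
Proof.
move=> hf hg; rewrite /Q WD (tcD (dirichlet_hol (Wdir hf)) (dirichlet_hol (Wdir hg))).
exact: qsqD.
Qed.

Let truncation_bound m : exists2 B : R, 0 <= B & forall f, dirichlet f -> Q m f <= B * dsq f.
Proof.
have [B0 B00 HB0] := Wcoef 0.
have [C C0 HC] : exists2 C : R, 0 <= C & forall f, dirichlet f ->
    \sum_(j < m) j%:R * normc (tc (W f) j) ^+ 2 <= C * dsq f.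
  elim: m => [|n [C C0 IH]]; first by exists 0 => // f _; rewrite big_ord0 mul0r.
  have [B B1 HB] := Wcoef n; exists (C + n%:R * B); first by rewrite addr_ge0// mulr_ge0.
  move=> f hf; rewrite big_ord_recr/= mulrDl lerD ?IH// -mulrA ler_wpM2l//.
  exact: HB.
exists (B0 + kappa R * C); first by rewrite addr_ge0// mulr_ge0// kappa_ge0.
move=> f hf; rewrite /Q /qsq mulrDl lerD ?HB0// -mulrA ler_wpM2l ?kappa_ge0//.
exact: HC.
Qed.

(** Taking the bound least gives a unit vector that nearly attains it; the term it
    contributes to the series below then outweighs all later ones. *)
Let optimal_bound m : exists B : R, [/\ 0 <= B, forall f, dirichlet f -> Q m f <= B * dsq f &
  0 < B -> exists f, [/\ dirichlet f, dsq f <= 1 & B / 2 <= Q m f]].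
Proof.
have [C C0 HC] := truncation_bound m.
pose V := [set Q m f | f in [set f | dirichlet f /\ dsq f <= 1]].
have V0 : V 0.
  exists (fun=> 0); last first.
    rewrite /Q (_ : W (fun=> 0) = fun=> 0); last first.
      have := WZ 0 (fun=> 0); rewrite (_ : (fun z => 0 * 0) = (fun=> 0 : R[i])).
        by move=> ->; apply/funext => z; rewrite mul0r.
      by apply/funext => z; rewrite mul0r.
    apply/le_anti; rewrite qsq_ge0 andbT.
    apply: le_trans (@qsq_small R m _ 0 _) _ => [j|]; last by rewrite expr0n/= mulr0.
    by rewrite tc_cst; case: j => [|j]; rewrite normc0.
  split; first exact: dirichlet_cst.
  apply: dsq_le => m'; apply: le_trans (@qsq_small R m' _ 0 _) _ => [j|].
    by rewrite tc_cst; case: j => [|j]; rewrite normc0.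
  by rewrite expr0n/= mulr0.
have ubV : has_ubound V.
  exists C => _ [f [hf f1] <-]; apply: le_trans (HC f hf) _.
  by rewrite -[leRHS]mulr1 ler_wpM2l.
have sV : has_sup V by split => //; exists 0.
exists (sup V); split.
- exact: ub_le_sup.
- move=> f hf; have s0 := dsq_ge0 hf.
  have [s1|s1] := eqVneq (dsq f) 0; first by have := HC f hf; rewrite s1 !mulr0.
  have sp : 0 < dsq f by rewrite lt_neqAle eq_sym s1.
  pose t : R := (Num.sqrt (dsq f))^-1.
  have t2 : normc t%:C ^+ 2 = (dsq f)^-1.
    by rewrite ncR ger0_norm ?invr_ge0 ?sqrtr_ge0// exprVn sqr_sqrtr.
  have : Q m (fun z => t%:C * f z) <= sup V.
    apply: (ub_le_sup ubV); exists (fun z => t%:C * f z); last by reflexivity.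
    split; first exact: dirichletZ.
    by rewrite (dsqZ _ hf) t2 mulVf.
  by rewrite (QZ _ _ hf) t2 mulrC ler_pdivrMr.
move=> B0; have B2 : 0 < sup V / 2 by rewrite divr_gt0.
have [_ [f [hf f1] <-] Hf] := sup_adherent B2 sV.
  by exists f; split; [exact: hf|exact: f1|lra].
Qed.

(** Uniform boundedness by a gliding hump: at each stage the sign is chosen by the
    parallelogram identity so that the new term does not decrease the norm. *)
Theorem uniform_boundedness : exists2 M : R, 0 <= M &
  forall f, dirichlet f -> dsq (W f) <= M * dsq f.
Proof.
have /choice[B HB] := optimal_bound.
have [[M HM]|nM] := pselect (exists M : R, forall m, B m <= M).
  have M0 : 0 <= M by apply: le_trans (HM 0%N); have [] := HB 0%N.
  exists M => // f hf; apply: dsq_le => m; have [_ H _] := HB m.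
  by apply: le_trans (H f hf) _; rewrite ler_wpM2r// dsq_ge0.
have big (C : R) : exists m, C < B m.
  apply: contrapT => H; apply: nM; exists C => m; rewrite leNgt; apply/negP => h.
  by apply: H; exists m.
have /choice[m Hm] k : exists m, (k.+1%:R : R) * 100 ^+ k < B m by exact: big.
have Bp k : 0 < B (m k).
  by apply: le_lt_trans (Hm k); rewrite mulr_ge0// exprn_ge0.
have /choice[F HF] k : exists f, [/\ dirichlet f, dsq f <= 1 & B (m k) / 2 <= Q (m k) f].
  by have [_ _ H] := HB (m k); exact: H (Bp k).
pose step k (eps : R[i]) (S : R[i] -> R[i]) z := S z + lam R ^+ k * (eps * F k z).
have sign k S : exists eps : R[i], normc eps = 1 /\ (dirichlet S ->
    Q (m k) (fun z => lam R ^+ k * F k z) <= Q (m k) (step k eps S)).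
  have [hS|nS] := pselect (dirichlet S); last first.
    by exists 1; split; [exact: normc1|move=> h; case: (nS h)].
  have [hF _ _] := HF k; have hG := dirichletZ (lam R ^+ k) hF.
  set G := fun z => lam R ^+ k * F k z in hG *.
  have E1 : step k 1 S = fun z => S z + G z by apply/funext => z; rewrite /step mul1r.
  have E2 : step k (-1) S = fun z => S z + -1 * G z.
    by apply/funext => z; rewrite /step mulrCA.
  have := qsq_parallelogram (m k) (tc (W S)) (tc (W G)).
  have hWS := dirichlet_hol (Wdir hS); have hWG := dirichlet_hol (Wdir hG).
  have F1 : Q (m k) (step k 1 S) = qsq (m k) (fun j => tc (W S) j + tc (W G) j).
    by rewrite E1 /Q WD (tcD hWS hWG).
  have F2 : Q (m k) (step k (-1) S) = qsq (m k) (fun j => tc (W S) j - tc (W G) j).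
    rewrite E2 /Q WD WZ (tcD hWS (holZ (-1) hWG)) (tcZ (-1) hWG).
    by congr qsq; apply/funext => j; rewrite mulN1r.
  rewrite -F1 -F2 => P; have := qsq_ge0 (m k) (tc (W S)) => P0.
  have [h|h] := leP (Q (m k) G) (Q (m k) (step k 1 S)); first by exists 1; split; [exact: normc1|move=> _; exact: h].
  exists (-1); split=> [|_]; first by rewrite ncN normc1.
  by move: P; rewrite -/(Q (m k) G); lra.
have /choice[sg Hsg] (p : nat * (R[i] -> R[i])) := sign p.1 p.2.
have [S [S0 SS]] : exists S : nat -> R[i] -> R[i],
    S 0%N = (fun=> 0) /\ forall k, S k.+1 = step k (sg (k, S k)) (S k).
  by exists (fix S k := if k is j.+1 then step j (sg (j, S j)) (S j) else fun=> 0).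
pose g k z := sg (k, S k) * F k z.
have dF k : dirichlet (F k) by have [hF _ _] := HF k; exact: hF.
have dg k : dirichlet (g k) by exact: (dirichletZ _ (dF k)).
have g1 k : dsq (g k) <= 1.
  have [s1 _] := Hsg (k, S k); rewrite /g (dsqZ _ (dF k)) s1 expr1n mul1r.
  by have [_ H _] := HF k; exact: H.
have SE K : S K = fun z => \sum_(k < K) lam R ^+ k * g k z.
  elim: K => [|K IH]; first by rewrite S0; apply/funext => z; rewrite big_ord0.
  by rewrite SS /step; apply/funext => z; rewrite big_ord_recr /= {1}IH.
have dS K : dirichlet (S K).
  elim: K => [|K IH]; first by rewrite S0; exact: dirichlet_cst.
  by rewrite SS; exact: (dirichletD IH (dirichletZ _ (dg K))).
have [x hx Hx] := dirichlet_complete dg g1.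
exfalso.
have key k : 36 / 100 * k%:R <= 2 * dsq (W x).
  have dR : dirichlet (fun z => S k.+1 z - x z) by exact: (dirichletB (dS k.+1) hx).
  have r1 : dsq (fun z => S k.+1 z - x z) <= 7 * (1 / 100) ^+ k.+1.
    have Hx' : dsq (fun z => x z - S k.+1 z) <= 7 * (1 / 100) ^+ k.+1.
      by rewrite (SE k.+1); exact: Hx.
    apply: le_trans Hx'.
    have := dsqZ (-1) (dirichletB hx (dS k.+1)); rewrite ncN normc1 expr1n mul1r => <-.
    by rewrite (_ : (fun z => S k.+1 z - x z) = (fun z => -1 * (x z - S k.+1 z)))//; apply/funext => z; ring.
  have q1 : Q (m k) (S k.+1) <= 2 * Q (m k) x + 2 * Q (m k) (fun z => S k.+1 z - x z).
    rewrite [X in Q _ X <= _](_ : _ = fun z => x z + (S k.+1 z - x z)); first exact: QD.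
    by apply/funext => z; rewrite addrC subrK.
  have q2 := qsq_le_dsq (m k) (Wdir hx); rewrite -/(Q (m k) x) in q2.
  have [_ H1 _] := HB (m k); have q3 := H1 _ dR.
  have q4 := ler_wpM2l (ltW (Bp k)) r1.
  have [_ /(_ (dS k)) q5] := Hsg (k, S k).
  rewrite -SS (QZ _ _ (dF k)) ncX nc_lam -exprM mulnC exprM in q5.
  have [_ _ q6] := HF k.
  have p0 : 0 < (1 / 100 : R) ^+ k by rewrite exprn_gt0//; lra.
  have E : (1 / 10 : R) ^+ 2 = 1 / 100 by lra.
  rewrite E in q5; have q7 := ler_wpM2l (ltW p0) q6.
  have q8 : k%:R <= (1 / 100) ^+ k * B (m k).
    have := ltW (Hm k) => /(ler_wpM2l (ltW p0)); apply: le_trans.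
    rewrite mulrCA -exprMn (_ : 1 / 100 * 100 = 1 :> R); last by lra.
    by rewrite expr1n mulr1 ler_nat.
  rewrite exprS in q4.
  move: q1 q2 q3 q4 q5 q7 q8; rewrite /=.
  move: (Q _ _) (Q _ _) (Q _ _) (Q _ _) => a1 a2 a3 a4.
  move: (B (m k)) ((1 / 100) ^+ k) => b p; lra.
have := key (Num.truncn (10 * dsq (W x))).+1.
have := truncnS_gt (10 * dsq (W x)); have := dsq_ge0 (Wdir hx); lra.
Qed.

End Operator.
End BoundedOperators.

(** * Multipliers for a finite Blaschke product *)

Section Sufficiency.
Variable R : realType.
Implicit Types (f g u phi : R[i] -> R[i]) (z c a : R[i]).

Lemma finite_blaschkeE phi : self_map_disc phi -> finite_blaschke phi ->
  exists c a s, [/\ normc c = 1, in_disc (a :: s) &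
    forall z, disc z -> phi z = blaschke c (a :: s) z].
Proof.
move=> [_ self] [c [s [c1 hs E]]].
have c1' : normc c = 1 by apply: (@complexI R); rewrite -normcE' c1.
case: s hs E => [_ E|a s hs E]; last by exists c, a, s; split; [exact: c1'|exact: hs|exact: E].
have := self 0 (@disc0 R); rewrite E; last exact: disc0.
by rewrite big_nil mulr1 discE c1' ltxx.
Qed.

(** Cauchy's estimate on a disc that [phi] maps into a smaller disc, where point
    evaluations are bounded. *)
Lemma wcomp_coef u c a s : normc c = 1 -> in_disc (a :: s) -> dirichlet u ->
  (forall f, dirichlet f -> dirichlet (fun z => u z * f (blaschke c (a :: s) z))) ->
  forall n, exists2 B : R, 0 <= B & forall f, dirichlet f ->
    normc (tc (fun z => u z * f (blaschke c (a :: s) z)) n) ^+ 2 <= B * dsq f.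
Proof.
move=> c1 hs hu Wd n; have [rho hr Hrho] := blaschke_half c1 hs.
have [r0 r1] := andP hr; have r2 : 0 < 1 - rho by lra.
pose U := Num.sqrt (htotal u) / (1 - 1 / 2).
have U0 : 0 <= U by apply: divr_ge0; [exact: sqrtr_ge0|lra].
pose k1 := 1 + (kappa R)^-1.
have k0 : 0 <= k1 by rewrite addr_ge0// invr_ge0 kappa_ge0.
exists ((2 ^+ n * (U / (1 - rho))) ^+ 2 * k1); first by rewrite mulr_ge0 ?sqr_ge0.
move=> f hf; pose V := Num.sqrt (htotal f).
have bf := dbounded_hbounded (dirichlet_dbounded hf).
have bu := dbounded_hbounded (dirichlet_dbounded hu).
have H : normc (tc (fun z => u z * f (blaschke c (a :: s) z)) n) <= 2 ^+ n * (U * (V / (1 - rho))).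
  apply: cauchy_coef; first exact: (dirichlet_hol (Wd f hf)).
  move=> z hz; have dz : disc z by rewrite discE; lra.
  rewrite ncM; apply: ler_pM => //.
    apply: le_trans (point_bound (dirichlet_hol hu) bu dz) _.
    by rewrite ler_wpM2l ?sqrtr_ge0// lef_pV2 ?posrE; lra.
  have hw := Hrho z hz; have dw : disc (blaschke c (a :: s) z) by exact: blaschke_disc_map.
  apply: le_trans (point_bound (dirichlet_hol hf) bf dw) _.
  by rewrite ler_wpM2l ?sqrtr_ge0// lef_pV2 ?posrE; lra.
have V2 : V ^+ 2 <= k1 * dsq f by rewrite sqr_sqrtr ?htotal_ge0// htotal_le_dsq.
have P0 : 0 <= 2 ^+ n * (U * (V / (1 - rho))).
  apply: mulr_ge0; first exact: exprn_ge0.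
  by apply: mulr_ge0 => //; apply: divr_ge0; [exact: sqrtr_ge0|exact: ltW].
apply: le_trans (lerXn2r 2 (normc_ge0 _) P0 H) _.
have -> : (2 ^+ n * (U * (V / (1 - rho)))) ^+ 2 = (2 ^+ n * (U / (1 - rho))) ^+ 2 * V ^+ 2.
  by ring.
by rewrite -[leRHS]mulrA; apply: ler_wpM2l => //; exact: sqr_ge0.
Qed.

Theorem blaschke_multipliers phi : self_map_disc phi -> finite_blaschke phi ->
  wcomp_multiplier phi = @multiplier R.
Proof.
move=> self fb; have [c [a [s [c1 hs E]]]] := finite_blaschkeE self fb.
have [d [e [he Hmod]]] := blaschke_module c1 hs.
apply/seteqP; split => u.
  move=> [hu [Wd _]] g hg; have [G [dG EG]] := Hmod g hg.
  have h i : dirichlet (fun z => if (i < d)%N then e i z * (u z * G i (phi z)) else 0).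
    case hi: (i < d)%N; last exact: dirichlet_cst.
    exact: (he i _ (Wd _ (dG i hi))).
  apply: dirichlet_ext (dirichlet_sum (index_enum 'I_d) (fun i : 'I_d => h i)) => z hz /=.
  rewrite EG// mulr_sumr; apply: eq_bigr => i _.
  by rewrite ltn_ord E// mulrCA.
move=> hm; have hu : dirichlet u.
  by apply: dirichlet_ext (hm _ (dirichlet_cst 1)) => z _; rewrite mulr1.
have Wd f : dirichlet f -> dirichlet (fun z => u z * f (blaschke c (a :: s) z)).
  by move=> hf; apply: hm; exact: dirichlet_comp.
have WE f z : disc z -> u z * f (blaschke c (a :: s) z) = wcomp u phi f z.
  by move=> hz; rewrite /wcomp E.
have [M M0 HM] := uniform_boundedness
  (W := fun f z => u z * f (blaschke c (a :: s) z))
  (fun f g => funext (fun z => mulrDr _ _ _)) (fun k f => funext (fun z => mulrCA _ _ _))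
  Wd (wcomp_coef c1 hs hu Wd).
split; first exact: hu.
split=> [f hf|]; first exact: dirichlet_ext (WE f) (Wd f hf).
exists (Num.sqrt M) => f hf.
have hW : dirichlet (wcomp u phi f) by exact: dirichlet_ext (WE f) (Wd f hf).
rewrite (dirichlet_normE hW) (dirichlet_normE hf) -sqrtrM// ler_wsqrtr//.
apply: le_trans (HM f hf).
rewrite /dsq (tc_ext (WE f) (dirichlet_hol (Wd f hf))).
by rewrite (dtotal_ext (WE f) (dirichlet_hol (Wd f hf))).
Qed.

End Sufficiency.

(** * Radial limits of inner functions *)

Section InnerFunctions.
Variable R : realType.
Local Notation mu := (@lebesgue_measure R).
Implicit Types (f g phi : R[i] -> R[i]) (z w a c : R[i]).

Lemma tc_kern a n : disc a -> tc (kern a) n = a^* ^+ n.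
Proof.
move=> ha; have hk : hol (kern a) := hol_den_inv ha.
have E : tc (fun z => (1 - a^* * z) * kern a z) = (fun n => if n is 0%N then 1 else 0).
  rewrite -(tc_cst 1) -(@tc_ext _ (fun=> 1) (fun z => (1 - a^* * z) * kern a z))//.
    by move=> z hz; rewrite /kern mulfV// den_neq0.
  exact: hol_cst.
rewrite tc_den// in E; elim: n => [|n IH].
  by have := congr1 (fun u => u 0%N) E; rewrite /= mulr0 subr0 expr0.
by have := congr1 (fun u => u n.+1) E => /= /eqP; rewrite subr_eq0 IH exprS => /eqP.
Qed.

Lemma kern_conj a w z : a^* = w -> kern a z = (1 - w * z)^-1.
Proof. by move=> <-. Qed.

(** The mean square of [kern c] over the unit circle. A rescaled kernel takes the same
    values on a smaller circle, where Parseval's identity applies. *)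
Lemma kern_circle_ge c (r : R) N : disc c -> normc c < r -> r < 1 ->
  exists F, [/\ hol F, forall t, F (r%:C * cis t) = kern c (cis t) &
  ((2 * pi * \sum_(n < N) (normc c ^+ 2) ^+ n)%:E <=
    \int[mu]_(t in `[0%R, (2 * pi)%R]) (normc (F (r%:C * cis t)) ^+ 2)%:E)%E].
Proof.
move=> hc cr r1; have r0 : 0 < r by rewrite (le_lt_trans _ cr).
have rC : r%:C != 0 :> R[i] by rewrite eq_complex /= eqxx andbT gt_eqF.
have [a [ha aJ an]] : exists a : R[i], [/\ disc a, a^* = c^* / r%:C & normc a = normc c / r].
  have an : normc (c^* / r%:C)^* = normc c / r by rewrite ncJ ncM ncJ ncV ncR gtr0_norm.
  exists (c^* / r%:C)^*; split; [|by rewrite conjcK|exact: an].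
  by rewrite discE an ltr_pdivrMr// mul1r.
have hr : 0 <= r < 1 by rewrite ltW.
exists (kern a); split; first exact: hol_den_inv.
  by move=> t; rewrite (kern_conj _ aJ) mulrA divfK.
have := circle_parseval (hol_den_inv ha : hol (kern a)) hr; apply: cvge_ge.
exists N => // m /= Nm; rewrite lee_fin ler_wpM2l ?(ltW (pi2_gt0 R))//.
have E n : normc (tc (kern a) n) ^+ 2 * (r ^+ n) ^+ 2 = (normc c ^+ 2) ^+ n.
  by rewrite tc_kern// ncX ncJ an -!exprMn divfK ?gt_eqF// -!exprM mulnC.
under [leRHS]eq_bigr do rewrite E.
apply: (@nneg_partial_mono _ (fun n => (normc c ^+ 2) ^+ n)) => // n.
by rewrite exprn_ge0 ?sqr_ge0.
Qed.

(** The squared Hardy norm of [kern c * f] is at least that of [kern c], which is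
    [1 / (1 - |c|^2)]. This is the trace of unimodular boundary values that survives the
    removal of zeros. *)
Definition full_modulus f := forall c, disc c -> forall M : R,
  (forall N, hsum (fun z => kern c z * f z) N <= M) -> 1 <= (1 - normc c ^+ 2) * M.

Lemma radial_sequence phi t w : (phi (r%:C * cis t) : R[i]^o) @[r --> (1 : R)^'-] --> (w : R[i]^o) ->
  (fun k : nat => normc (phi ((1 - k.+1%:R^-1)%:C * cis t))) @ \oo --> normc w.
Proof.
move=> /cvgrPdist_le H; apply/cvgrPdist_le => e e0.
have eC : 0 < e%:C :> R[i] by rewrite ltcR.
have : \forall r \near (1 : R)^'-, normc (w - phi (r%:C * cis t)) <= e.
  by apply: filterS (H _ eC) => r; rewrite normcE' lecR.
rewrite /at_left near_withinE => -[d /= d0 Hd].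
have [K HK] : exists K : nat, d^-1 < K%:R.
  by exists (Num.truncn d^-1).+1; exact: truncnS_gt.
exists K => // k /= hk.
rewrite (le_trans (nc_lip _ _))//; apply: Hd => /=; last by rewrite ltrBlDr ltrDl invr_gt0.
rewrite opprB addrC subrK gtr0_norm ?invr_gt0// -[d]invrK ltf_pV2 ?posrE ?invr_gt0//.
by rewrite (lt_le_trans HK)// ler_nat ltnW// ltnS.
Qed.

Lemma kern_sequence c t : disc c ->
  (fun k : nat => normc (kern c ((1 - k.+1%:R^-1)%:C * cis t))) @ \oo --> normc (kern c (cis t)).
Proof.
move=> hc; rewrite /kern; under eq_fun do rewrite ncV; rewrite ncV.
apply: cvgV.
  rewrite nc_eq0; apply/eqP => E; have : normc (c^* * cis t) = 1.
    by rewrite -(normc1 R); congr normc; apply/esym/eqP; rewrite -subr_eq0 E.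
  by rewrite ncM ncJ nc_cis mulr1 => h; move: hc; rewrite discE h ltxx.
apply/cvgrPdist_le => e e0.
exists (Num.truncn e^-1).+1 => // k /= hk.
rewrite (le_trans (nc_lip _ _))//.
rewrite (_ : _ - _ = - (c^* * cis t * (k.+1%:R^-1)%:C)); last by rewrite rmorphB/=; ring.
rewrite ncN !ncM ncJ nc_cis mulr1 ncR gtr0_norm ?invr_gt0//.
apply: (@le_trans _ _ (1 * k.+1%:R^-1)).
  by rewrite ler_wpM2r ?invr_ge0//; move: hc; rewrite discE => /ltW.
rewrite mul1r -[e]invrK lef_pV2 ?posrE ?invr_gt0//.
by rewrite (le_trans (ltW (truncnS_gt _)))// ler_nat ltnW// ltnS.
Qed.

(** Dominated convergence along radii tending to one; the limit of the integrand is
    almost everywhere that of the kernel alone. *)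
Lemma inner_full_modulus phi : self_map_disc phi -> inner_disc phi -> full_modulus phi.
Proof.
move=> [hol_phi self] [_ _ rad] c hc M HM.
have hphi : hol phi by exact/holP.
have hk := hol_kern_mul hc hphi; have g := disc_gap hc.
have c1 : normc c < 1 by rewrite -discE.
pose r := (1 + normc c) / 2.
pose rk k : R := 1 - k.+1%:R^-1.
have hrk k : 0 <= rk k < 1.
  by rewrite /rk subr_ge0 invf_le1// ler1n/= ltrBlDr ltrDl invr_gt0.
pose G k t := (normc (kern c ((rk k)%:C * cis t) * phi ((rk k)%:C * cis t)) ^+ 2)%:E.
have IG k : (\int[mu]_(t in `[0%R, (2 * pi)%R]) G k t <= (2 * pi * M)%:E)%E.
  have := circle_parseval hk (hrk k); apply: cvge_le; apply: nearW => N.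
  rewrite lee_fin ler_wpM2l ?(ltW (pi2_gt0 R))// (le_trans _ (HM N))//.
  apply: ler_sum => n _; rewrite -[leRHS]mulr1 ler_wpM2l ?sqr_ge0//.
  by rewrite exprn_ile1 ?exprn_ge0 ?exprn_ile1//; have /andP[h1 h2] := hrk k; lra.
have key N : \sum_(n < N) (normc c ^+ 2) ^+ n <= M.
  have [F [hF FE HF]] := @kern_circle_ge c r N hc (ltac:(rewrite /r; lra)) (ltac:(rewrite /r; lra)).
  have hr : 0 <= r < 1 by apply/andP; split; rewrite /r; have := normc_ge0 c; lra.
  rewrite -(ler_pM2l (pi2_gt0 R)) -lee_fin; apply: le_trans HF _.
  have [] := @dominated_convergence _ _ _ mu `[0, 2 * pi]%classic (measurable_itv _)
    G (fun t => (normc (F (r%:C * cis t)) ^+ 2)%:E) (fun=> (((1 - normc c)^-1) ^+ 2)%:E).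
  - by move=> k; exact: (measurable_circle hk (hrk k)).
  - exact: (measurable_circle hF hr).
  - move: rad; apply: filterS; first exact: (ae_filter_ringOfSetsType mu).
    move=> t Ht ht; have [w hw w1] := Ht ht.
    have {}w1 : normc w = 1 by apply: (@complexI R); rewrite -normcE' w1.
    apply: cvg_EFin; first by apply: nearW.
    have H : (fun k => normc (kern c ((rk k)%:C * cis t)) * normc (phi ((rk k)%:C * cis t))) @ \oo -->
        normc (kern c (cis t)).
      rewrite -[X in _ --> X]mulr1 -w1; apply: cvgM; first exact: kern_sequence.
      exact: radial_sequence.
    pose h k := normc (kern c ((rk k)%:C * cis t)) * normc (phi ((rk k)%:C * cis t)).
    rewrite (_ : fine \o _ = (fun k => h k * h k)); last first.
      by apply/funext => k; rewrite /= ncM expr2.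
    by rewrite /= FE expr2; apply: cvgM; exact: H.
  - apply/integrableP; split; first exact: measurable_cst.
    rewrite integral_cst//= lebesgue_measure_itv/=; case: ifP => _; last by rewrite mule0.
    by rewrite -EFinB -EFinM ltry.
  - apply: aeW => t k _; rewrite /G /= ger0_norm ?sqr_ge0// lee_fin lerXn2r ?nnegrE//.
      by rewrite invr_ge0; lra.
    have dz := disc_polar t (hrk k).
    rewrite ncM -[leRHS]mulr1 ler_pM//; last by have := self _ dz; rewrite discE => /ltW.
    rewrite /kern ncV lef_pV2 ?posrE ?nc_gt0 ?den_neq0//; last by lra.
    have := ncD (1 - c^* * ((rk k)%:C * cis t)) (c^* * ((rk k)%:C * cis t)).
    rewrite subrK normc1 ncM ncJ => h.
    by have := ler_piMr (normc_ge0 c) (ltW ((discE _).1 dz)); lra.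
  move=> _ _ cv; apply: cvge_le cv; exact: nearW.
apply/ler_addgt0Pr => e e0.
have q1 : 0 <= normc c ^+ 2 < 1 by rewrite sqr_ge0/=; lra.
have [N0 HN] := geo_small 1 q1 e0; have := HN N0 (leqnn _); rewrite mul1r => h.
have := ler_wpM2l (ltW g) (key N0).
have -> : (1 - normc c ^+ 2) * \sum_(n < N0) (normc c ^+ 2) ^+ n = 1 - (normc c ^+ 2) ^+ N0.
  by have := subrX1 (normc c ^+ 2) N0; lra.
lra.
Qed.

End InnerFunctions.

(** * Inner functions in the Dirichlet space *)

Section Necessity.
Variable R : realType.
Implicit Types (f g phi psi q : R[i] -> R[i]) (z w a c : R[i]).

Lemma hsumD f g N : hol f -> hol g ->
  hsum (fun z => f z + g z) N <= 2 * hsum f N + 2 * hsum g N.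
Proof.
move=> hf hg; rewrite /hsum (tcD hf hg) !mulr_sumr -big_split/=.
by apply: ler_sum => n _; exact: ncD_sq.
Qed.

(** By full modulus the quotient [q] by [z - a] has squared Hardy norm at least
    [1 / (1 - |a|^2)], so that dividing by [mob a] lowers the Dirichlet integral by one. *)
Lemma remove_zero psi a : dirichlet psi -> full_modulus psi ->
  (forall N, hsum psi N <= 1) -> disc a -> psi a = 0 ->
  exists psi', [/\ dirichlet psi', full_modulus psi', forall N, hsum psi' N <= 1,
    dtotal psi' <= dtotal psi - 1 & forall z, disc z -> psi z = mob a z * psi' z].
Proof.
move=> dpsi fpsi h1 ha psia; have hpsi := dirichlet_hol dpsi; have g := disc_gap ha.
have [q hq E] := divide_at ha hpsi; rewrite psia in E.
have EU z : disc z -> psi z = stepU a 0 q z by exact: E.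
have bU := dbounded_ext EU hpsi (dirichlet_dbounded dpsi).
have [bL bq] := step_bounded ha hq bU.
have Em z : disc z -> psi z = mob a z * stepL a 0 q z.
  move=> hz; rewrite EU// /stepU /stepL /mob mulr0 subr0 add0r.
  by have d0 := den_neq0 ha hz; field.
have hL := hol_stepL a 0 hq.
exists (stepL a 0 q); split; first exact: dirichletI.
- move=> c hc M HM; apply: (fpsi c hc) => N; apply: le_trans (HM N).
  have hk := hol_kern_mul hc hL; apply: le_trans (mob_hsum N ha hk).
  rewrite (@hsum_ext _ (fun z => kern c z * psi z))//; last exact: hol_kern_mul.
  by move=> z hz; rewrite (Em z hz) mulrCA.
- move=> N; have := step_hardy_le ha hq bU N; rewrite normc0 expr0n/= mulr0 addr0.
  by move=> /le_trans; apply; rewrite (htotal_ext EU hpsi); exact: htotal_le.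
- have := step_dtotal ha hq bU; rewrite (dtotal_ext EU hpsi).
  suff : 1 <= (1 - normc a ^+ 2) * htotal q by lra.
  apply: (fpsi a ha) => N; apply: le_trans (hsum_le_total N bq).
  have := kernel_energy 0 N ha hq; rewrite normc0 expr0n/= mul0r addr0.
  rewrite (@hsum_ext _ (fun z => kern a z * psi z) (fun z => kern a z * (0 + (z - a) * q z)))//.
    by move=> z hz; rewrite (E z hz).
  exact: hol_kern_mul.
exact: Em.
Qed.

Lemma tc_psum (u : nat -> R[i]) N : tc (fun z => psum u z N) = (fun n => if (n < N)%N then u n else 0).
Proof.
apply: tc_unique => z hz e e0; exists N => M NM.
rewrite (_ : psum _ z M = psum u z N) ?subrr ?normc0 ?(ltW e0)//.
rewrite /psum -!(big_mkord xpredT (fun n => (if (n < N)%N then u n else 0) * z ^+ n)).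
rewrite (big_cat_nat (leq0n N) NM)/= [X in _ + X]big1_seq ?addr0; last first.
  by move=> n /=; rewrite mem_index_iota => /andP[Nn _]; rewrite ltnNge Nn mul0r.
by rewrite big_mkord; apply: eq_bigr => n _; rewrite ltn_ord.
Qed.

(** The quotient is again a polynomial, with [|q_n| <= 1 + |q_(n+1)|]; the point of the
    bound is that it does not depend on [a]. *)
Lemma poly_quotient_hsum P q a N M : disc a -> hol q ->
  (forall z, disc z -> P z = P a + (z - a) * q z) -> hol P ->
  (forall n, (N <= n)%N -> tc P n = 0) -> (forall n, normc (tc P n) <= 1) ->
  hsum q M <= N%:R * N%:R ^+ 2.
Proof.
move=> ha hq E hP P0 P1; have rec n : tc P n.+1 = tc q n - a * tc q n.+1.
  by rewrite -(tc_ext E hP) (tc_stepU a (P a) n.+1 hq).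
have q0 n : (N <= n)%N -> tc q n = 0.
  move=> Nn; apply/eqP; rewrite -nc_eq0; apply/eqP/le_anti; rewrite normc_ge0 andbT.
  have := @quotient_coef_le _ a q n 0 ha hq; rewrite mul0r; apply => m nm.
  by rewrite -rec P0 ?normc0//; apply: leqW; exact: leq_trans nm.
have t1 : normc a <= 1 by apply: ltW; rewrite -discE.
have qb n K : normc (tc q n) <= K%:R + normc (tc q (n + K)).
  elim: K => [|K IH]; first by rewrite add0r addn0.
  apply: le_trans IH _; rewrite -natr1 addnS -addrA lerD2l.
  rewrite -[tc q (n + K)](subrK (a * tc q (n + K).+1)) -rec.
  apply: le_trans (ncD _ _) _; rewrite lerD// ncM.
  by rewrite -[leRHS]mul1r ler_wpM2r.
have qN n : normc (tc q n) <= N%:R.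
  by have := qb n N; rewrite (q0 _ (leq_addl n N)) normc0 addr0.
have [NM|MN] := leqP N M; last first.
  apply: (@le_trans _ _ (\sum_(n < M) N%:R ^+ 2)).
    by apply: ler_sum => n _; rewrite lerXn2r ?nnegrE.
  by rewrite sumr_const card_ord -[leLHS]mulr_natl ler_wpM2r ?sqr_ge0// ler_nat ltnW.
rewrite /hsum -(big_mkord xpredT (fun n => normc (tc q n) ^+ 2)).
rewrite (big_cat_nat (leq0n N) NM)/= [X in _ + X]big1_seq ?addr0; last first.
  move=> n /=; rewrite mem_index_iota => /andP[Nn _].
  by rewrite q0// normc0 expr0n.
rewrite big_mkord; apply: (@le_trans _ _ (\sum_(n < N) N%:R ^+ 2)).
  by apply: ler_sum => n _; rewrite lerXn2r ?nnegrE.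
by rewrite sumr_const card_ord -[leLHS]mulr_natl.
Qed.

(** The modulus of a Dirichlet function with full modulus tends to one uniformly at
    the boundary: the defect is controlled by the quotient at [a], whose energy is
    small for the tail of the series and bounded for the polynomial part. *)
Lemma boundary_modulus psi (d : R) : dirichlet psi -> full_modulus psi ->
  (forall N, hsum psi N <= 1) -> 0 < d ->
  exists2 r0 : R, 0 <= r0 < 1 & forall a, disc a -> r0 <= normc a ->
    1 - d <= normc (psi a) ^+ 2.
Proof.
move=> dpsi fpsi h1 d0; have hpsi := dirichlet_hol dpsi.
have bpsi := dirichlet_dbounded dpsi; have d4 : 0 < d / 4 by lra.
have [N HN] : exists N, dtotal psi - d / 4 < dsum psi N.
  have [] := @sup_adherent _ (range (dsum psi)) (d / 4) d4.
    split; first by exists (dsum psi 0), 0%N.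
    by case: bpsi => M HM; exists M => _ [N _ <-]; exact: HM.
  by move=> _ [N _ <-] h; exists N.
pose P z := psum (tc psi) z N; pose T z := psi z - P z.
have hP : hol P by exact: hol_psum.
have hT : hol T by exact: holB.
have tP := tc_psum (tc psi) N; rewrite -/P in tP.
have tT n : tc T n = if (n < N)%N then 0 else tc psi n.
  by rewrite /T (tcB hpsi hP) tP; case: ifP; rewrite ?subrr ?subr0.
have DT M : dsum T M <= d / 4.
  have H : dsum T M + dsum psi N <= dsum psi (maxn M N).
    have nat f L : dsum f L = \sum_(0 <= n < L) n%:R * normc (tc f n) ^+ 2.
      by rewrite /dsum -(big_mkord xpredT (fun n => n%:R * normc (tc f n) ^+ 2)).
    rewrite !nat.
    rewrite [leRHS](big_cat_nat (leq0n N) (leq_maxr M N))/= [leLHS]addrC lerD2l.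
    have [MN|NM] := leqP M N.
      rewrite big_nat big1 => [|n /andP[_ nM]].
        by apply: sumr_ge0 => n _; exact: dterm_ge0.
      by rewrite tT (leq_trans nM MN) normc0 expr0n/= mulr0.
    rewrite (big_cat_nat (leq0n N) (ltnW NM))/= [X in X + _]big_nat [X in X + _]big1 ?add0r.
      by apply: ler_sum_nat => n /andP[Nn _]; rewrite tT ltnNge Nn.
    by move=> n /andP[_ nN]; rewrite tT nN normc0 expr0n/= mulr0.
  by have := dsum_le_total (maxn M N) bpsi; move: H HN; lra.
have bT : dbounded T by exists (d / 4).
pose K : R := N%:R * N%:R ^+ 2; have K0 : 0 <= K by rewrite mulr_ge0// sqr_ge0.
have P1 n : normc (tc psi n) <= 1.
  rewrite -(@ler_pXn2r _ 2) ?nnegrE// expr1n; apply: le_trans (h1 n.+1).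
  by rewrite /hsum big_ord_recr/= lerDr hsum_ge0.
pose s := d / (4 * (K + 1) + d); have s0 : 0 < s by rewrite divr_gt0//; lra.
have sE : s * (4 * (K + 1) + d) = d by rewrite divfK// gt_eqF//; lra.
have s1 : s < 1 by rewrite ltr_pdivrMr; lra.
exists (1 - s / 2); first by apply/andP; split; lra.
move=> a ha ra; have g := disc_gap ha.
have gs : 1 - normc a ^+ 2 <= s by have := normc_ge0 a; nra.
have [qT hqT ET] := divide_at ha hT; have [qP hqP EP] := divide_at ha hP.
have ET' z : disc z -> T z = stepU a (T a) qT z by exact: ET.
have bU := dbounded_ext ET' hT bT.
have [bL bq] := step_bounded ha hqT bU.
have I1 : (1 - normc a ^+ 2) * htotal qT <= d / 4.
  have := step_dtotal ha hqT bU; rewrite (dtotal_ext ET' hT).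
  by have := dtotal_ge0 bL; have := dtotal_le DT; lra.
have I2 M : hsum qP M <= K.
  apply: (poly_quotient_hsum M ha hqP EP hP) => n; first by move=> Nn; rewrite tP ltnNge Nn.
  by rewrite tP; case: ifP => // _; rewrite normc0.
have hq : hol (fun z => qP z + qT z) by exact: holD.
have psiE z : disc z -> psi z = psi a + (z - a) * (qP z + qT z).
  move=> hz; have := EP z hz; have := ET z hz; rewrite /T => e1 e2.
  by rewrite -[LHS](subrK (P z)) e1 e2; ring.
have := fpsi a ha (2 * K + 2 * htotal qT + normc (psi a) ^+ 2 / (1 - normc a ^+ 2)).
have bnd M : hsum (fun z => kern a z * psi z) M <=
    2 * K + 2 * htotal qT + normc (psi a) ^+ 2 / (1 - normc a ^+ 2).
  rewrite -(@hsum_ext _ (fun z => kern a z * psi z) (fun z => kern a z * (psi a + (z - a) * (qP z + qT z)))).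
  - apply: le_trans (kernel_energy (psi a) M ha hq) _; rewrite lerD2r.
    by have := hsumD M hqP hqT; have := I2 M; have := hsum_le_total M bq; lra.
  - by move=> z hz; rewrite -psiE.
  - exact: hol_kern_mul.
move=> /(_ bnd); rewrite mulrDr [X in _ + X]mulrC divfK ?gt_eqF// mulrDr.
have : (1 - normc a ^+ 2) * (2 * K) <= s * (2 * K) by rewrite ler_wpM2r// mulr_ge0.
have sK : 0 <= s * K by rewrite mulr_ge0// ltW.
have sd : 0 <= s * d by rewrite mulr_ge0// ltW.
by move: I1 sE sd sK; lra.
Qed.

(** Since [|psi|] tends to one at the boundary, the mean value property of [1 / psi] gives
    [|psi(0)| >= 1], which exhausts the Hardy norm. *)
Lemma zero_free_constant psi : dirichlet psi -> full_modulus psi ->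
  (forall N, hsum psi N <= 1) -> (forall z, disc z -> psi z != 0) ->
  exists2 c, normc c = 1 & forall z, disc z -> psi z = c.
Proof.
move=> dpsi fpsi h1 nz; have hpsi := dirichlet_hol dpsi.
have hg : hol (fun z => (psi z)^-1) by exact: hol_inv.
have p0 : 1 <= normc (tc psi 0) ^+ 2.
  apply/ler_addgt0Pr => d d0; pose e : R := Num.min d (1 / 2).
  have e0 : 0 < e by rewrite lt_min d0/=; lra.
  have e1 : e <= 1 / 2 by rewrite ge_min lexx orbT.
  have ed : e <= d by rewrite ge_min lexx.
  have [r hr Hr] := boundary_modulus dpsi fpsi h1 e0.
  have hb t : normc ((psi (r%:C * cis t))^-1) <= Num.sqrt (1 - e)^-1.
    have hz := disc_polar t hr; have := Hr _ hz.
    rewrite nc_polar ger0_norm; last by case/andP: hr.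
    move=> /(_ (lexx _)) h; rewrite -(@ler_pXn2r _ 2) ?nnegrE//.
    rewrite sqr_sqrtr; last by rewrite invr_ge0; lra.
    by rewrite ncV exprVn lef_pV2 ?posrE ?exprn_gt0 ?nc_gt0 ?nz//; lra.
  have := circle_sup 1 hg hr hb; rewrite big_ord_recl big_ord0 addr0 expr0 expr1n mulr1.
  rewrite sqr_sqrtr; last by rewrite invr_ge0; lra.
  rewrite -(tc_at0 hg) (tc_at0 hpsi) ncV exprVn lef_pV2 ?posrE ?exprn_gt0 ?nc_gt0//.
  - by move: ed; lra.
  - by rewrite -(tc_at0 hpsi); exact: (nz _ (@disc0 R)).
  - by lra.
have tz n : tc psi n.+1 = 0.
  apply/eqP; rewrite -nc_eq0 -sqrf_eq0; apply/eqP/le_anti; rewrite sqr_ge0 andbT.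
  have := h1 n.+2; rewrite /hsum big_ord_recl big_ord_recr/=.
  rewrite (_ : bump 0 n = n.+1)//; set S := \sum_(i < n) _.
  have : 0 <= S by apply: sumr_ge0 => i _; exact: sqr_ge0.
  by move: p0; lra.
exists (tc psi 0).
  have := h1 1%N; rewrite /hsum big_ord_recl big_ord0 addr0 => h2.
  by have := normc_ge0 (tc psi 0); move: p0 h2; nra.
move=> z hz; apply: (pconv_unique_val (tcP hpsi hz)).
have E : tc (fun=> tc psi 0) = tc psi by apply/funext => -[|n]; rewrite tc_cst.
by have := tcP (hol_cst (tc psi 0)) hz; rewrite E.
Qed.

(** Each zero costs one unit of a finite Dirichlet integral, so there are finitely many. *)
Lemma full_modulus_blaschke psi : dirichlet psi -> full_modulus psi ->
  (forall N, hsum psi N <= 1) ->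
  exists c s, [/\ normc c = 1, in_disc s & forall z, disc z -> psi z = blaschke c s z].
Proof.
move=> dpsi fpsi h1; move: (truncnS_gt (dtotal psi)); move: (Num.truncn _).+1 => k.
elim: k psi dpsi fpsi h1 => [|k IH] psi dpsi fpsi h1 lt.
  by have := dtotal_ge0 (dirichlet_dbounded dpsi); lra.
have [[a [ha psia]]|nz] := pselect (exists a, disc a /\ psi a = 0).
  have [psi' [d' f' h' t' E]] := remove_zero dpsi fpsi h1 ha psia.
  have [|c [s [c1 hs Es]]] := IH psi' d' f' h'; first by move: lt; rewrite -natr1; lra.
  exists c, (a :: s); split; first exact: c1.
    by move=> b; rewrite in_cons => /orP[/eqP->//|/hs].
  by move=> z hz; rewrite E// blaschke_cons Es.
have [c c1 Hc] := zero_free_constant dpsi fpsi h1 (fun z hz =>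
  introN eqP (fun e => nz (ex_intro _ z (conj hz e)))).
exists c, [::]; split=> // z hz.
by rewrite Hc// /blaschke big_nil mulr1.
Qed.

Theorem inner_dirichlet_blaschke phi : self_map_disc phi -> inner_disc phi ->
  dirichlet phi -> finite_blaschke phi.
Proof.
move=> self inn dphi; have [_ sm] := self.
have h1 N : hsum phi N <= 1.
  rewrite -(expr1n R 2); apply: hsum_le_sup; first exact: dirichlet_hol.
  by move=> z hz; apply: ltW; rewrite -discE; exact: sm.
have [c [s [c1 hs E]]] := full_modulus_blaschke dphi (inner_full_modulus self inn) h1.
exists c, s; split; [by rewrite normcE' c1|exact: hs|exact: E].
Qed.

End Necessity.

Theorem theorem2p2 (R : realType) (phi : R[i] -> R[i])
    (phi_self : self_map_disc phi) (phi_inner : inner_disc phi)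
    (phi_nonconstant : nonconstant_disc phi) :
  wcomp_multiplier phi = @multiplier R <-> finite_blaschke phi.
Proof.
split=> [E|fb]; last exact: blaschke_multipliers.
apply: inner_dirichlet_blaschke => //.
have m1 : multiplier (fun=> 1 : R[i]).
  by move=> f hf; apply: dirichlet_ext hf => z _; rewrite mul1r.
rewrite -E in m1; have [_ [W _]] := m1.
by apply: dirichlet_ext (W _ (@dirichlet_id R)) => z _; rewrite /wcomp mul1r.
Qed.
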